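(* Let $\gamma>0$, let $\{\xi(z):z\in\mathbb{Z}^d\}$ be i.i.d. Weibull($\gamma$) random variables, and for large $t$ let $Z_t^{(1)}$ be a maximiser over $z\in\mathbb{Z}^d$ of $\Psi_t(z)=\xi(z)-\frac{|z|}{\gamma t}\log\log t$. Let $$T_t=\inf\{s>0: Z_{t+s}^{(1)}\neq Z_t^{(1)}\}.$$ Then, as $t\to\infty$, $T_t/t$ converges in distribution to a nondegenerate almost surely positive random variable $\Theta$.
   Context: $d\ge1$ is an integer and $|\cdot|$ is the $\ell^1$-norm. The $\xi(z)$ are independent with $\mathrm{Prob}\{\xi(z)<x\}=1-e^{-x^{\gamma}}$ for $x\ge0$. $\Psi_t$ is defined for all $t$ large enough that $\log\log t$ is well defined and positive; almost surely a maximiser $Z_t^{(1)}$ exists for all sufficiently large $t$ (if there are several, any choice is made). *)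

(* Defs.v *)
From HB Require Import structures.
From mathcomp Require Import all_boot all_order all_algebra finmap.
From mathcomp Require Import all_classical all_reals all_analysis.

Set Implicit Arguments.
Unset Strict Implicit.
Unset Printing Implicit Defensive.

Import Order.TTheory GRing.Theory Num.Theory.
Import numFieldNormedType.Exports.

Local Open Scope classical_set_scope.
Local Open Scope ring_scope.

Definition mutually_independent (disp : measure_display)
    (Omega : measurableType disp) (R : realType) (P : probability Omega R)
    (I : choiceType) (X : I -> {RV P >-> R}) : Prop :=
  forall (J : {fset I}) (A : I -> set R), (forall i, measurable (A i)) ->
    P (\bigcap_(i in [set` J]) (X i @^-1` A i)) =
    (\prod_(i <- J) P (X i @^-1` A i))%E.

Definition weibull_distributed (disp : measure_display)
    (Omega : measurableType disp) (R : realType) (P : probability Omega R)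
    (gamma : R) (X : {RV P >-> R}) : Prop :=
  forall x : R, 0 <= x ->
    P [set w | X w < x] = (1 - expR (- (x `^ gamma)))%:E.

Definition nondegenerate_rv (disp : measure_display)
    (Omega : measurableType disp) (R : realType) (P : probability Omega R)
    (X : {RV P >-> R}) : Prop :=
  forall c : R, ~ {ae P, forall w, X w = c}.

Definition cvg_in_distribution (disp disp' : measure_display)
    (Omega : measurableType disp) (Omega' : measurableType disp')
    (R : realType) (P : probability Omega R) (P' : probability Omega' R)
    (Y : R -> {RV P >-> R}) (Theta : {RV P' >-> R}) : Prop :=
  forall x : R, {for x, continuous (cdf Theta)} ->
    cdf (Y t) x @[t --> +oo] --> cdf Theta x.

(* For extended-real maps not known to be measurable: [X t] need only agree
   almost surely, for large t, with a real random variable. *)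
Definition ae_cvg_in_distribution (disp disp' : measure_display)
    (Omega : measurableType disp) (Omega' : measurableType disp')
    (R : realType) (P : probability Omega R) (P' : probability Omega' R)
    (X : R -> Omega -> \bar R) (Theta : {RV P' >-> R}) : Prop :=
  exists2 Y : R -> {RV P >-> R},
    \forall t \near +oo, {ae P, forall w, X t w = (Y t w)%:E} &
    cvg_in_distribution Y Theta.

Definition l1norm (d : nat) (z : 'rV[int]_d) : nat := 
  (\sum_(i < d) `|z ord0 i|)%N.

Definition Psi (R : realType) (d : nat) (gamma : R) (xi : 'rV[int]_d -> R)
    (t : R) (z : 'rV[int]_d) : R :=
  xi z - (l1norm z)%:R / (gamma * t) * ln (ln t).

Definition is_maximiser (R : realType) (T : Type) (f : T -> R) (z : T) : Prop :=
  forall y, f y <= f z.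

(* Any tie-breaking rule is allowed, with no measurability requirement.
   Existence of a maximiser is not part of the hypothesis: [Z t w] is
   unconstrained where there is none. *)
Definition maximiser_choice (R : realType) (Omega : Type) (d : nat) (gamma : R)
    (xi : Omega -> 'rV[int]_d -> R) (Z : R -> Omega -> 'rV[int]_d) : Prop :=
  \forall t \near +oo, forall w,
    (exists z, is_maximiser (Psi gamma (xi w) t) z) ->
    is_maximiser (Psi gamma (xi w) t) (Z t w).

(* Extended-real infimum, so that it is +oo when Z never changes after t. *)
Definition change_time (R : realType) (Omega : Type) (V : Type)
    (Z : R -> Omega -> V) (t : R) (w : Omega) : \bar R :=
  ereal_inf [set s%:E | s in [set s : R | 0 < s /\ Z (t + s) w <> Z t w]].

(* Main.v *)
(** Let [c] be the slope of the penalty at time [t] and [c'] its slope at time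
[(1 + x) t], so that [c' / c] tends to [theta = 1 / (1 + x)]. A maximiser for
both slopes maximises for every slope in between, and a site that has been
overtaken never returns; hence the maximiser does not change before [(1 + x) t]
iff some site maximises for [c] and [c'] simultaneously.

The probability of this event is a sum over the sites [z] (ties being
negligible). Conditionally on [xi z], independence makes each term a product of
Weibull distribution functions, and on the right spatial scale [r] it converges
to an exponential of an integral. Summing over [z] with cut-offs in space and
height gives Riemann sums that converge to truncations of
  [persistence d theta = \int kappa p^(d-1) / D_theta p dp], where
  [D_theta p = \int kappa q^(d-1) exp (- min (q - p) (theta (q - p))) dq].
Nothing is lost in the cut-offs: for [theta = 1] the integrand is the density
of a Gamma law, so the limit [persistence d 1 = 1] already carries all the mass,
and it also shows that maximisers exist almost surely. The limit law then has
distribution function [x |-> 1 - persistence d (1 / (1 + x))]. *)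

Require Import Defs.
From HB Require Import structures.
From mathcomp Require Import all_boot all_order all_algebra finmap.
From mathcomp Require Import all_classical all_reals all_analysis.
From mathcomp Require Import measurable_realfun ring lra.

Set Implicit Arguments.
Unset Strict Implicit.
Unset Printing Implicit Defensive.

Import Order.TTheory GRing.Theory Num.Theory.
Import numFieldNormedType.Exports.

Local Open Scope classical_set_scope.
Local Open Scope ring_scope.


(** No conditional law is formed. The height of a site is measured by the argument [x] of [level],
    in which its law is [dx / r ^+ d], and this axis is cut into cells. On a cell, replacing the
    height of [z] in the thresholds of its rivals by the lower or the upper end of the cell yields a
    product event ([winner_event]) inside or around the event that [z] wins. The sum over the cells
    is a Riemann sum for [escape], the integral of [exp (- x * D)].

    The upper bound needs no estimate of the sites beyond the cut-offs. If they miss the maximiser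
    for the slope [c], an event of probability one minus the truncated sum for the pair [(c, c)]
    occurs, and this is small because [persistence d 1 = 1].

    Two obstacles concern time. [Z] need not be measurable, so the change time is compared, off a
    null set, with an infimum over rational delays. And ties cannot be excluded at all times at
    once, since the maximiser changes through a tie; uniqueness is used at the initial time only,
    and the change is located up to an arbitrarily small delay. *)

(** * Elementary limits and inequalities for powers and logarithms *)

Lemma cvgryMl (R : realType) (k : R) (a : nat -> R) : 0 < k ->
  a @ \oo --> +oo -> (fun n => k * a n) @ \oo --> +oo.
Proof.
move=> k0 /cvgryPge ay; apply/cvgryPge => A.
by apply: filterS (ay (k^-1 * A)) => n; rewrite ler_pdivrMl.
Qed.

Lemma cvgryV (R : realType) (a : nat -> R) :
  a @ \oo --> +oo -> (fun n => (a n)^-1) @ \oo --> (0 : R).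
Proof.
move=> ay; apply: (proj2 (@gtr0_cvgV0 _ _ \oo _ a _)) => //.
by move/cvgryPgt : ay; exact.
Qed.

Lemma lnB1_le (R : realType) (x : R) : 0 < x -> ln x <= x - 1.
Proof. by move=> x0; rewrite lerBrDl -{2}(lnK x0) expR_ge1Dx. Qed.

Lemma ln_ge_1BV (R : realType) (x : R) : 0 < x -> 1 - x^-1 <= ln x.
Proof.
move=> x0; have := @lnB1_le R x^-1; rewrite invr_gt0 => /(_ x0).
rewrite lnV ?posrE// lerNl; lra.
Qed.

(** With [(1 + h)^g = exp (g * ln (1 + h))], this is [1 + y <= exp y] followed by
    [ln x >= 1 - 1 / x]. Convexity is avoided, so [g] may lie on either side of 1. *)
Lemma powR1D_ge (R : realType) (g h : R) : 0 < g -> -1 < h ->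
  g * h / (1 + h) <= (1 + h) `^ g - 1.
Proof.
move=> g0 h1; have h0 : 0 < 1 + h by lra.
apply: (@le_trans _ _ (g * ln (1 + h))).
  rewrite -mulrA ler_pM2l//; apply: le_trans (ln_ge_1BV h0).
  by rewrite -{1}(addKr 1 h) mulrDl mulfV ?gt_eqF// mulN1r addrC.
by rewrite lerBrDl /powR gt_eqF// expR_ge1Dx.
Qed.

Lemma powR1D_le (R : realType) (g h : R) : 0 < g -> -1 < h ->
  (1 + h) `^ g - 1 <= g * h * (1 + h) `^ g.
Proof.
move=> g0 h1; have h0 : 0 < 1 + h by lra.
apply: (@le_trans _ _ (g * ln (1 + h) * (1 + h) `^ g)).
  rewrite /powR gt_eqF//; set y := g * _.
  (* [1 - y <= exp (- y)], multiplied by [exp y], reads [exp y - 1 <= y * exp y]. *)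
  have := expR_ge1Dx (- y); rewrite expRN -(ler_pM2r (expR_gt0 y)).
  rewrite mulVf ?gt_eqF ?expR_gt0// mulrDl mul1r mulNr; lra.
rewrite ler_pM2r ?powR_gt0// ler_pM2l//.
by apply: (le_trans (lnB1_le h0)); lra.
Qed.

Lemma powR1D_scaled_bounds (R : realType) (g a w : R) :
  0 < g -> 0 < a -> -1 < w / (g * a) ->
  w / (1 + w / (g * a)) <= a * ((1 + w / (g * a)) `^ g - 1)
    <= w * (1 + w / (g * a)) `^ g.
Proof.
move=> g0 a0; have wE : w = a * g * (w / (g * a)) by field; rewrite !gt_eqF.
move: wE; move: (w / _) => h wE h1; rewrite wE.
by rewrite -!mulrA !ler_pM2l// !mulrA powR1D_ge// powR1D_le.
Qed.

(** First-order expansion of the Weibull exponent: multiplying a height whose exponent is [a] by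
    [1 + h] adds about [a * g * h = w] to the exponent, although [a] itself diverges. *)
Lemma cvg_powR1D_scaled (R : realType) (g mu : R) (a w : nat -> R) : 0 < g ->
  a @ \oo --> +oo -> w @ \oo --> mu ->
  (fun n => a n * ((1 + w n / (g * a n)) `^ g - 1)) @ \oo --> mu.
Proof.
move=> g0 ay wmu.
pose h n := w n / (g * a n).
have h0 : h @ \oo --> 0.
  rewrite -(mulr0 mu); apply: cvgM => //.
  by apply: cvgryV; exact: cvgryMl.
have h1 : \forall n \near \oo, -1 < h n.
  by apply: (cvgr_gt 0) => //; lra.
have D1 : (fun n => 1 + h n) @ \oo --> (1 : R).
  by rewrite -[X in _ --> X]addr0; apply: cvgD => //; exact: cvg_cst.
have P1 : (fun n => (1 + h n) `^ g) @ \oo --> (1 : R).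
  have L : (fun n => expR (g * ln (1 + h n))) @ \oo --> (1 : R).
    rewrite -[X in _ --> X]expR0 -(mulr0 g) -ln1.
    apply: continuous_cvg; first exact: continuous_expR.
    apply: cvgM; first exact: cvg_cst.
    by apply: continuous_cvg D1; exact: continuous_ln.
  apply: cvg_trans L; apply: near_eq_cvg; near=> n.
  rewrite /powR gt_eqF//.
  have : -1 < h n by near: n.
  lra.
apply: (@squeeze_cvgr _ _ _ _ (fun n => w n / (1 + h n))
                              (fun n => w n * (1 + h n) `^ g)).
- near=> n.
  have an : 0 < a n by near: n; move/cvgryPgt : ay; exact.
  have hn : -1 < h n by near: n.
  exact: powR1D_scaled_bounds.
- rewrite -[X in _ --> X]divr1; apply: cvgM => //; apply: cvgV => //.
- by rewrite -[X in _ --> X]mulr1; apply: cvgM.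
Unshelve. all: by end_near. Qed.

(** Concavity of [ln]: [1 + w / k] is the mean of [1 + w / K] and [1] with weights [K / k] and
    [1 - K / k]. It yields bounds of fixed degree [K] that are uniform in large [k]. *)
Lemma ln1D_scaled_le (R : realType) (k K w : R) : 0 < K -> K <= k -> 0 <= w ->
  K * ln (1 + w / K) <= k * ln (1 + w / k).
Proof.
move=> K0 Kk w0; have k0 : 0 < k by lra.
have t01 : 0 <= K / k <= 1.
  by apply/andP; split; [rewrite divr_ge0// ltW|rewrite ler_pdivrMr// mul1r].
pose t : {i01 R} := Itv01 (proj1 (andP t01)) (proj2 (andP t01)).
have wK : 0 < 1 + w / K by rewrite ltr_pwDl// divr_ge0// ltW.
have := @concave_ln R t (1 + w / K) 1 wK ltr01.
rewrite !convRE ln1 mulr0 mulr1 addr0 /= => H.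
rewrite -ler_pdivrMl// mulrA (mulrC k^-1).
have <- : K / k * (1 + w / K) + unstable.onem (K / k) = 1 + w / k.
  by rewrite /unstable.onem; field; rewrite !gt_eqF.
exact: H.
Qed.

(** * Weibull tails at extreme heights *)

Lemma cvg_minr (R : realType) (u v : nat -> R) (a b : R) :
  u @ \oo --> a -> v @ \oo --> b ->
  (fun n => Num.min (u n) (v n)) @ \oo --> Num.min a b.
Proof.
move=> /cvgrPdist_lt ua /cvgrPdist_lt vb; apply/cvgrPdist_lt => /= e e0.
near=> n.
have : `|a - u n| < e by near: n; exact: ua.
have : `|b - v n| < e by near: n; exact: vb.
rewrite !ltr_norml => /andP[? ?] /andP[? ?].
by case: (leP a b) => ?; case: (leP (u n) (v n)) => ?; apply/andP; split; lra.
Unshelve. all: by end_near. Qed.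

Lemma cvgry_ln (R : realType) (u : nat -> R) :
  u @ \oo --> +oo -> (fun n => ln (u n)) @ \oo --> +oo.
Proof.
move=> /cvgryPge uy; apply/cvgryPge => A; near=> n.
have un : expR A <= u n by near: n; exact: uy.
by rewrite -[A]expRK ler_ln ?posrE ?expR_gt0// (lt_le_trans (expR_gt0 A)).
Unshelve. all: by end_near. Qed.

Lemma cvgryDr (R : realType) (u : nat -> R) (k : R) :
  u @ \oo --> +oo -> (fun n => u n + k) @ \oo --> +oo.
Proof.
move=> /cvgryPge uy; apply/cvgryPge => A.
by apply: filterS (uy (A - k)) => n; rewrite lerBlDr.
Qed.

(** The maximum gives the value 1 at negative heights, which occur as thresholds since a penalty may
    be negative. *)
Definition weibull_tail (R : realType) (g v : R) : R :=
  expR (- (Num.max 0 v `^ g)).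

Lemma weibull_tail_gt0 (R : realType) (g v : R) : 0 < weibull_tail g v.
Proof. exact: expR_gt0. Qed.

Lemma weibull_tail_le1 (R : realType) (g v : R) : weibull_tail g v <= 1.
Proof. by rewrite /weibull_tail -expR0 ler_expR oppr_le0 powR_ge0. Qed.

Lemma weibull_tail_homo (R : realType) (g v w : R) : 0 < g -> v <= w ->
  weibull_tail g w <= weibull_tail g v.
Proof.
move=> g0 vw; rewrite /weibull_tail ler_expR lerN2.
by apply: (ge0_ler_powR (ltW g0)); rewrite ?nnegrE ?ge_max ?le_max ?lexx ?vw ?orbT.
Qed.

(** The shift [m] becomes a factor [1 + w / (g * a)], the form required by the expansion above. Here
    [w] is [m] times the derivative of [v^g] at the height [v = a^(1/g)]. *)
Lemma powR_levelD (R : realType) (g a m : R) : 0 < g -> 0 < a ->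
  a `^ g^-1 + m =
  a `^ g^-1 * (1 + g * a `^ (1 - g^-1) * m / (g * a)).
Proof.
move=> g0 a0; have p0 : 0 < a `^ g^-1 by rewrite powR_gt0.
rewrite powRB; last by apply/implyP => _; rewrite gt_eqF.
by rewrite powRr1 ?ltW//; field; rewrite !gt_eqF.
Qed.

Lemma weibull_tail_levelD (R : realType) (g a m : R) : 0 < g -> 0 < a ->
  -1 < g * a `^ (1 - g^-1) * m / (g * a) ->
  expR a * weibull_tail g (a `^ g^-1 + m) =
  expR (- (a * ((1 + g * a `^ (1 - g^-1) * m / (g * a)) `^ g - 1))).
Proof.
move=> g0 a0 h1; rewrite /weibull_tail powR_levelD//.
set h := _ / (g * a); rewrite -/h in h1.
have p0 : 0 < a `^ g^-1 by rewrite powR_gt0.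
rewrite max_r; last by rewrite mulr_ge0 ?ltW//; lra.
rewrite powRM ?ltW//; last by lra.
by rewrite -powRrM mulVf ?gt_eqF// powRr1 ?ltW// -expRD; congr expR; ring.
Qed.

(** At extreme heights the tail is locally exponential, for every [g]: a shift of the height
    multiplies it by [exp (- mu)], where [mu] is the limit of the shift times the local derivative
    of the exponent. *)
Lemma weibull_tail_asymp (R : realType) (g mu : R) (a m : nat -> R) : 0 < g ->
  a @ \oo --> +oo ->
  (fun n => g * a n `^ (1 - g^-1) * m n) @ \oo --> mu ->
  (fun n => expR (a n) * weibull_tail g (a n `^ g^-1 + m n)) @ \oo --> expR (- mu).
Proof.
move=> g0 ay wmu; have C := cvg_powR1D_scaled g0 ay wmu.
have a0 : \forall n \near \oo, 0 < a n by move/cvgryPgt : ay; exact.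
have h0 : (fun n => g * a n `^ (1 - g^-1) * m n / (g * a n)) @ \oo --> (0 : R).
  rewrite -(mulr0 mu); apply: cvgM => //.
  by apply: cvgryV; exact: cvgryMl.
have : (fun n => expR (- (a n * ((1 + g * a n `^ (1 - g^-1) * m n / (g * a n)) `^ g - 1)))) @ \oo --> expR (- mu).
  by apply: continuous_cvg; [exact: continuous_expR|exact: cvgN].
apply: cvg_trans; apply: near_eq_cvg; near=> n.
rewrite weibull_tail_levelD//; first by near: n.
by near: n; apply: (cvgr_gt 0) => //; lra.
Unshelve. all: by end_near. Qed.

(** For [g < 1] the exponent is concave in the height and no exponential bound holds. From
    [y^g - 1 >= g * ln y] the tail is at most [1 + w / (g * a)] to the power [- g * a], and
    [ln1D_scaled_le] lowers this growing degree to a fixed [K]. *)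
Lemma weibull_tail_domination (R : realType) (g a m : R) (K : nat) : 0 < g ->
  0 < a -> (0 < K)%N -> K%:R <= g * a -> 0 <= m ->
  expR a * weibull_tail g (a `^ g^-1 + m)
    <= ((1 + g * a `^ (1 - g^-1) * m / K%:R) ^+ K)^-1.
Proof.
move=> g0 a0 K0 Ka m0; set w := g * _ * m.
have w0 : 0 <= w by rewrite !mulr_ge0 ?powR_ge0// ltW.
have h0 : 0 <= w / (g * a) by rewrite divr_ge0// mulr_ge0// ltW.
have K0' : 0 < K%:R :> R by rewrite ltr0n.
have wK : 0 < 1 + w / K%:R by rewrite ltr_pwDl// divr_ge0// ltW.
rewrite weibull_tail_levelD//; last by rewrite -/w; lra.
rewrite -/w -[X in (X ^+ K)^-1]lnK ?posrE// -expRM_natl -expRN ler_expR lerN2.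
apply: le_trans (ln1D_scaled_le K0' Ka w0) _.
have h1 : 0 < 1 + w / (g * a) by lra.
rewrite mulrAC mulrC ler_pM2l//.
by rewrite lerBrDl /powR gt_eqF// expR_ge1Dx.
Qed.

(** The common slope of the two linear penalties, evaluated between sites at
distance [j] and [k] from the origin: a site at distance [j] does not beat a
site at distance [k] and height [v], neither with slope [c] nor with slope
[c'], iff its height is at most [v + penalty c c' k j]. *)
Definition penalty (R : realType) (c c' : R) (k j : nat) : R :=
  Num.min ((j%:R - k%:R) * c) ((j%:R - k%:R) * c').

(** The height exceeded with probability [x / r ^+ d]. *)
Definition level (R : realType) (d : nat) (g r x : R) : R :=
  (d%:R * ln r - ln x) `^ g^-1.

Lemma weibull_tail_level (R : realType) (d : nat) (g r x : R) : 0 < g -> 0 < r ->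
  0 < x -> x <= r ^+ d -> weibull_tail g (level d g r x) = x / r ^+ d.
Proof.
move=> g0 r0 x0 xr; rewrite /weibull_tail /level max_r ?powR_ge0//.
have lx : 0 <= d%:R * ln r - ln x.
  by rewrite subr_ge0 mulr_natl -lnXn// ler_ln ?posrE// exprn_gt0.
rewrite -powRrM mulVf ?gt_eqF// powRr1// opprB expRD lnK ?posrE//.
by rewrite expRN expRM_natl lnK ?posrE.
Qed.

(** [r] is the scale of the distance to the maximiser for slope [c]: by
[scaling_norm], raising a [level] by the penalty [c * r * p] divides the expected
number of sites above it by [exp p] in the limit. *)
Record scaling (R : realType) (d : nat) (g theta : R) (c c' r : nat -> R) : Prop :=
  Scaling {
    scaling_gamma : 0 < g ;
    scaling_theta : 0 < theta <= 1 ;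
    scaling_slope : forall n, 0 < c' n <= c n ;
    scaling_pos : forall n, 0 < r n ;
    scaling_ry : r @ \oo --> +oo ;
    scaling_ratio : (fun n => c' n / c n) @ \oo --> theta ;
    scaling_norm : (fun n => g * (d%:R * ln (r n)) `^ (1 - g^-1) * c n * r n)
                     @ \oo --> (1 : R) }.

Lemma scaling_height_y (R : realType) (d : nat) (g theta x : R) (c c' r : nat -> R) :
  (0 < d)%N -> scaling d g theta c c' r ->
  (fun n => d%:R * ln (r n) - ln x) @ \oo --> +oo.
Proof.
move=> d0 S; apply: cvgryDr; apply: cvgryMl; first by rewrite ltr0n.
exact/cvgry_ln/(scaling_ry S).
Qed.

(** The local rate is the same at every fixed [level x], because [ln x] is negligible against
    [d * ln r]. *)
Lemma scaling_normE (R : realType) (d : nat) (g theta x : R) (c c' r : nat -> R) :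
  (0 < d)%N -> scaling d g theta c c' r ->
  (fun n => g * (d%:R * ln (r n) - ln x) `^ (1 - g^-1) * c n * r n) @ \oo --> (1 : R).
Proof.
move=> d0 S; have ay := scaling_height_y x d0 S.
have Ly : (fun n => d%:R * ln (r n)) @ \oo --> +oo.
  by apply: cvgryMl; [rewrite ltr0n|exact/cvgry_ln/(scaling_ry S)].
have L0 : \forall n \near \oo, 0 < d%:R * ln (r n) by move/cvgryPgt : Ly; exact.
have a0 : \forall n \near \oo, 0 < d%:R * ln (r n) - ln x.
  by move/cvgryPgt : ay; exact.
have q1 : (fun n => 1 - ln x * (d%:R * ln (r n))^-1) @ \oo --> (1 : R).
  rewrite -[X in _ --> X]subr0 -(mulr0 (ln x)).
  apply: cvgB; first exact: cvg_cst.
  by apply: cvgM; [exact: cvg_cst|exact: cvgryV].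
have P1 : (fun n => expR ((1 - g^-1) * ln (1 - ln x * (d%:R * ln (r n))^-1)))
    @ \oo --> (1 : R).
  rewrite -[X in _ --> X]expR0 -(mulr0 (1 - g^-1)) -ln1.
  apply: continuous_cvg; first exact: continuous_expR.
  apply: cvgM; first exact: cvg_cst.
  by apply: continuous_cvg q1; exact: continuous_ln.
rewrite -[X in _ --> X]mulr1; apply: cvg_trans (cvgM (scaling_norm S) P1).
 apply: near_eq_cvg; near=> n.
have Ln : 0 < d%:R * ln (r n) by near: n.
have an : 0 < d%:R * ln (r n) - ln x by near: n.
have -> : d%:R * ln (r n) - ln x = d%:R * ln (r n) * (1 - ln x * (d%:R * ln (r n))^-1).
  by rewrite mulrBr mulr1 (mulrC (ln x)) mulVKf// gt_eqF.
have q0 : 0 < 1 - ln x * (d%:R * ln (r n))^-1.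
  rewrite -(ltr_pM2l Ln) mulr0 mulrBr mulr1 (mulrC (ln x)) mulVKf// gt_eqF//.
rewrite [in RHS]powRM ?ltW// [(1 - ln x * _) `^ _]/powR gt_eqF//=; ring.
Unshelve. all: by end_near. Qed.

Lemma expR_height (R : realType) (d : nat) (r x : R) : 0 < r -> 0 < x ->
  expR (d%:R * ln r - ln x) = r ^+ d / x.
Proof. by move=> r0 x0; rewrite expRB expRM_natl !lnK ?posrE. Qed.

Lemma penaltyE (R : realType) (c c' r b : R) (k j : nat) : 0 < r -> 0 < c ->
  0 <= b ->
  b * penalty c c' k j =
  Num.min (b * c * r * (j%:R / r - k%:R / r))
          (b * c * r * (c' / c) * (j%:R / r - k%:R / r)).
Proof.
move=> r0 c0 b0; rewrite /penalty minr_pMr//; congr Num.min;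
  by field; rewrite ?gt_eqF.
Qed.

Lemma site_tail_asymp (R : realType) (d : nat) (g theta x p p' : R)
    (c c' r : nat -> R) (k j : nat -> nat) :
  (0 < d)%N -> scaling d g theta c c' r -> 0 < x ->
  (fun n => (k n)%:R / r n) @ \oo --> p ->
  (fun n => (j n)%:R / r n) @ \oo --> p' ->
  (fun n => r n ^+ d *
     weibull_tail g (level d g (r n) x + penalty (c n) (c' n) (k n) (j n)))
  @ \oo --> x * expR (- Num.min (p' - p) (theta * (p' - p))).
Proof.
move=> d0 S x0 kp jp; have g0 := scaling_gamma S.
have W : (fun n => g * (d%:R * ln (r n) - ln x) `^ (1 - g^-1) *
      penalty (c n) (c' n) (k n) (j n)) @ \oo -->
    Num.min (p' - p) (theta * (p' - p)).
  under eq_fun => n.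
    rewrite (penaltyE _ _ _ (scaling_pos S n)); last 2 first.
      by have /andP[/lt_le_trans] := scaling_slope S n; exact.
      by rewrite mulr_ge0 ?powR_ge0// ltW.
    over.
  have B := scaling_normE x d0 S.
  have D : (fun n => (j n)%:R / r n - (k n)%:R / r n) @ \oo --> p' - p by exact: cvgB.
  apply: cvg_minr.
    by rewrite -[X in _ --> X]mul1r; apply: cvgM.
  apply: cvgM D; rewrite -[X in _ --> X]mul1r; apply: cvgM => //.
  exact: scaling_ratio S.
apply: cvg_trans (cvgM (cvg_cst x) (weibull_tail_asymp g0 (scaling_height_y x d0 S) W)).
 apply: near_eq_cvg; near=> n.
rewrite /= expR_height ?(scaling_pos S)//.
by rewrite mulrA (mulrC x) divfK ?gt_eqF.
Unshelve. all: by end_near. Qed.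

(** Converts decay in the excess distance [y - p - 1] into decay in [1 + y], at the cost of the
    factor [p + 2] in the slope. *)
Lemma slope_shift_le (R : realType) (e p y : R) : 0 < e -> e <= 1 -> 0 <= p ->
  p + 2 < y -> e / (p + 2) * (1 + y) <= 1 + e * (y - p - 1).
Proof.
move=> e0 e1 p0 py; have p2 : 0 < p + 2 by lra.
rewrite mulrAC ler_pdivrMr//.
have h1 : 0 <= (1 - e) * (p + 2) by rewrite mulr_ge0//; lra.
have h2 : 0 <= e * (y - p - 1) * (p + 1) by rewrite !mulr_ge0//; lra.
lra.
Qed.

(** Up to distance [p + 2] the tail is compared with the one at the origin, where
    [1 + j / r <= p + 3]. Farther out both penalties, at the local rate, exceed [theta / 2] times
    the excess distance, and the polynomial domination applies. The constant adds the two
    contributions. The rates [theta / 2] hold eventually because the rates tend to 1 and [theta]. *)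
Lemma site_tail_le (R : realType) (d : nat) (g theta x p C0 c c' r : R) (k j K : nat) :
  0 < g -> 0 < theta <= 1 -> 0 < r -> 0 < c' <= c -> 0 < x -> 0 <= p -> 0 < C0 ->
  (0 < K)%N -> K%:R <= g * (d%:R * ln r - ln x) -> 0 < d%:R * ln r - ln x ->
  k%:R / r <= p + 1 ->
  theta / 2 <= g * (d%:R * ln r - ln x) `^ (1 - g^-1) * c * r ->
  theta / 2 <= g * (d%:R * ln r - ln x) `^ (1 - g^-1) * c * r * (c' / c) ->
  r ^+ d * weibull_tail g (level d g r x + penalty c c' k 0) <= C0 ->
  r ^+ d * weibull_tail g (level d g r x + penalty c c' k j)
    <= (C0 * (p + 3) ^+ K + x / (theta / (2 * K%:R) / (p + 2)) ^+ K)
       / (1 + j%:R / r) ^+ K.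
Proof.
move=> g0 /andP[t0 t1] rn /andP[c'0 c'c] x0 p0 C0p K0 Ka an kn h1 h2 hC.
have K0' : 1 <= K%:R :> R by rewrite ler1n.
set e := theta / (2 * K%:R); set b := e / (p + 2).
have e0 : 0 < e by rewrite divr_gt0// mulr_gt0//; lra.
have e1 : e <= 1 by rewrite ler_pdivrMr ?mulr_gt0//; lra.
have b0 : 0 < b by rewrite divr_gt0//; lra.
set y := j%:R / r.
have c0 : 0 < c := lt_le_trans c'0 c'c.
have y0 : 0 <= y by rewrite divr_ge0 ?ler0n// ltW.
have Y0 : 0 < (1 + y) ^+ K by rewrite exprn_gt0//; lra.
rewrite ler_pdivlMr//.
have [yp|yp] := leP y (p + 2).
  apply: (@le_trans _ _ (C0 * (p + 3) ^+ K)); last first.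
    by rewrite lerDl mulr_ge0 ?invr_ge0 ?exprn_ge0// ltW.
  apply: ler_pM.
  - by rewrite mulr_ge0 ?exprn_ge0 ?ltW// weibull_tail_gt0.
  - exact: ltW.
  - apply: le_trans hC.
    rewrite ler_pM2l; last exact: exprn_gt0.
    apply: weibull_tail_homo; first exact: g0.
    (* The penalty increases with the distance [j], so the threshold is lowest at [j = 0]. *)
    rewrite lerD2l /penalty le_min !ge_min !ler_pM2r// !lerD2r !ler_nat.
    by rewrite leq0n orbT.
  - by rewrite lerXn2r ?nnegrE; lra.
apply: (@le_trans _ _ (x / b ^+ K)); last first.
  by rewrite lerDr mulr_ge0 ?exprn_ge0 ?ltW//; lra.
have y1 : 0 <= y - p - 1 by clear -yp; lra.
have t2 : 0 <= theta / 2 by clear -t0; lra.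
have y2 : 0 < 1 + y by clear -y0; lra.
have K2 : 0 < K%:R :> R by clear -K0'; lra.
have yn : p + 1 <= y by clear -yp; lra.
have kj : (k <= j)%N.
  rewrite -(ler_nat R) -(@ler_pM2r _ r^-1) ?invr_gt0//.
  exact: le_trans kn yn.
have m0 : 0 <= penalty c c' k j.
  by rewrite le_min !mulr_ge0 ?subr_ge0 ?ler_nat// ltW.
set a := d%:R * ln r - ln x in an Ka h1 h2 *.
have D := weibull_tail_domination g0 an K0 Ka m0.
rewrite expR_height// in D.
have -> : r ^+ d = x * (r ^+ d / x) by rewrite mulrC divfK ?gt_eqF.
rewrite -(mulrA x) -(mulrA x) ler_pM2l//.
set w := g * _ * _ in D.
have wE : theta / 2 * (y - p - 1) <= w.
  rewrite /w (@penaltyE _ _ _ _ _ _ _ rn c0) ?mulr_ge0 ?powR_ge0 ?(ltW g0)//.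
  set B := g * _ * _ * _; set s := j%:R / _ - _.
  have s0 : y - p - 1 <= s by rewrite /s -/y -addrA lerD2l -opprD lerN2.
  by rewrite le_min; apply/andP; split; apply: ler_pM.
have lb : b * (1 + y) <= 1 + w / K%:R.
  apply: (@le_trans _ _ (1 + e * (y - p - 1))).
    exact: slope_shift_le.
  rewrite lerD2l /e ler_pdivlMr//.
  apply: le_trans wE; rewrite le_eqVlt; apply/orP; left; apply/eqP.
  by field; rewrite gt_eqF.
apply: (@le_trans _ _ (((1 + w / K%:R) ^+ K)^-1 * (1 + y) ^+ K)).
  by rewrite ler_pM2r//; exact: D.
have bY : 0 < b * (1 + y) by rewrite mulr_gt0.
rewrite mulrC ler_pdivrMr; last by rewrite exprn_gt0//; exact: lt_le_trans lb.
rewrite ler_pdivlMl ?exprn_gt0// -exprMn.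
have wK := lt_le_trans bY lb.
by apply: lerXn2r lb; rewrite nnegrE ltW.
Qed.

(** The degree [K] is left free: [d.+1] makes the sum over the shells converge, and [1] shows that
    each single tail is small. *)
Lemma site_tail_domination (R : realType) (d : nat) (g theta x p : R)
    (c c' r : nat -> R) (k : nat -> nat) (K : nat) :
  (0 < d)%N -> scaling d g theta c c' r -> 0 < x -> 0 <= p -> (0 < K)%N ->
  (fun n => (k n)%:R / r n) @ \oo --> p ->
  exists2 C, 0 < C & \forall n \near \oo, forall j,
    r n ^+ d * weibull_tail g (level d g (r n) x + penalty (c n) (c' n) (k n) j)
      <= C / (1 + j%:R / r n) ^+ K.
Proof.
move=> d0 S x0 p0 K0 kp; have g0 := scaling_gamma S.
have /andP[t0 t1] := scaling_theta S.
have z0 : (fun n => (0 : nat)%:R / r n) @ \oo --> (0 : R).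
  by under eq_fun do rewrite mul0r; exact: cvg_cst.
have T0 := site_tail_asymp d0 S x0 kp z0.
set C0 := x * expR _ in T0.
have B1 := scaling_normE x d0 S.
have B2 : (fun n => g * (d%:R * ln (r n) - ln x) `^ (1 - g^-1) * c n * r n *
    (c' n / c n)) @ \oo --> theta.
  by rewrite -[X in _ --> X]mul1r; exact: cvgM B1 (scaling_ratio S).
have C0p : 0 < C0 by rewrite mulr_gt0// expR_gt0.
have K0' : 1 <= K%:R :> R by rewrite ler1n.
exists ((C0 + 1) * (p + 3) ^+ K + x / (theta / (2 * K%:R) / (p + 2)) ^+ K).
  rewrite addr_gt0// mulr_gt0 ?invr_gt0 ?exprn_gt0 ?divr_gt0 ?mulr_gt0//; lra.
have ay := scaling_height_y x d0 S.
near=> n => j; apply: site_tail_le => //.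
- exact: scaling_theta S.
- exact: scaling_pos S n.
- exact: scaling_slope S n.
- by rewrite addr_gt0.
- rewrite -ler_pdivrMl//; near: n.
  by move/cvgryPge : ay; exact.
- by near: n; move/cvgryPgt : ay; exact.
- by near: n; apply: (cvgr_le _ kp); lra.
- by near: n; apply: (cvgr_ge _ B1); lra.
- by near: n; apply: (cvgr_ge _ B2); lra.
- by near: n; apply: (cvgr_le _ T0); rewrite -/C0; lra.
Unshelve. all: by end_near. Qed.

(** * Balls and shells of the lattice *)

Definition int_ball (n : nat) : seq int :=
  0 :: [seq Posz i.+1 | i <- iota 0 n] ++ [seq Negz i | i <- iota 0 n].

Lemma int_ball_uniq n : uniq (int_ball n).
Proof.
rewrite /int_ball /= mem_cat negb_or cat_uniq; apply/and4P; split.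
- by apply/andP; split; apply/negP => /mapP[].
- by rewrite map_inj_uniq ?iota_uniq// => i j [].
- by apply/hasPn => z /mapP[i _ ->]; apply/negP => /mapP[].
- by rewrite map_inj_uniq ?iota_uniq// => i j [].
Qed.

Lemma mem_int_ball n (z : int) : (z \in int_ball n) = (`|z| <= n)%N.
Proof.
rewrite inE mem_cat; case: z => [[|i]|i] //=.
- rewrite (_ : (Posz i.+1 \in [seq Negz j | j <- _]) = false) ?orbF; last first.
    by apply/negbTE/negP => /mapP[].
  rewrite mem_map; last by move=> ? ? [].
  by rewrite mem_iota.
- rewrite (_ : (Negz i \in [seq Posz j.+1 | j <- _]) = false); last first.
    by apply/negbTE/negP => /mapP[].
  rewrite mem_map; last by move=> ? ? [].
  by rewrite mem_iota.
Qed.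

(** Slicing by the first coordinate enumerates the ball without repetition and gives a recursion for
    its size. *)
Fixpoint lattice_ball (d n : nat) : seq 'rV[int]_d :=
  match d with
  | 0 => [:: 0]
  | d'.+1 => [seq (row_mx (k%:M : 'rV_1) z : 'rV_(1 + d'))
               | k <- int_ball n, z <- lattice_ball d' (n - `|k|)]
  end.

Lemma l1norm_row_mx d (k : int) (z : 'rV[int]_d) :
  l1norm (row_mx (k%:M : 'rV_1) z) = (`|k| + l1norm z)%N.
Proof.
rewrite /l1norm big_split_ord big_ord1 row_mxEl mxE eqxx mulr1n.
by congr addn; apply: eq_bigr => i _; rewrite row_mxEr.
Qed.

Lemma mem_lattice_ball d n z : (z \in lattice_ball d n) = (l1norm z <= n)%N.
Proof.
elim: d n z => [|d IH] n z.
  by rewrite inE [z]thinmx0 eqxx /l1norm big_ord0.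
apply/idP/idP => [/allpairsPdep[k [y [kn yn ->]]]|].
  move: kn yn; rewrite mem_int_ball IH l1norm_row_mx => kn yn.
  by rewrite -(subnKC kn) leq_add2l.
(* [d.+1] and [1 + d] are convertible; the second form allows [z] to be split into blocks. *)
move: z; change (forall z : 'rV[int]_(1 + d), (l1norm z <= n)%N ->
  z \in lattice_ball d.+1 n) => z.
rewrite -[z]hsubmxK [lsubmx z]mx11_scalar l1norm_row_mx => zn.
apply/allpairsPdep; exists (lsubmx z 0 0), (rsubmx z); split => //.
  by rewrite mem_int_ball; apply: leq_trans zn; rewrite leq_addr.
by rewrite IH leq_subRL// (leq_trans _ zn)// leq_addr.
Qed.

Lemma lattice_ball_uniq d n : uniq (lattice_ball d n).
Proof.
elim: d n => [//|d IH] n; apply: allpairs_uniq_dep => //.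
- exact: int_ball_uniq.
- move=> [k y] [k' y'] _ _ /= H; have [/matrixP/(_ 0 0)] := @eq_row_mx _ 1 1 d _ _ _ _ H.
  by rewrite !mxE !mulr1n => -> ->.
Qed.

(** The slices at first coordinates [k] and [- k] have the same size, hence the doubling. *)
Lemma size_lattice_ballS d n :
  size (lattice_ball d.+1 n) =
  (size (lattice_ball d n) + (\sum_(i < n) size (lattice_ball d i)).*2)%N.
Proof.
rewrite [LHS]size_allpairs_dep /int_ball /= subn0 map_cat sumn_cat -!map_comp.
congr addn; rewrite -addnn.
have E : sumn [seq size (lattice_ball d (n - i.+1)) | i <- iota 0 n] =
    (\sum_(i < n) size (lattice_ball d i))%N.
  rewrite sumnE big_map (_ : iota 0 n = index_iota 0 n) ?big_mkord; last first.
    by rewrite /index_iota subn0.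
  rewrite (reindex_inj rev_ord_inj)/=; apply: eq_bigr => i _.
  by rewrite subnSK// subKn// ltnW.
by rewrite -E; congr addn.
Qed.

Lemma sum_bin_col n k : (\sum_(i < n) 'C(i, k) = 'C(n, k.+1))%N.
Proof.
by elim: n => [|n IH]; rewrite ?big_ord0 ?bin0n// big_ord_recr/= IH binS.
Qed.

(** The term of index [k] counts the points with exactly [k] nonzero coordinates: their positions,
    their signs, and the positive [k]-tuples of sum at most [n]. *)
Lemma size_lattice_ball d n :
  size (lattice_ball d n) = (\sum_(k < d.+1) 2 ^ k * 'C(d, k) * 'C(n, k))%N.
Proof.
elim: d n => [|d IH] n; first by rewrite big_ord1 !bin0.
rewrite size_lattice_ballS IH.
under [X in (_ + X.*2)%N]eq_bigr => i _ do rewrite IH.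
rewrite exchange_big/=.
under [X in X.*2]eq_bigr => k _ do rewrite -big_distrr/= sum_bin_col.
rewrite [RHS]big_ord_recl [X in (X + _.*2)%N]big_ord_recl /= !bin0 -addnA.
congr addn; rewrite -mul2n big_distrr/=.
rewrite [in RHS](eq_bigr (fun k : 'I_d.+1 => 2 ^ k.+1 * 'C(d, k.+1) * 'C(n, k.+1)
    + 2 * (2 ^ k * 'C(d, k) * 'C(n, k.+1)))%N); last first.
  by move=> k _; rewrite /= /bump /= add1n binS expnS; ring.
rewrite [RHS]big_split/=; congr addn; rewrite big_ord_recr/= bin_small// muln0 mul0n addn0.
by apply: eq_bigr => k _; rewrite /bump /= add1n.
Qed.

Definition lattice_shell (d n : nat) : seq 'rV[int]_d :=
  [seq z <- lattice_ball d n | l1norm z == n].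

Lemma mem_lattice_shell d n z : (z \in lattice_shell d n) = (l1norm z == n).
Proof.
rewrite mem_filter mem_lattice_ball.
by case: eqVneq => [->|]; rewrite ?leqnn.
Qed.

Lemma lattice_shell_uniq d n : uniq (lattice_shell d n).
Proof. exact/filter_uniq/lattice_ball_uniq. Qed.

Lemma perm_lattice_ballS d n :
  perm_eq (lattice_ball d n.+1) (lattice_ball d n ++ lattice_shell d n.+1).
Proof.
apply: uniq_perm; first exact: lattice_ball_uniq.
  rewrite cat_uniq lattice_ball_uniq lattice_shell_uniq andbT /=.
  apply/hasPn => z; rewrite mem_lattice_shell mem_lattice_ball => /eqP ->.
  by rewrite ltnn.
move=> z; rewrite mem_cat mem_lattice_shell !mem_lattice_ball.
by rewrite [LHS]leq_eqVlt ltnS orbC.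
Qed.

Lemma lattice_ball_shell0 d : lattice_shell d 0 = lattice_ball d 0.
Proof.
by apply/all_filterP/allP => z; rewrite mem_lattice_ball leqn0.
Qed.

Lemma big_lattice_ball (V : nmodType) d n (F : 'rV[int]_d -> V) :
  \sum_(z <- lattice_ball d n) F z =
  \sum_(k < n.+1) \sum_(z <- lattice_shell d k) F z.
Proof.
elim: n => [|n IH]; first by rewrite big_ord1 lattice_ball_shell0.
by rewrite (perm_big _ (perm_lattice_ballS d n)) big_cat IH [RHS]big_ord_recr.
Qed.

Lemma size_lattice_shellS d n :
  size (lattice_shell d n.+1) = (\sum_(k < d) 2 ^ k.+1 * 'C(d, k.+1) * 'C(n, k))%N.
Proof.
have := perm_size (perm_lattice_ballS d n); rewrite size_cat !size_lattice_ball.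
rewrite !big_ord_recl /= !bin0 -!addnA => /addnI.
under eq_bigr => k _ do rewrite /bump/= add1n binS mulnDr.
under [X in _ = (X + _)%N -> _]eq_bigr => k _ do rewrite /bump/= add1n.
by rewrite big_split => /= /addnI ->.
Qed.

Lemma cvg_sum_ord (R : realType) m (F : 'I_m -> nat -> R) (l : 'I_m -> R) :
  (forall i, F i @ \oo --> l i) ->
  (fun n => \sum_(i < m) F i n) @ \oo --> \sum_(i < m) l i.
Proof.
elim: m F l => [|m IH] F l Fl.
  by under eq_fun do rewrite big_ord0; rewrite big_ord0; exact: cvg_cst.
under eq_fun do rewrite big_ord_recl; rewrite big_ord_recl.
by apply: cvgD => //; exact: (IH (fun i => F (lift ord0 i))).
Qed.

Lemma cvg_natB (R : realType) (p : R) (r : nat -> R) (m : nat -> nat) (i : nat) :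
  (forall n, 0 < r n) -> r @ \oo --> +oo ->
  (fun n => (m n)%:R / r n) @ \oo --> p ->
  (fun n => (m n - i)%:R / r n) @ \oo --> p.
Proof.
move=> r0 ry mp.
apply: (@squeeze_cvgr _ _ _ _ (fun n => (m n)%:R / r n - i%:R * (r n)^-1) (fun n => (m n)%:R / r n)).
- near=> n; rewrite -mulrBl !ler_pM2r ?invr_gt0// ler_nat leq_subr andbT.
  by rewrite lerBlDr -natrD ler_nat addnC -leq_subLR.
- rewrite -[X in _ --> X]subr0 -(mulr0 i%:R); apply: cvgB => //.
  by apply: cvgM; [exact: cvg_cst|exact: cvgryV].
- exact: mp.
Unshelve. all: by end_near. Qed.

Lemma cvg_ffact (R : realType) (p : R) (r : nat -> R) (m : nat -> nat) (k : nat) :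
  (forall n, 0 < r n) -> r @ \oo --> +oo ->
  (fun n => (m n)%:R / r n) @ \oo --> p ->
  (fun n => (m n ^_ k)%:R / r n ^+ k) @ \oo --> p ^+ k.
Proof.
move=> r0 ry mp; elim: k => [|k IH].
  by under eq_fun do rewrite ffactn0 expr0 divr1; exact: cvg_cst.
under eq_fun => n.
  rewrite ffactnSr natrM exprSr invfM mulrACA [X in _ * X]mulrC.
  rewrite [(r n)^-1 * _]mulrC.
  over.
by rewrite exprSr; apply: cvgM => //; exact: cvg_natB.
Qed.

(** Coefficients of lower degree are negligible at the scale [r ^+ e], so only the top term of the
    size of a shell survives. *)
Lemma cvg_bin (R : realType) (p : R) (r : nat -> R) (m : nat -> nat) (e k : nat) :
  (forall n, 0 < r n) -> r @ \oo --> +oo -> (k <= e)%N ->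
  (fun n => (m n)%:R / r n) @ \oo --> p ->
  (fun n => 'C(m n, k)%:R / r n ^+ e) @ \oo -->
    (if k == e then p ^+ e / e`!%:R else 0).
Proof.
move=> r0 ry ke mp.
have binE n : 'C(m n, k)%:R = (m n ^_ k)%:R / k`!%:R :> R.
  by rewrite -bin_ffact natrM mulfK// pnatr_eq0 -lt0n fact_gt0.
have F := @cvg_ffact R p r m k r0 ry mp.
case: eqVneq => [<-|ke'].
  under eq_fun do rewrite binE mulrAC.
  by apply: cvgM => //; exact: cvg_cst.
have {ke ke'}ke : (k < e)%N by rewrite ltn_neqAle ke' ke.
have -> : 0 = p ^+ k / k`!%:R * 0 ^+ (e - k) :> R.
  by rewrite expr0n subn_eq0 leqNgt ke mulr0.
have rV := cvgryV ry.
have rVk : forall q, (fun n => (r n)^-1 ^+ q) @ \oo --> (0 : R) ^+ q.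
  elim=> [|q IH]; first by under eq_fun do rewrite expr0; exact: cvg_cst.
  by under eq_fun do rewrite exprS; rewrite exprS; apply: cvgM.
have E n : 'C(m n, k)%:R / r n ^+ e =
    (m n ^_ k)%:R / r n ^+ k / k`!%:R * (r n)^-1 ^+ (e - k).
  rewrite binE -[in LHS](subnKC (ltnW ke)) exprD exprVn; field.
  by rewrite !expf_neq0 ?gt_eqF// pnatr_eq0 -lt0n fact_gt0.
under eq_fun do rewrite E.
by apply: cvgM; [apply: cvgM => //; exact: cvg_cst|exact: rVk].
Qed.

(** The [kappa] of the overview: the shell at distance [n] has about [kappa * n ^ d.-1] sites,
    namely [n ^ d.-1 / (d.-1)!] in each of the [2 ^ d] orthants. *)
Definition shell_density (R : realType) (d : nat) : R :=
  (2 ^ d)%:R / (d.-1)`!%:R.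

Lemma shell_density_gt0 (R : realType) (d : nat) : 0 < shell_density R d.
Proof. by rewrite divr_gt0 ?ltr0n ?expn_gt0 ?fact_gt0. Qed.

Lemma cvg_size_shell (R : realType) (d : nat) (p : R) (r : nat -> R) (j : nat -> nat) :
  (0 < d)%N -> (forall n, 0 < r n) -> r @ \oo --> +oo -> 0 < p ->
  (fun n => (j n)%:R / r n) @ \oo --> p ->
  (fun n => (size (lattice_shell d (j n)))%:R / r n ^+ d.-1) @ \oo -->
    shell_density R d * p ^+ d.-1.
Proof.
case: d => // d _ r0 ry p0 jp /=.
have L : (fun n => \sum_(k < d.+1) (2 ^ k.+1 * 'C(d.+1, k.+1))%:R *
      ('C((j n).-1, k)%:R / r n ^+ d)) @ \oo -->
    \sum_(k < d.+1) (2 ^ k.+1 * 'C(d.+1, k.+1))%:R *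
      (if k == d :> nat then p ^+ d / d`!%:R else 0 : R).
  apply: cvg_sum_ord => k; apply: cvgM; first exact: cvg_cst.
  apply: cvg_bin => //; first by rewrite -ltnS.
  by under eq_fun do rewrite -subn1; exact: cvg_natB.
rewrite big_ord_recr/= eqxx binn muln1 big1 in L; last first.
  by move=> k _; rewrite ltn_eqF ?mulr0//.
rewrite add0r mulrA mulrAC in L.
apply: cvg_trans L; apply: near_eq_cvg; near=> n.
have j0 : (0 < j n)%N.
  have : 0 < (j n)%:R / r n by near: n; exact: (cvgr_gt _ jp).
  by rewrite pmulr_lgt0 ?invr_gt0// ltr0n.
rewrite -(prednK j0) size_lattice_shellS/= natr_sum mulr_suml.
by apply: eq_bigr => k _; rewrite !natrM !mulrA.
Unshelve. all: by end_near. Qed.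

Lemma leq_ffact_expn n k : (n ^_ k <= n ^ k)%N.
Proof.
by elim: k => // k IH; rewrite ffactnSr expnSr leq_mul// leq_subr.
Qed.

(** [n.+1] instead of [n] keeps the bound true at the origin when [d > 1]. *)
Lemma size_shell_le d : (0 < d)%N -> exists C, forall n,
  (size (lattice_shell d n) <= C * n.+1 ^ d.-1)%N.
Proof.
case: d => // d _; exists (\sum_(k < d.+1) 2 ^ k.+1 * 'C(d.+1, k.+1))%N => -[|n].
  rewrite exp1n muln1 lattice_ball_shell0 size_lattice_ball big_ord_recl bin0.
  rewrite [X in (_ + X <= _)%N]big1 ?addn0; last by move=> i _; rewrite lift0 [X in (_ * X)%N]bin_small ?muln0.
  rewrite big_ord_recl /= bin0 expn0 muln1 (leq_trans _ (leq_addr _ _))//.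
  by rewrite muln_gt0 expn_gt0 bin_gt0.
rewrite size_lattice_shellS big_distrl/=; apply: leq_sum => k _.
rewrite leq_mul2l; apply/orP; right.
apply: (@leq_trans (n ^_ k)).
  by rewrite -bin_ffact leq_pmulr// fact_gt0.
apply: (@leq_trans (n ^ k)); first exact: leq_ffact_expn.
apply: (@leq_trans (n.+2 ^ k)); first by elim: (k : nat) => // i IH; rewrite !expnS leq_mul// leqW.
by rewrite leq_pexp2l// -ltnS.
Qed.

(** * Sums as integrals of step functions *)

Lemma itv_oy_sub_cy (R : realType) (a : R) : `]a, +oo[ `<=` `[a, +oo[.
Proof. by move=> x /=; rewrite !in_itv/= !andbT => /ltW. Qed.

(** Domination is asked only from some rank [N] on, as the asymptotic estimates provide it; the
    sequence is shifted by [N]. *)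
Lemma dominated_convergence_Rintegral (disp : measure_display)
    (T : measurableType disp) (R : realType) (mu : {measure set T -> \bar R})
    (D : set T) (f_ : nat -> T -> R) (f g : T -> R) :
  measurable D -> (forall n, measurable_fun D (f_ n)) ->
  (forall x, D x -> f_ ^~ x @ \oo --> f x) ->
  mu.-integrable D (EFin \o g) ->
  (\forall n \near \oo, forall x, D x -> `|f_ n x| <= g x) ->
  mu.-integrable D (EFin \o f) /\
  (fun n => (\int[mu]_(x in D) f_ n x)%R) @ \oo --> (\int[mu]_(x in D) f x)%R.
Proof.
move=> mD mf_ f_f ig [N _ fg].
have mf : measurable_fun D f by exact: measurable_fun_cvg mf_ f_f.
have [] := @dominated_convergence _ _ _ mu D mD
  (fun n => EFin \o f_ (n + N)%N) (EFin \o f) (EFin \o g).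
- by move=> n; exact/measurable_EFinP.
- exact/measurable_EFinP.
- apply: aeW => x Dx; apply: cvg_EFin; first by near=> n.
  have := f_f x Dx; rewrite -(cvg_shiftn N); exact.
- exact: ig.
- by apply: aeW => x n Dx /=; rewrite lee_fin fg//= leq_addl.
move=> iF _ C; split => //.
rewrite -(cvg_shiftn N); apply: fine_cvg.
by rewrite /Rintegral fineK ?integrable_fin_num.
Unshelve. all: by end_near. Qed.

(** [step r a] interpolates the sequence [a] on the lattice of mesh [1 / r], with
the factor [r] for which its integral is the sum of [a]. *)
Definition step (R : realType) (r : R) (a : nat -> R) (x : R) : R :=
  r * a (Num.truncn (x * r)).

Lemma step_cellE (R : realType) (r x : R) (k : nat) : 0 < r ->
  x \in `[k%:R / r, k.+1%:R / r[ -> Num.truncn (x * r) = k.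
Proof.
move=> r0; rewrite in_itv/= => /andP[h1 h2].
by apply: truncn_def; rewrite -ler_pdivrMr// h1 -ltr_pdivlMr.
Qed.

Lemma mem_step_cell (R : realType) (r x : R) : 0 < r -> 0 <= x ->
  x \in `[(Num.truncn (x * r))%:R / r, (Num.truncn (x * r)).+1%:R / r[.
Proof.
move=> r0 x0; rewrite in_itv/= ler_pdivrMr// ltr_pdivlMr//.
by rewrite truncn_itv// mulr_ge0// ltW.
Qed.

Lemma measurable_step (R : realType) (r : R) (a : nat -> R) (D : set R) : 0 < r ->
  measurable D -> D `<=` `[0, +oo[ -> measurable_fun D (step r a).
Proof.
move=> r0 mD D0 _ Y mY.
rewrite (_ : _ `&` _ = \bigcup_(k in [set k | Y (r * a k)])
    (D `&` `[k%:R / r, k.+1%:R / r[)); last first.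
  apply/seteqP; split => [x [Dx Yx]|x [k /= Yk [Dx xk]]]; last first.
    by split => //; rewrite /step /= (step_cellE r0 xk).
  exists (Num.truncn (x * r)) => //; split => //.
  by apply: mem_step_cell => //; have := D0 _ Dx; rewrite /= in_itv/= andbT.
by apply: bigcup_measurable => k _; exact: measurableI.
Qed.

Lemma integral_step (R : realType) (r : R) (a : nat -> R) : 0 < r ->
  (forall k, 0 <= a k) ->
  (\int[lebesgue_measure]_(x in `]0%R, +oo[) (step r a x)%:E =
   \sum_(k <oo) (a k)%:E)%E.
Proof.
move=> r0 a0.
have U : (`[0, +oo[%classic : set R) = \bigcup_k `[k%:R / r, k.+1%:R / r[%classic.
  apply/seteqP; split => [x /=|x [k _ /=]]; rewrite in_itv/= ?andbT.
    by move=> x0; exists (Num.truncn (x * r)) => //; exact: mem_step_cell.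
  by rewrite in_itv/= andbT => /andP[+ _]; apply: le_trans; rewrite divr_ge0// ltW.
have mS : measurable_fun (`[0, +oo[%classic : set R) (step r a).
  exact: measurable_step.
(* The cells tile the half-line closed at 0; the added point is null. *)
rewrite integral_itv_obnd_cbnd; last first.
  apply/measurable_EFinP; apply: measurable_funS mS => //.
  exact: itv_oy_sub_cy.
rewrite U ge0_integral_bigcup//; last 3 first.
- by rewrite -U; exact/measurable_EFinP.
- by move=> x _; rewrite lee_fin mulr_ge0// ltW.
- move=> i j _ _ [x [/= xi xj]].
  by rewrite -(step_cellE r0 xi) -(step_cellE r0 xj).
apply: eq_eseriesr => k _.
rewrite (eq_integral (cst (r * a k)%:E)); last first.
  by move=> x; rewrite inE/= => xk; rewrite /step (step_cellE r0 xk).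
rewrite integral_cst//= lebesgue_measure_itv/= lte_fin ltr_pM2r ?invr_gt0//.
rewrite ltr_nat ltnSn -EFinD -EFinM; congr EFin.
by rewrite -natr1; field; rewrite gt_eqF.
Qed.

Lemma eseries_finite (R : realType) (a : nat -> R) (m : nat) :
  (\sum_(k <oo) (if (k < m)%N then a k else 0)%:E = (\sum_(k < m) a k)%:E)%E.
Proof.
apply/cvg_lim => //; apply: cvg_near_cst; near=> n.
have mn : (m <= n)%N by near: n; exact: nbhs_infty_ge.
rewrite sumEFin; congr EFin; rewrite /= (big_cat_nat _ mn)//=.
rewrite [X in _ + X]big_nat_cond [X in _ + X]big1 ?addr0; last first.
  by move=> i /andP[/andP[mi _] _]; rewrite ltnNge mi.
by rewrite big_mkord; apply: eq_bigr => i _; rewrite ltn_ord.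
Unshelve. all: by end_near. Qed.

Lemma cvg_sum_step (R : realType) (r : R) (a : nat -> R) : 0 < r ->
  (forall k, 0 <= a k) ->
  (@lebesgue_measure R).-integrable `]0, +oo[ (EFin \o step r a) ->
  (fun m => \sum_(k < m) a k) @ \oo -->
    (\int[lebesgue_measure]_(x in `]0, +oo[) step r a x)%R.
Proof.
move=> r0 a0 iS.
have E := integral_step r0 a0.
have : (fun m => (\sum_(0 <= k < m) (a k)%:E)%E) @ \oo -->
    (\int[lebesgue_measure]_(x in `]0%R, +oo[) (step r a x)%:E)%E.
  by rewrite E; apply: is_cvg_nneseries => n _ _; rewrite lee_fin.
have /fineK <- : (\int[lebesgue_measure]_(x in `]0%R, +oo[) (step r a x)%:E)%E
    \is a fin_num by exact: integrable_fin_num iS.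
move=> /fine_cvg; apply: cvg_trans; apply: near_eq_cvg; near=> m.
by rewrite /= sumEFin/= big_mkord.
Unshelve. all: by end_near. Qed.

Lemma integrable_cst_itv (R : realType) (b B : R) :
  (@lebesgue_measure R).-integrable `]0, b] (cst B%:E).
Proof.
apply/integrableP; split; first exact: measurable_cst.
rewrite (eq_integral (cst `|B%:E|%E))// integral_cst//= lebesgue_measure_itv/= lte_fin.
by case: ifP => _; rewrite ?mule0// -EFinD -EFinM ltry.
Qed.

Lemma integrable_step_bounded (R : realType) (r b B : R) (a : nat -> R) : 0 < r ->
  (forall k, 0 <= a k) -> (forall k, k%:R / r <= b -> r * a k <= B) ->
  (@lebesgue_measure R).-integrable `]0, b] (EFin \o step r a).
Proof.
move=> r0 a0 aB.
have mS : measurable_fun (`]0, b]%classic : set R) (step r a).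
  by apply: measurable_step => // x /=; rewrite !in_itv/= => /andP[/ltW ->].
apply: (@le_integrable _ _ _ _ _ _ _ (cst B%:E)) => //.
- exact/measurable_EFinP.
- move=> x /=; rewrite in_itv/= => /andP[x0 xb].
  rewrite lee_fin ger0_norm ?mulr_ge0 ?(ltW r0)//.
  apply: le_trans (ler_norm _); apply: aB; apply: le_trans xb.
  by have := mem_step_cell r0 (ltW x0); rewrite in_itv/= => /andP[].
- exact: integrable_cst_itv.
Qed.

(** The first [m] cells fill [[0, m / r[], so the sum compares with the integral over []0, b]]
    according to the position of [b]; the next lemma is the opposite case. *)
Lemma le_sum_step (R : realType) (r b : R) (a : nat -> R) (m : nat) : 0 < r ->
  (forall k, 0 <= a k) ->
  (@lebesgue_measure R).-integrable `]0, b] (EFin \o step r a) -> m%:R / r <= b ->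
  \sum_(k < m) a k <= (\int[lebesgue_measure]_(x in `]0, b]) step r a x)%R.
Proof.
move=> r0 a0 iS mb; pose a' k := if (k < m)%N then a k else 0.
have a'0 k : 0 <= a' k by rewrite /a'; case: ifP.
have E := integral_step r0 a'0; rewrite eseries_finite in E.
rewrite -lee_fin /Rintegral fineK; last exact: integrable_fin_num iS.
rewrite -E [leLHS]integral_mkcond [leRHS]integral_mkcond; apply: ge0_le_integral => //.
- by move=> x _; apply: erestrict_ge0 => y _; rewrite lee_fin mulr_ge0// ltW.
- apply/(measurable_restrictT _ _).1 => //; apply/measurable_EFinP.
  by apply: measurable_step => //; exact: itv_oy_sub_cy.
- by apply/(measurable_restrictT _ _).1 => //; exact: measurable_int iS.
- move=> x _; rewrite !patchE; case: ifPn => [|_]; last first.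
    by case: ifP => // _; rewrite lee_fin mulr_ge0// ltW.
  rewrite inE/= in_itv/= andbT => x0.
  have := mem_step_cell r0 (ltW x0); rewrite in_itv/= => /andP[x1 x2].
  rewrite /step /a'; case: ltnP => km; last first.
    by rewrite mulr0; case: ifP => // _; rewrite lee_fin mulr_ge0// ltW.
  rewrite ifT// inE/= in_itv/= x0/= (le_trans (ltW x2))// (le_trans _ mb)//.
  by rewrite ler_pM2r ?invr_gt0// ler_nat.
Qed.

Lemma ge_sum_step (R : realType) (r b : R) (a : nat -> R) (m : nat) : 0 < r ->
  (forall k, 0 <= a k) ->
  (@lebesgue_measure R).-integrable `]0, b] (EFin \o step r a) -> b < m%:R / r ->
  (\int[lebesgue_measure]_(x in `]0, b]) step r a x)%R <= \sum_(k < m) a k.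
Proof.
move=> r0 a0 iS mb; pose a' k := if (k < m)%N then a k else 0.
have a'0 k : 0 <= a' k by rewrite /a'; case: ifP.
have E := integral_step r0 a'0; rewrite eseries_finite in E.
rewrite -lee_fin /Rintegral fineK; last exact: integrable_fin_num iS.
rewrite -E [leLHS]integral_mkcond [leRHS]integral_mkcond; apply: ge0_le_integral => //.
- by move=> x _; apply: erestrict_ge0 => y _; rewrite lee_fin mulr_ge0// ltW.
- by apply/(measurable_restrictT _ _).1 => //; exact: measurable_int iS.
- apply/(measurable_restrictT _ _).1 => //; apply/measurable_EFinP.
  by apply: measurable_step => //; exact: itv_oy_sub_cy.
- move=> x _; rewrite !patchE; case: ifPn => [|_]; last first.
    by case: ifP => // _; rewrite lee_fin mulr_ge0// ltW.
  rewrite inE/= in_itv/= => /andP[x0 xb].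
  have := mem_step_cell r0 (ltW x0); rewrite in_itv/= => /andP[x1 x2].
  rewrite ifT ?inE/= ?in_itv/= ?x0// /step /a' ifT//.
  rewrite -(ltr_nat R) -(@ltr_pM2r _ r^-1) ?invr_gt0//.
  exact: le_lt_trans (le_trans x1 xb) mb.
Qed.

(** Multiples of this function dominate the rival densities and their step approximations. *)
Lemma integrable_oneDsqrV (R : realType) :
  (@lebesgue_measure R).-integrable `]0, +oo[ (EFin \o (fun x => (1 + x ^+ 2)^-1)).
Proof.
suff I : (@lebesgue_measure R).-integrable `[0, +oo[
    (EFin \o (fun x => (1 + x ^+ 2)^-1)).
  by apply: integrableS I => //; exact: itv_oy_sub_cy.
apply/integrableP; split.
  apply/measurable_EFinP; apply: measurable_funTS.
  by apply: continuous_measurable_fun; exact: (@continuous_oneDsqrV R).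
rewrite [ltLHS](_ : _ = (pi / 2)%:E) ?ltry// -integral0y_oneDsqr.
apply: eq_integral => x _.
by rewrite /= ger0_norm// invr_ge0 addr_ge0// sqr_ge0.
Qed.

(** * The limiting persistence probability *)

(** The limiting intensity, at distance [p'] from the origin and on the scale of
the problem, of the sites that beat a site of height [level 1] at distance [p]. *)
Definition rival_density (R : realType) (d : nat) (theta p p' : R) : R :=
  shell_density R d * p' ^+ d.-1 * expR (- Num.min (p' - p) (theta * (p' - p))).

Definition rival_mass (R : realType) (d : nat) (theta p : R) : R :=
  (\int[lebesgue_measure]_(p' in `]0, +oo[) rival_density d theta p p')%R.

(** The limiting probability that one site maximises with two slopes whose ratio
is [theta]. Given a height [level x] at distance [p], the number of rivals is
asymptotically Poisson with mean [x * rival_mass d theta p]; integrating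
[exp (- x * rival_mass d theta p)] over [x > 0] leaves [1 / rival_mass]. *)
Definition persistence (R : realType) (d : nat) (theta : R) : R :=
  (\int[lebesgue_measure]_(p in `]0, +oo[)
     (shell_density R d * p ^+ d.-1 / rival_mass d theta p))%R.

Lemma rival_density_ge0 (R : realType) (d : nat) (theta p p' : R) : 0 <= p' ->
  0 <= rival_density d theta p p'.
Proof.
by move=> p0; rewrite !mulr_ge0 ?expR_ge0 ?exprn_ge0// ltW// shell_density_gt0.
Qed.

Lemma minr_slope (R : realType) (theta s : R) : theta <= 1 ->
  Num.min s (theta * s) = if 0 <= s then theta * s else s.
Proof.
move=> t1; case: ifPn => [s0|]; first by rewrite min_r// ler_piMl.
by rewrite -ltNge => s0; rewrite min_l// -[leLHS]mul1r ler_wnM2r// ltW.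
Qed.

Lemma measurable_rival_density (R : realType) (d : nat) (theta p : R) (D : set R) :
  measurable_fun D (rival_density d theta p).
Proof.
apply: measurable_funTS; apply: measurable_funM.
  by apply: measurable_funM => //; exact: measurable_funX.
apply: measurableT_comp => //; apply: measurableT_comp => //.
apply: measurable_minr; first exact: measurable_funB.
by apply: measurable_funM => //; exact: measurable_funB.
Qed.

Lemma exprn_le_expR (R : realType) (x : R) (m : nat) : 0 <= x ->
  x ^+ m <= m`!%:R * expR x.
Proof.
move=> x0; case: m => [|m]; first by rewrite expr0 mul1r -[leLHS]expR0 ler_expR.
have := expR_ge1Dxn m x0; rewrite -(ler_pM2l (_ : 0 < (m.+1)`!%:R :> R)); last first.
  by rewrite ltr0n fact_gt0.
apply: le_trans; rewrite mulrDr mulr1 mulrC divfK ?pnatr_eq0 -?lt0n ?fact_gt0//.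
by rewrite lerDr ler0n.
Qed.

Lemma exprn_expRN_le (R : realType) (t x : R) (m : nat) : 0 < t -> 0 <= x ->
  x ^+ m * expR (- (t * x)) <= m`!%:R / t ^+ m.
Proof.
move=> t0 x0; rewrite ler_pdivlMr ?exprn_gt0// mulrAC -exprMn expRN.
by rewrite ler_pdivrMr ?expR_gt0// [x * t]mulrC exprn_le_expR// mulr_ge0// ltW.
Qed.

(** For both signs of [p' - p], the minimum in the exponent is at least [theta * p' - p]. *)
Lemma rival_density_le_exp (R : realType) (d : nat) (theta p p' : R) :
  0 < theta <= 1 -> 0 <= p -> 0 <= p' ->
  rival_density d theta p p' <=
  shell_density R d * p' ^+ d.-1 * (expR p * expR (- (theta * p'))).
Proof.
move=> /andP[t0 t1] p0 p'0; apply: ler_wpM2l.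
  by rewrite mulr_ge0 ?exprn_ge0// ltW// shell_density_gt0.
rewrite -expRD ler_expR minr_slope//; case: ifPn => [_|].
  have : theta * p <= p by rewrite ler_piMl.
  lra.
have : theta * p' <= p' by rewrite ler_piMl.
lra.
Qed.

(** From [x ^+ m * exp (- theta * x) <= m! / theta ^+ m], used with [m = d.-1] and [m = d.+1] to
    bound [p' ^+ d.-1 * (1 + p' ^+ 2) * exp (- theta * p')]. *)
Definition rival_bound (R : realType) (d : nat) (theta p : R) : R :=
  shell_density R d * expR p *
  ((d.-1)`!%:R / theta ^+ d.-1 + (d.+1)`!%:R / theta ^+ d.+1).

Lemma rival_density_le (R : realType) (d : nat) (theta p p' : R) : (0 < d)%N ->
  0 < theta <= 1 -> 0 <= p -> 0 <= p' ->
  rival_density d theta p p' <= rival_bound d theta p * (1 + p' ^+ 2)^-1.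
Proof.
move=> d0 t01 p0 p'0; have /andP[t0 t1] := t01.
apply: (le_trans (rival_density_le_exp d t01 p0 p'0)).
have q0 : 0 < 1 + p' ^+ 2 by rewrite ltr_wpDr// sqr_ge0.
rewrite ler_pdivlMr// /rival_bound.
rewrite [leLHS](_ : _ = shell_density R d * expR p *
  (p' ^+ d.-1 * expR (- (theta * p')) * (1 + p' ^+ 2))); last by ring.
rewrite ler_pM2l ?mulr_gt0 ?expR_gt0 ?shell_density_gt0//.
have e1 := exprn_expRN_le d.-1 t0 p'0; have e2 := exprn_expRN_le d.+1 t0 p'0.
have E : p' ^+ d.+1 = p' ^+ d.-1 * p' ^+ 2.
  by rewrite -exprD; congr (_ ^+ _); rewrite addn2 prednK.
rewrite E in e2; apply: le_trans (lerD e1 e2).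
rewrite le_eqVlt; apply/orP; left; apply/eqP; ring.
Qed.

Lemma integrable_scaled (disp : measure_display) (T : measurableType disp)
    (R : realType) (mu : {measure set T -> \bar R}) (D : set T) (f : T -> R) (k : R) :
  measurable D -> mu.-integrable D (EFin \o f) ->
  mu.-integrable D (EFin \o (fun x => k * f x)).
Proof.
move=> mD fD; have := integrableZl mD k fD.
by apply: eq_integrable => // x _; rewrite /= EFinM.
Qed.

Lemma integrable_oneDsqrV_scaled (R : realType) (k : R) :
  (@lebesgue_measure R).-integrable `]0, +oo[
    (EFin \o (fun x => k * (1 + x ^+ 2)^-1)).
Proof.
by apply: integrable_scaled => //; exact: integrable_oneDsqrV.
Qed.

Lemma integrable_rival_density (R : realType) (d : nat) (theta p : R) : (0 < d)%N ->
  0 < theta <= 1 -> 0 <= p ->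
  (@lebesgue_measure R).-integrable `]0, +oo[ (EFin \o rival_density d theta p).
Proof.
move=> d0 t01 p0.
apply: le_integrable (integrable_oneDsqrV_scaled (rival_bound d theta p)) => //.
  by apply/measurable_EFinP; exact: measurable_rival_density.
move=> x /=; rewrite in_itv/= andbT => /ltW x0.
rewrite lee_fin ger0_norm ?rival_density_ge0//.
by apply: le_trans (ler_norm _); exact: rival_density_le.
Qed.

Lemma cvg_rival_mass (R : realType) (d : nat) (t theta p : R) (th ps : nat -> R) :
  (0 < d)%N -> 0 < t -> (forall n, t <= th n <= 1) -> (forall n, 0 <= ps n) ->
  th @ \oo --> theta -> ps @ \oo --> p ->
  (fun n => rival_mass d (th n) (ps n)) @ \oo --> rival_mass d theta p.
Proof.
move=> d0 t0 tht ps0 tc pc.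
(* [rival_bound] increases in [p] and decreases in [theta], so its value at [t] and [p + 1]
   dominates eventually. *)
apply: (proj2 (@dominated_convergence_Rintegral _ _ _ lebesgue_measure _ _ _
  (fun x => rival_bound d t (p + 1) * (1 + x ^+ 2)^-1) _ _ _ _ _)) => //.
- by move=> n; exact: measurable_rival_density.
- move=> x _; apply: cvgM; first exact: cvg_cst.
  apply: continuous_cvg; first exact: continuous_expR.
  apply: cvgN; apply: cvg_minr; first by apply: cvgB => //; exact: cvg_cst.
  by apply: cvgM => //; apply: cvgB => //; exact: cvg_cst.
- exact: integrable_oneDsqrV_scaled.
- near=> n => x /=; rewrite in_itv/= andbT => /ltW x0.
  have /andP[n0 n1] := tht n.
  have n01 : 0 < th n <= 1 by rewrite n1 (lt_le_trans t0).
  rewrite ger0_norm ?rival_density_ge0//.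
  apply: le_trans (rival_density_le d0 n01 (ps0 n) x0) _.
  rewrite ler_wpM2r ?invr_ge0 ?addr_ge0 ?sqr_ge0// /rival_bound.
  have pn : ps n <= p + 1 by near: n; apply: (cvgr_le _ pc); lra.
  apply: ler_pM.
  + by rewrite mulr_ge0 ?expR_ge0// ltW// shell_density_gt0.
  + by case/andP: n01 => ? _; rewrite addr_ge0// divr_ge0// exprn_ge0 ?ltW.
  + by rewrite ler_pM2l ?shell_density_gt0// ler_expR.
  + case/andP: n01 => ? _.
    apply: lerD; rewrite ler_wpM2l// lef_pV2 ?posrE ?exprn_gt0//;
      by apply: lerXn2r; rewrite ?nnegrE// ltW.
Unshelve. all: by end_near. Qed.

Lemma rival_mass_ge0 (R : realType) (d : nat) (theta p : R) :
  0 <= rival_mass d theta p.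
Proof.
apply: Rintegral_ge0 => x /=; rewrite in_itv/= andbT => /ltW.
exact: rival_density_ge0.
Qed.

Lemma rival_mass_homo (R : realType) (d : nat) (t u p : R) : (0 < d)%N ->
  0 < t -> t <= u -> u <= 1 -> 0 <= p -> rival_mass d u p <= rival_mass d t p.
Proof.
move=> d0 t0 tu u1 p0; apply: le_Rintegral => //.
- by apply: integrable_rival_density => //; rewrite u1 (lt_le_trans t0).
- by apply: integrable_rival_density => //; rewrite t0 (le_trans tu).
move=> x /=; rewrite in_itv/= andbT => /ltW x0; apply: ler_wpM2l.
  by rewrite mulr_ge0 ?exprn_ge0// ltW// shell_density_gt0.
rewrite ler_expR lerN2 !minr_slope ?(le_trans tu)//; case: ifP => // s0.
by rewrite ler_wpM2r.
Qed.

(** For [theta = 1] the minimum disappears and [exp (- (p' - p))] factors. This is why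
    [persistence_density d 1] is a Gamma density. *)
Lemma rival_mass1 (R : realType) (d : nat) (p : R) : (0 < d)%N ->
  rival_mass d 1 p = expR p * rival_mass d 1 0.
Proof.
move=> d0; rewrite /rival_mass -RintegralZl//; last first.
  by apply: integrable_rival_density => //; rewrite lexx ltr01.
apply: eq_Rintegral => x _; rewrite /rival_density !mul1r !minxx.
by rewrite [RHS]mulrCA -expRD; congr (_ * expR _); ring.
Qed.

Lemma rival_mass_le (R : realType) (d : nat) (theta p : R) : (0 < d)%N ->
  0 < theta <= 1 -> 0 <= p -> rival_mass d theta p <= expR p * rival_mass d theta 0.
Proof.
move=> d0 t01 p0; rewrite /rival_mass -RintegralZl//; last first.
  exact: integrable_rival_density.
apply: le_Rintegral => //; first exact: integrable_rival_density.
  by apply: integrable_scaled => //; exact: integrable_rival_density.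
move=> x /=; rewrite in_itv/= andbT => /ltW x0.
apply: le_trans (rival_density_le_exp d t01 p0 x0) _.
rewrite /rival_density minr_slope; last by case/andP: t01.
by rewrite subr0 x0 mulrCA.
Qed.

(** On []p, p + 1 / theta]] the exponent is at least [-1]. The length [1 / theta] of this interval
    makes the persistence vanish with [theta]. *)
Lemma rival_mass_ge (R : realType) (d : nat) (theta p : R) : (0 < d)%N ->
  0 < theta <= 1 -> 0 <= p ->
  shell_density R d * p ^+ d.-1 * expR (-1) / theta <= rival_mass d theta p.
Proof.
move=> d0 t01 p0; have /andP[t0 t1] := t01; set c := _ * expR _.
have c0 : 0 <= c by rewrite !mulr_ge0 ?expR_ge0 ?exprn_ge0// ltW// shell_density_gt0.
have iD := integrable_rival_density d0 t01 p0.
rewrite -lee_fin [leRHS]fineK; last exact: integrable_fin_num iD.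
apply: (@le_trans _ _ (\int[lebesgue_measure]_(x in `]p, (p + theta^-1)%R]) c%:E)%E).
  rewrite integral_cst//= lebesgue_measure_itv/= lte_fin ltrDl invr_gt0 t0.
  by rewrite -EFinD -EFinM lee_fin addrAC subrr add0r.
apply: (@le_trans _ _ (\int[lebesgue_measure]_(x in `]p, (p + theta^-1)%R])
    (rival_density d theta p x)%:E)%E).
  apply: ge0_le_integral => //.
  - by apply/measurable_EFinP; exact: measurable_rival_density.
  - move=> x /=; rewrite in_itv/= => /andP[px xp]; rewrite lee_fin /c.
    apply: ler_pM; rewrite ?expR_ge0//.
    + by rewrite mulr_ge0 ?exprn_ge0// ltW// shell_density_gt0.
    + rewrite ler_pM2l ?shell_density_gt0//.
      by apply: lerXn2r; rewrite ?nnegrE// ltW// (le_lt_trans p0).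
    + rewrite ler_expR lerN2 minr_slope// subr_ge0 (ltW px).
      by rewrite mulrC -ler_pdivlMr// mul1r lerBlDl.
apply: ge0_subset_integral => //.
- by apply/measurable_EFinP; exact: measurable_rival_density.
- by move=> x /=; rewrite in_itv/= andbT => /ltW x0; rewrite lee_fin rival_density_ge0.
- by move=> x /=; rewrite !in_itv/= andbT => /andP[/(le_lt_trans p0)].
Qed.

Lemma rival_mass_gt0 (R : realType) (d : nat) (theta p : R) : (0 < d)%N ->
  0 < theta <= 1 -> 0 <= p -> 0 < rival_mass d theta p.
Proof.
move=> d0 /andP[t0 t1] p0.
apply: lt_le_trans (rival_mass_homo d0 t0 t1 (lexx _) p0).
have := @rival_mass_ge R d 1 1 d0; rewrite ltr01 lexx => /(_ isT ler01).
rewrite rival_mass1// => H; rewrite rival_mass1// mulr_gt0 ?expR_gt0//.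
rewrite -(pmulr_rgt0 _ (expR_gt0 1)); apply: lt_le_trans H.
by rewrite expr1n mulr1 divr1 mulr_gt0 ?expR_gt0// shell_density_gt0.
Qed.

Lemma cvg_truncn_scaled (R : realType) (p : R) (r : nat -> R) : 0 <= p ->
  (forall n, 0 < r n) -> r @ \oo --> +oo ->
  (fun n => (Num.truncn (p * r n))%:R / r n) @ \oo --> p.
Proof.
move=> p0 r0 ry.
apply: (@squeeze_cvgr _ _ _ _ (fun n => p - (r n)^-1) (fun=> p)).
- near=> n; have /andP[h1 h2] : _ := truncn_itv (mulr_ge0 p0 (ltW (r0 n))).
  rewrite ler_pdivrMr// h1 andbT ler_pdivlMr// mulrBl mulVf ?gt_eqF//.
  by rewrite lerBlDr natr1 ltW.
- by rewrite -[X in _ --> X]subr0; apply: cvgB; [exact: cvg_cst|exact: cvgryV].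
- exact: cvg_cst.
Unshelve. all: by end_near. Qed.

(** [F] is the pointwise limit of its step interpolations of mesh [1 / n.+1]; the factor [n.+1^-1]
    cancels the normalisation of [step]. Sequences of nonnegative points are the ones for which
    limits of the rival mass are known. *)
Lemma seq_continuous_measurable (R : realType) (F : R -> R) (D : set R) :
  measurable D -> D `<=` `[0, +oo[ ->
  (forall (p : R) (ps : nat -> R), 0 <= p -> (forall n, 0 <= ps n) -> ps @ \oo --> p ->
     (fun n => F (ps n)) @ \oo --> F p) ->
  measurable_fun D F.
Proof.
move=> mD D0 cF.
pose h n x := step n.+1%:R (fun k => n.+1%:R^-1 * F (k%:R / n.+1%:R)) x.
apply: (@measurable_fun_cvg _ _ _ D h) => [n|x Dx]; first exact: measurable_step.
have x0 : 0 <= x by have := D0 _ Dx; rewrite /= in_itv/= andbT.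
under eq_fun do rewrite /h /step mulrA mulfV ?pnatr_eq0// mul1r.
have C : (fun n => (Num.truncn (x * n.+1%:R))%:R / n.+1%:R) @ \oo --> x.
  apply: cvg_truncn_scaled => //; apply/cvgryPge => A; near=> n.
  have : A <= n%:R by near: n; exact: nbhs_infty_ger.
  by move=> /le_trans; apply; rewrite ler_nat.
apply: (cF _ _ x0 _ C) => n; exact: divr_ge0.
Unshelve. all: by end_near. Qed.

Lemma le_integrable_ge0 (disp : measure_display) (T : measurableType disp)
    (R : realType) (mu : {measure set T -> \bar R}) (D : set T) (f g : T -> R) :
  measurable D -> measurable_fun D f -> (forall x, D x -> 0 <= f x) ->
  (forall x, D x -> f x <= g x) ->
  mu.-integrable D (EFin \o g) -> mu.-integrable D (EFin \o f).
Proof.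
move=> mD mf f0 fg; apply: le_integrable => //; first exact/measurable_EFinP.
move=> x Dx; rewrite lee_fin ger0_norm ?f0//.
by apply: le_trans (ler_norm _); exact: fg.
Qed.

Lemma dominated_convergence_ge0 (disp : measure_display)
    (T : measurableType disp) (R : realType) (mu : {measure set T -> \bar R})
    (D : set T) (f_ : nat -> T -> R) (f g : T -> R) :
  measurable D -> (forall n, measurable_fun D (f_ n)) ->
  (forall x, D x -> f_ ^~ x @ \oo --> f x) ->
  mu.-integrable D (EFin \o g) ->
  (forall n x, D x -> 0 <= f_ n x) ->
  (\forall n \near \oo, forall x, D x -> f_ n x <= g x) ->
  (fun n => (\int[mu]_(x in D) f_ n x)%R) @ \oo --> (\int[mu]_(x in D) f x)%R.
Proof.
move=> mD mf_ ff ig f0 [N _ fg].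
apply: (proj2 (dominated_convergence_Rintegral mD mf_ ff ig _)).
by exists N => // n Nn x Dx; rewrite ger0_norm ?f0// fg.
Qed.

Lemma itv_oy_ge0 (R : realType) (x : R) : `]0, +oo[%classic x -> 0 <= x.
Proof. by rewrite /= in_itv/= andbT => /ltW. Qed.

Lemma itv_oc_ge0 (R : realType) (b x : R) : `]0, b]%classic x -> 0 <= x.
Proof. by rewrite /= in_itv/= => /andP[/ltW]. Qed.

Lemma cvg_exprn (R : realType) (u : nat -> R) (l : R) (k : nat) :
  u @ \oo --> l -> (fun n => u n ^+ k) @ \oo --> l ^+ k.
Proof.
move=> ul; elim: k => [|k IH].
  by under eq_fun do rewrite expr0; exact: cvg_cst.
by under eq_fun do rewrite exprS; rewrite exprS; apply: cvgM.
Qed.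

Definition persistence_density (R : realType) (d : nat) (theta p : R) : R :=
  shell_density R d * p ^+ d.-1 / rival_mass d theta p.

(** The part of [persistence_density] due to the maximisers whose height lies at
least [level M]. *)
Definition truncated_density (R : realType) (d : nat) (theta M p : R) : R :=
  persistence_density d theta p * (1 - expR (- (M * rival_mass d theta p))).

Definition truncated_persistence (R : realType) (d : nat) (theta b M : R) : R :=
  (\int[lebesgue_measure]_(p in `]0, b]) truncated_density d theta M p)%R.

Lemma rival_densityE (R : realType) (d : nat) (theta p p' : R) :
  rival_density d theta p p' =
  shell_density R d * p' ^+ d.-1 * expR (- Num.min (p' - p) (theta * (p' - p))).
Proof. by []. Qed.

Lemma persistence_densityE (R : realType) (d : nat) (theta p : R) :
  persistence_density d theta p =
  shell_density R d * p ^+ d.-1 / rival_mass d theta p.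
Proof. by []. Qed.

Lemma truncated_densityE (R : realType) (d : nat) (theta M p : R) :
  truncated_density d theta M p =
  persistence_density d theta p * (1 - expR (- (M * rival_mass d theta p))).
Proof. by []. Qed.

Lemma rival_massE (R : realType) (d : nat) (theta p : R) :
  rival_mass d theta p =
  (\int[lebesgue_measure]_(p' in `]0, +oo[) rival_density d theta p p')%R.
Proof. by []. Qed.

Lemma persistenceE (R : realType) (d : nat) (theta : R) :
  persistence d theta =
  (\int[lebesgue_measure]_(p in `]0, +oo[) persistence_density d theta p)%R.
Proof. by []. Qed.

Lemma truncated_persistenceE (R : realType) (d : nat) (theta b M : R) :
  truncated_persistence d theta b M =
  (\int[lebesgue_measure]_(p in `]0, b]) truncated_density d theta M p)%R.
Proof. by []. Qed.

(* Unification would otherwise unfold these down to integrals. *)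
Opaque rival_density rival_mass persistence_density truncated_density
  persistence truncated_persistence shell_density.

Lemma cvg_persistence_density (R : realType) (d : nat) (t theta p : R)
    (th ps : nat -> R) :
  (0 < d)%N -> 0 < t -> 0 < theta <= 1 -> 0 <= p -> (forall n, t <= th n <= 1) ->
  (forall n, 0 <= ps n) -> th @ \oo --> theta -> ps @ \oo --> p ->
  (fun n => persistence_density d (th n) (ps n)) @ \oo -->
    persistence_density d theta p.
Proof.
move=> d0 t0 t01 p0 tht ps0 tc pc; rewrite persistence_densityE.
under eq_fun do rewrite persistence_densityE.
apply: cvgM.
  apply: cvgM; first exact: cvg_cst.
  exact: cvg_exprn.
apply: cvgV; first by rewrite gt_eqF// rival_mass_gt0.
exact: cvg_rival_mass t0 tht ps0 tc pc.
Qed.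

Lemma measurable_persistence_density (R : realType) (d : nat) (theta : R) (D : set R) :
  (0 < d)%N -> 0 < theta <= 1 -> measurable D -> D `<=` `[0, +oo[ ->
  measurable_fun D (persistence_density d theta).
Proof.
move=> d0 t01 mD D0; have /andP[t0 t1] := t01.
apply: seq_continuous_measurable => // p ps p0 ps0 pc.
apply: (@cvg_persistence_density _ d theta theta p (cst theta)) => //.
  by move=> n; rewrite lexx.
exact: cvg_cst.
Qed.

Lemma measurable_truncated_density (R : realType) (d : nat) (theta M : R) (D : set R) :
  (0 < d)%N -> 0 < theta <= 1 -> measurable D -> D `<=` `[0, +oo[ ->
  measurable_fun D (truncated_density d theta M).
Proof.
move=> d0 t01 mD D0; have /andP[t0 t1] := t01.
apply: seq_continuous_measurable => // p ps p0 ps0 pc.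
rewrite truncated_densityE; under eq_fun do rewrite truncated_densityE.
apply: cvgM.
  apply: (@cvg_persistence_density _ d theta theta p (cst theta)) => //.
    by move=> n; rewrite lexx.
  exact: cvg_cst.
apply: cvgB; first exact: cvg_cst.
apply: continuous_cvg; first exact: continuous_expR.
apply: cvgN; apply: cvgM; first exact: cvg_cst.
apply: (@cvg_rival_mass _ d theta theta p (cst theta)) => //.
  by move=> n; rewrite lexx.
exact: cvg_cst.
Qed.

Lemma persistence_density_ge0 (R : realType) (d : nat) (theta p : R) : 0 <= p ->
  0 <= persistence_density d theta p.
Proof.
move=> p0; rewrite persistence_densityE divr_ge0 ?rival_mass_ge0// mulr_ge0 ?exprn_ge0//.
exact/ltW/shell_density_gt0.
Qed.

Lemma truncated_density_ge0 (R : realType) (d : nat) (theta M p : R) :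
  0 <= M -> 0 <= p -> 0 <= truncated_density d theta M p.
Proof.
move=> M0 p0; rewrite truncated_densityE mulr_ge0 ?persistence_density_ge0// subr_ge0.
by rewrite -expR0 ler_expR oppr_le0 mulr_ge0 ?rival_mass_ge0.
Qed.

Lemma truncated_density_le (R : realType) (d : nat) (theta M p : R) :
  0 <= p -> truncated_density d theta M p <= persistence_density d theta p.
Proof.
move=> p0; by rewrite truncated_densityE -[leRHS]mulr1 ler_wpM2l ?persistence_density_ge0.
Qed.

Lemma persistence_density1 (R : realType) (d : nat) (p : R) : (0 < d)%N ->
  persistence_density d 1 p = (rival_mass d 1 0)^-1 * rival_density d 1 0 p.
Proof.
move=> d0; rewrite persistence_densityE rival_mass1// rival_densityE.
rewrite mul1r minxx subr0 expRN invfM; ring.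
Qed.

Lemma persistence_density_homo (R : realType) (d : nat) (t u p : R) : (0 < d)%N ->
  0 < t -> t <= u -> u <= 1 -> 0 <= p ->
  persistence_density d t p <= persistence_density d u p.
Proof.
move=> d0 t0 tu u1 p0; rewrite !persistence_densityE; apply: ler_wpM2l.
  by rewrite mulr_ge0 ?exprn_ge0// ltW// shell_density_gt0.
have u0 := lt_le_trans t0 tu.
rewrite lef_pV2 ?posrE ?rival_mass_gt0 ?t0 ?u0 ?u1 ?(le_trans tu)//.
exact: rival_mass_homo.
Qed.

Lemma integrable_persistence_density1 (R : realType) (d : nat) : (0 < d)%N ->
  (@lebesgue_measure R).-integrable `]0, +oo[ (EFin \o persistence_density d 1).
Proof.
move=> d0; have : (@lebesgue_measure R).-integrable `]0, +oo[
    (EFin \o (fun p => (rival_mass d 1 0)^-1 * rival_density d 1 0 p)).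
  apply: integrable_scaled => //.
  by apply: integrable_rival_density => //; rewrite ltr01 lexx.
by apply: eq_integrable => // p _; rewrite /= persistence_density1.
Qed.

Lemma integrable_persistence_density (R : realType) (d : nat) (theta : R) :
  (0 < d)%N -> 0 < theta <= 1 ->
  (@lebesgue_measure R).-integrable `]0, +oo[ (EFin \o persistence_density d theta).
Proof.
move=> d0 t01; have /andP[t0 t1] := t01.
apply: le_integrable_ge0 (integrable_persistence_density1 R d0).
- exact: measurable_itv.
- by apply: measurable_persistence_density => //; exact: itv_oy_sub_cy.
- by move=> p /itv_oy_ge0; exact: persistence_density_ge0.
- by move=> p /itv_oy_ge0 p0; exact: persistence_density_homo.
Qed.

Lemma persistence1 (R : realType) (d : nat) : (0 < d)%N -> persistence d (1 : R) = 1.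
Proof.
move=> d0; rewrite persistenceE.
rewrite (@eq_Rintegral _ _ _ lebesgue_measure _ (fun p => (rival_mass d 1 0)^-1 * rival_density d 1 0 p)); last first.
  by move=> p _; rewrite -persistence_density1.
rewrite RintegralZl//; last first.
  by apply: integrable_rival_density => //; rewrite ltr01 lexx.
by rewrite -rival_massE mulVf// gt_eqF// rival_mass_gt0// ltr01 lexx.
Qed.

Lemma persistence_homo (R : realType) (d : nat) (t u : R) : (0 < d)%N ->
  0 < t -> t <= u -> u <= 1 -> persistence d t <= persistence d u.
Proof.
move=> d0 t0 tu u1; rewrite !persistenceE; apply: le_Rintegral.
- exact: measurable_itv.
- by apply: integrable_persistence_density => //; rewrite t0 (le_trans tu).
- by apply: integrable_persistence_density => //; rewrite u1 (lt_le_trans t0).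
- by move=> p /itv_oy_ge0 p0; exact: persistence_density_homo.
Qed.

(** [rival_mass_le] bounds the density below by the Gamma density times a constant, the ratio of the
    two masses at [p = 0]. Positivity keeps the limiting distribution function below 1
    everywhere. *)
Lemma persistence_gt0 (R : realType) (d : nat) (theta : R) : (0 < d)%N ->
  0 < theta <= 1 -> 0 < persistence d theta.
Proof.
move=> d0 t01; have m1 : 0 < rival_mass d (1 : R) 0 by rewrite rival_mass_gt0// ltr01 lexx.
have mt : 0 < rival_mass d theta 0 by rewrite rival_mass_gt0.
apply: (@lt_le_trans _ _ ((rival_mass d theta 0)^-1 * rival_mass d 1 0)).
  by rewrite mulr_gt0 ?invr_gt0.
have i1 : (@lebesgue_measure R).-integrable `]0, +oo[ (EFin \o rival_density d 1 0).
  by apply: integrable_rival_density => //; rewrite ltr01 lexx.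
rewrite [rival_mass d 1 0]rival_massE -RintegralZl// persistenceE; apply: le_Rintegral => //.
- exact: integrable_scaled.
- exact: integrable_persistence_density.
move=> p /itv_oy_ge0 p0.
rewrite persistence_densityE rival_densityE mul1r minxx subr0 mulrCA ler_wpM2l//.
  by rewrite mulr_ge0 ?exprn_ge0// ltW// shell_density_gt0.
rewrite expRN -invfM lef_pV2 ?posrE ?mulr_gt0 ?expR_gt0 ?rival_mass_gt0//.
by rewrite mulrC rival_mass_le.
Qed.

Lemma cvg_persistence (R : realType) (d : nat) (t theta : R) (th : nat -> R) :
  (0 < d)%N -> 0 < t -> 0 < theta <= 1 -> (forall n, t <= th n <= 1) ->
  th @ \oo --> theta ->
  (fun n => persistence d (th n)) @ \oo --> persistence d theta.
Proof.
move=> d0 t0 t01 tht tc.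
have th01 n : 0 < th n <= 1.
  by have /andP[n0 n1] := tht n; rewrite n1 (lt_le_trans t0).
rewrite persistenceE; under eq_fun do rewrite persistenceE.
apply: (@dominated_convergence_ge0 _ _ _ lebesgue_measure _
  (fun n => persistence_density d (th n)) _ (persistence_density d 1)).
- exact: measurable_itv.
- by move=> n; apply: measurable_persistence_density => //; exact: itv_oy_sub_cy.
- move=> p /itv_oy_ge0 p0.
  apply: (@cvg_persistence_density _ d t theta p th (cst p)) => //.
  exact: cvg_cst.
- exact: integrable_persistence_density1.
- by move=> n p /itv_oy_ge0; exact: persistence_density_ge0.
- apply: nearW => n p /itv_oy_ge0 p0; have /andP[n0 n1] := th01 n.
  exact: persistence_density_homo.
Qed.

(** By [rival_mass_ge] the density is at most [theta * e] at every [p], and the density for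
    [theta = 1] dominates. Consequently the maximiser is almost surely replaced and the limit law
    has no mass at infinity. *)
Lemma cvg_persistence0 (R : realType) (d : nat) (th : nat -> R) :
  (0 < d)%N -> (forall n, 0 < th n <= 1) -> th @ \oo --> (0 : R) ->
  (fun n => persistence d (th n)) @ \oo --> (0 : R).
Proof.
move=> d0 th01 tc.
under eq_fun do rewrite persistenceE.
suff : (fun n => (\int[lebesgue_measure]_(p in `]0%R, +oo[)
      persistence_density d (th n) p)%R) @ \oo -->
    (\int[lebesgue_measure]_(p in `]0%R, +oo[) (cst 0 : R -> R) p)%R.
  by rewrite Rintegral_cst// mul0r.
apply: (@dominated_convergence_ge0 _ _ _ lebesgue_measure _
  (fun n => persistence_density d (th n)) _ (persistence_density d 1)).
- exact: measurable_itv.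
- by move=> n; apply: measurable_persistence_density => //; exact: itv_oy_sub_cy.
- move=> p /itv_oy_ge0 p0.
  apply: (@squeeze_cvgr _ _ _ _ (cst 0) (fun n => th n * expR 1)).
  + near=> n; rewrite persistence_density_ge0//= persistence_densityE.
    have /andP[n0 n1] := th01 n.
    have := rival_mass_ge d0 (th01 n) p0.
    rewrite ler_pdivrMr// expRN ler_pdivrMr ?expR_gt0// => H.
    rewrite ler_pdivrMr ?rival_mass_gt0//; apply: le_trans H _.
    rewrite le_eqVlt; apply/orP; left; apply/eqP; ring.
  + exact: cvg_cst.
  + by rewrite -(mul0r (expR 1)); apply: cvgM => //; exact: cvg_cst.
- exact: integrable_persistence_density1.
- by move=> n p /itv_oy_ge0; exact: persistence_density_ge0.
- apply: nearW => n p /itv_oy_ge0 p0; have /andP[n0 n1] := th01 n.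
  exact: persistence_density_homo.
Unshelve. all: by end_near. Qed.

Lemma itv_oc_sub_cy (R : realType) (a b : R) : `]a, b] `<=` `[a, +oo[.
Proof. by move=> x /=; rewrite !in_itv/= andbT => /andP[/ltW]. Qed.

Lemma itv_oc_sub_oy (R : realType) (a b : R) : `]a, b] `<=` `]a, +oo[.
Proof. by move=> x /=; rewrite !in_itv/= andbT => /andP[]. Qed.

Lemma truncated_persistence_le (R : realType) (d : nat) (theta b M : R) :
  (0 < d)%N -> 0 < theta <= 1 -> 0 <= M ->
  truncated_persistence d theta b M <= persistence d theta.
Proof.
move=> d0 t01 M0; have iG := integrable_persistence_density d0 t01.
have iGb : (@lebesgue_measure R).-integrable `]0, b]
    (EFin \o persistence_density d theta).
  by apply: integrableS iG => //; exact: itv_oc_sub_oy.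
rewrite truncated_persistenceE.
apply: (@le_trans _ _ (\int[lebesgue_measure]_(p in `]0%R, b]) persistence_density d theta p)%R).
  apply: le_Rintegral => //.
    apply: le_integrable_ge0 iGb.
    - exact: measurable_itv.
    - by apply: measurable_truncated_density => //; exact: itv_oc_sub_cy.
    - by move=> p /itv_oc_ge0; exact: truncated_density_ge0.
    - by move=> p /itv_oc_ge0; exact: truncated_density_le.
  by move=> p /itv_oc_ge0 p0; exact: truncated_density_le.
rewrite -lee_fin persistenceE /Rintegral !fineK; last 2 first.
- exact: integrable_fin_num iG.
- exact: integrable_fin_num iGb.
apply: ge0_subset_integral.
- exact: measurable_itv.
- exact: measurable_itv.
- exact: measurable_int iG.
- by move=> p /itv_oy_ge0 p0; rewrite lee_fin; exact: persistence_density_ge0.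
- exact: itv_oc_sub_oy.
Qed.

Lemma cvg_truncated_persistence (R : realType) (d : nat) (theta : R) :
  (0 < d)%N -> 0 < theta <= 1 ->
  (fun n : nat => truncated_persistence d theta n%:R n%:R) @ \oo -->
    persistence d theta.
Proof.
move=> d0 t01.
have E (n : nat) : truncated_persistence d theta n%:R n%:R =
    (\int[lebesgue_measure]_(p in `]0, +oo[)
      (truncated_density d theta n%:R \_ `]0, n%:R]) p)%R.
  by rewrite -Rintegral_mkcondr (setIidr (@itv_oc_sub_oy R 0 n%:R)) truncated_persistenceE.
under eq_fun do rewrite E.
rewrite persistenceE.
apply: (@dominated_convergence_ge0 _ _ _ lebesgue_measure _
  (fun n => truncated_density d theta n%:R \_ `]0, n%:R]) _
  (persistence_density d theta)).
- exact: measurable_itv.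
- move=> n; apply/(measurable_restrict _ _ _).1 => //.
  rewrite (setIidr (@itv_oc_sub_oy R 0 n%:R)).
  by apply: measurable_truncated_density => //; exact: itv_oc_sub_cy.
- move=> p /=; rewrite in_itv/= andbT => p0.
  have m0 : 0 < rival_mass d theta p by rewrite rival_mass_gt0// ltW.
  have L : (fun n : nat => truncated_density d theta n%:R p) @ \oo -->
      persistence_density d theta p.
    have <- : persistence_density d theta p * (1 - 0) = persistence_density d theta p.
      by rewrite subr0 mulr1.
    under eq_fun do rewrite truncated_densityE.
    apply: cvgM; first exact: cvg_cst.
    apply: cvgB; first exact: cvg_cst.
    have ny : (fun n : nat => rival_mass d theta p * n%:R) @ \oo --> +oo.
      by apply: cvgryMl => //; exact: cvgr_idn.
    under eq_fun do rewrite mulrC.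
    exact: (cvg_comp _ _ ny (@cvgr_expR R)).
  apply: cvg_trans L; apply: near_eq_cvg; near=> n.
  rewrite patchE ifT// inE/= in_itv/= p0/=.
  by near: n; exact: nbhs_infty_ger.
- exact: integrable_persistence_density.
- move=> n p /itv_oy_ge0 p0; rewrite patchE; case: ifP => _; last exact: lexx.
  exact: truncated_density_ge0.
- apply: nearW => n p /itv_oy_ge0 p0.
  rewrite patchE; case: ifP => _; last exact: persistence_density_ge0.
  exact: truncated_density_le.
Unshelve. all: by end_near. Qed.

(** * Convergence of the expected number of rivals *)

Lemma size_shell_scaled_le (R : realType) (d : nat) : (0 < d)%N ->
  exists2 C : R, 0 < C & forall r j, 0 < r ->
    (size (lattice_shell d j))%:R / r ^+ d.-1 <= C * (j.+1%:R / r) ^+ d.-1.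
Proof.
move=> d0; have [C HC] := size_shell_le d0.
exists C.+1%:R => // r j r0.
rewrite expr_div_n mulrA ler_pM2r ?invr_gt0 ?exprn_gt0// -natrX -natrM ler_nat.
by apply: leq_trans (HC j) _; rewrite leq_mul2r leqnSn orbT.
Qed.

(** A shell grows like [(1 + y) ^+ e], the tail decays with two degrees more, and the surplus makes
    the product integrable. The factor 2 comes from [1 + x ^+ 2 <= 2 * (1 + y) ^+ 2], where [1 <= r]
    keeps the mesh below 1. *)
Lemma step_domination (R : realType) (e : nat) (r x N T C C' : R) (j : nat) :
  1 <= r -> 0 <= x -> j%:R <= x * r -> x * r < j.+1%:R ->
  0 <= N -> 0 < C -> 0 < C' -> 0 <= T ->
  N <= C * (j.+1%:R / r) ^+ e -> T <= C' / (1 + j%:R / r) ^+ e.+2 ->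
  N * T <= 2 * C * C' * (1 + x ^+ 2)^-1.
Proof.
move=> r1 x0 j1 j2 N0 C0 C'0 T0 NC TC.
have r0 : 0 < r by lra.
set y := j%:R / r in TC *.
have y0 : 0 <= y by rewrite divr_ge0// ltW.
have yS : j.+1%:R / r <= 1 + y.
  by rewrite -natr1 mulrDl addrC lerD2r mul1r invf_le1.
have xy : x <= 1 + y.
  by apply: le_trans yS; rewrite ler_pdivlMr// ltW.
have Y0 : 0 < 1 + y by rewrite ltr_wpDr.
apply: (@le_trans _ _ (C * (1 + y) ^+ e * (C' / (1 + y) ^+ e.+2))).
  apply: ler_pM => //; apply: le_trans NC _; rewrite ler_pM2l//.
  by apply: lerXn2r; rewrite ?nnegrE ?(ltW Y0)// divr_ge0// ltW.
have -> : C * (1 + y) ^+ e * (C' / (1 + y) ^+ e.+2) = C * C' / (1 + y) ^+ 2.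
  by rewrite -addn2 exprD; field; rewrite expf_neq0 ?gt_eqF.
have x2 : 0 < 1 + x ^+ 2 by rewrite ltr_wpDr// sqr_ge0.
rewrite ler_pdivrMr ?exprn_gt0//.
have -> : 2 * C * C' / (1 + x ^+ 2) * (1 + y) ^+ 2 =
    C * C' * (2 * (1 + y) ^+ 2 / (1 + x ^+ 2)) by field; rewrite gt_eqF.
rewrite -[leLHS]mulr1 ler_pM2l ?mulr_gt0// ler_pdivlMr// mul1r.
have h1 : 1 <= (1 + y) ^+ 2 by rewrite exprn_ege1// lerDl.
have h2 : x ^+ 2 <= (1 + y) ^+ 2.
  by apply: lerXn2r; rewrite ?nnegrE// ltW.
lra.
Qed.

Definition rival_sum_term (R : realType) (d : nat) (g c c' r x : R) (k j : nat) : R :=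
  (size (lattice_shell d j))%:R * weibull_tail g (level d g r x + penalty c c' k j).

Lemma rival_sum_term_ge0 (R : realType) (d : nat) (g c c' r x : R) (k j : nat) :
  0 <= rival_sum_term d g c c' r x k j.
Proof. by rewrite mulr_ge0// ltW// weibull_tail_gt0. Qed.

Lemma rival_sum_cvg (R : realType) (d : nat) (g theta x p : R)
    (c c' r : nat -> R) (k : nat -> nat) :
  (0 < d)%N -> scaling d g theta c c' r -> 0 < x -> 0 <= p ->
  (fun n => (k n)%:R / r n) @ \oo --> p ->
  let q n := rival_sum_term d g (c n) (c' n) (r n) x (k n) in
  (\forall n \near \oo,
     (@lebesgue_measure R).-integrable `]0, +oo[ (EFin \o step (r n) (q n))) /\
  (fun n => (\int[lebesgue_measure]_(p' in `]0, +oo[) step (r n) (q n) p')%R) @ \oo -->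
    x * rival_mass d theta p.
Proof.
move=> d0 S x0 p0 kp q.
have [C C0 shC] := size_shell_scaled_le R d0.
have [C' C'0 domC] := site_tail_domination d0 S x0 p0 (ltn0Sn d) kp.
have r1 : \forall n \near \oo, 1 <= r n by move/cvgryPge : (scaling_ry S); exact.
(* The factor [r] of [step] is split as [r ^+ d / r ^+ d.-1]: the divisor normalises the size of the
   shell, the numerator the tail. *)
have stepE n y : step (r n) (q n) y =
    (size (lattice_shell d (Num.truncn (y * r n))))%:R / r n ^+ d.-1 *
    (r n ^+ d * weibull_tail g (level d g (r n) x +
       penalty (c n) (c' n) (k n) (Num.truncn (y * r n)))).
  have -> : r n ^+ d = r n * r n ^+ d.-1 by rewrite -exprS prednK.
  rewrite /step /q /rival_sum_term.
  by field; rewrite expf_neq0// gt_eqF// (scaling_pos S).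
have q0 n j : 0 <= q n j by exact: rival_sum_term_ge0.
have dom : \forall n \near \oo, forall y, `]0, +oo[%classic y ->
    step (r n) (q n) y <= 2 * C * C' * (1 + y ^+ 2)^-1.
  near=> n => y /itv_oy_ge0 y0; rewrite stepE.
  have rn := scaling_pos S n.
  have := mem_step_cell rn y0; rewrite in_itv/= ler_pdivrMr// ltr_pdivlMr//.
  move=> /andP[h1 h2].
  apply: (@step_domination _ d.-1 (r n) y _ _ C C' _ _ y0 h1 h2) => //.
  - by near: n.
  - by rewrite divr_ge0// exprn_ge0// ltW.
  - by rewrite mulr_ge0 ?exprn_ge0 ?ltW// weibull_tail_gt0.
  - exact: shC.
  - rewrite (prednK d0); move: (Num.truncn _).
    by near: n; exact: domC.
have mS n : measurable_fun (`]0, +oo[%classic : set R) (step (r n) (q n)).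
  by apply: measurable_step => //; [exact: scaling_pos S n|exact: itv_oy_sub_cy].
have S0 n y : `]0, +oo[%classic y -> 0 <= step (r n) (q n) y.
  by move=> _; rewrite mulr_ge0// ltW// (scaling_pos S).
split.
  apply: filterS dom => n domn.
  apply: le_integrable_ge0 (integrable_oneDsqrV_scaled (2 * C * C')) => //.
    exact: mS.
  exact: S0.
rewrite rival_massE -RintegralZl//; last first.
  exact: integrable_rival_density (scaling_theta S) p0.
apply: dominated_convergence_ge0 (integrable_oneDsqrV_scaled (2 * C * C')) S0 dom => //.
move=> y yy; have y0 := itv_oy_ge0 yy.
have yp : 0 < y by move: yy; rewrite /= in_itv/= andbT.
have jy := cvg_truncn_scaled y0 (scaling_pos S) (scaling_ry S).
under eq_fun do rewrite stepE.
rewrite rival_densityE mulrCA; apply: cvgM.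
  exact: (cvg_size_shell d0 (scaling_pos S) (scaling_ry S) yp jy).
exact: site_tail_asymp d0 S x0 kp jy.
Unshelve. all: by end_near. Qed.

(** * Probabilities of independent Weibull events *)

(** Real-valued, so that real limits and linear arithmetic apply; [fine] loses nothing on a
    probability. *)
Definition prob (disp : measure_display) (Omega : measurableType disp)
    (R : realType) (P : probability Omega R) (A : set Omega) : R := fine (P A).

Lemma probE (disp : measure_display) (Omega : measurableType disp)
    (R : realType) (P : probability Omega R) (A : set Omega) :
  measurable A -> P A = (prob P A)%:E.
Proof. by move=> mA; rewrite fineK// fin_num_measure. Qed.

Lemma prob_ge0 (disp : measure_display) (Omega : measurableType disp)
    (R : realType) (P : probability Omega R) (A : set Omega) : 0 <= prob P A.
Proof. exact: fine_ge0. Qed.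

Lemma prob_le1 (disp : measure_display) (Omega : measurableType disp)
    (R : realType) (P : probability Omega R) (A : set Omega) :
  measurable A -> prob P A <= 1.
Proof. by move=> mA; rewrite -lee_fin -probE// probability_le1. Qed.

Lemma prob_le (disp : measure_display) (Omega : measurableType disp)
    (R : realType) (P : probability Omega R) (A B : set Omega) :
  measurable A -> measurable B -> A `<=` B -> prob P A <= prob P B.
Proof. by move=> mA mB AB; rewrite -lee_fin -!probE// le_measure ?inE. Qed.

Lemma prob_setC (disp : measure_display) (Omega : measurableType disp)
    (R : realType) (P : probability Omega R) (A : set Omega) :
  measurable A -> prob P (~` A) = 1 - prob P A.
Proof.
move=> mA; apply: EFin_inj; rewrite -probE; last exact: measurableC.
by rewrite probability_setC// EFinB -probE.
Qed.

Lemma prob_setD (disp : measure_display) (Omega : measurableType disp)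
    (R : realType) (P : probability Omega R) (A B : set Omega) :
  measurable A -> measurable B -> B `<=` A ->
  prob P (A `\` B) = prob P A - prob P B.
Proof.
move=> mA mB BA; apply: EFin_inj; rewrite -probE; last exact: measurableD.
rewrite measureD//; last by rewrite ltey_eq fin_num_measure.
by rewrite (setIidr BA) EFinB -!probE.
Qed.

Lemma prob_setU_le (disp : measure_display) (Omega : measurableType disp)
    (R : realType) (P : probability Omega R) (A B : set Omega) :
  measurable A -> measurable B -> prob P (A `|` B) <= prob P A + prob P B.
Proof.
move=> mA mB; have mU := measurableU _ _ mA mB.
by rewrite -lee_fin EFinD -!probE// measureU2.
Qed.

Lemma prob_negligible (disp : measure_display) (Omega : measurableType disp)
    (R : realType) (P : probability Omega R) (A : set Omega) :
  measurable A -> P.-negligible A -> prob P A = 0.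
Proof.
move=> mA [B [mB B0 AB]]; apply/eqP; rewrite eq_le prob_ge0 andbT.
by apply: le_trans (prob_le P mA mB AB) _; rewrite /prob B0.
Qed.

Lemma countable_rV (d : nat) : countable [set: 'rV[int]_d].
Proof. exact: countableP. Qed.

Lemma bigcap_countable_measurable (disp : measure_display)
    (T : measurableType disp) (U : Type) (F : U -> set T) :
  countable [set: U] -> (forall i, measurable (F i)) -> measurable (\bigcap_i F i).
Proof.
move=> cU mF; rewrite -[X in measurable X]setCK setC_bigcap.
apply: measurableC; apply: countable_bigcupT_measurable => // i.
exact: measurableC.
Qed.

Lemma rv_level_measurable (disp : measure_display) (Omega : measurableType disp)
    (R : realType) (P : probability Omega R) (X : {RV P >-> R}) (A : set R) :
  measurable A -> measurable (X @^-1` A).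
Proof. exact: measurable_funPTI. Qed.

Section weibull_law.
Context (disp : measure_display) (Omega : measurableType disp) (R : realType)
  (P : probability Omega R) (g : R).

Lemma weibull_lt (X : {RV P >-> R}) (v : R) : 0 < g -> weibull_distributed g X ->
  prob P (X @^-1` `]-oo, v[) = 1 - weibull_tail g v.
Proof.
move=> g0 wX; have [v0|v0] := leP 0 v.
  rewrite /prob /weibull_tail max_r// (_ : _ @^-1` _ = [set w | X w < v]).
    by rewrite wX.
  by apply/seteqP; split => w /=; rewrite in_itv.
rewrite /weibull_tail max_l ?(ltW v0)// powR0 ?gt_eqF// oppr0 expR0 subrr.
apply/eqP; rewrite eq_le prob_ge0 andbT.
apply: (@le_trans _ _ (prob P (X @^-1` `]-oo, 0[))).
  apply: prob_le; [exact: rv_level_measurable|exact: rv_level_measurable|].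
  by move=> w /=; rewrite !in_itv/= => /lt_trans; exact.
rewrite /prob (_ : _ @^-1` _ = [set w | X w < 0]); last first.
  by apply/seteqP; split => w /=; rewrite in_itv.
by rewrite wX// powR0 ?gt_eqF// oppr0 expR0 subrr.
Qed.

(** The hypothesis on the law concerns strict inequalities. An atom at [v] is ruled out by
    comparison with a slightly larger height. *)
Lemma weibull_le (X : {RV P >-> R}) (v : R) : 0 < g -> weibull_distributed g X ->
  prob P (X @^-1` `]-oo, v]) = 1 - weibull_tail g v.
Proof.
move=> g0 wX; apply/eqP; rewrite eq_le; apply/andP; split; last first.
  rewrite -(weibull_lt _ g0 wX).
  apply: prob_le; [exact: rv_level_measurable|exact: rv_level_measurable|].
  by move=> w /=; rewrite !in_itv/= => /ltW.
apply/ler_addgt0Pr => e e0.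
(* At [y] the exponent has grown by exactly [e], so the tail has dropped by at most [e]. *)
set m := Num.max 0 v; set y := (m `^ g + e) `^ g^-1.
have m0 : 0 <= m by rewrite le_max lexx.
have mge0 : 0 <= m `^ g by exact: powR_ge0.
have yg : y `^ g = m `^ g + e.
  by rewrite -powRrM mulVf ?gt_eqF// powRr1// addr_ge0// ltW.
have y0 : 0 <= y by exact: powR_ge0.
have my : v < y.
  rewrite ltNge; apply/negP => yv.
  have : y `^ g <= m `^ g.
    by apply: (ge0_ler_powR (ltW g0)); rewrite ?nnegrE// /m le_max yv orbT.
  by rewrite yg gerDl leNgt e0.
apply: (@le_trans _ _ (prob P (X @^-1` `]-oo, y[))).
  apply: prob_le; [exact: rv_level_measurable|exact: rv_level_measurable|].
  by move=> w /=; rewrite !in_itv/= => /le_lt_trans; exact.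
rewrite weibull_lt// /weibull_tail (max_r y0) -/m yg opprD expRD.
have h1 := expR_ge1Dx (- e).
have h2 : expR (- m `^ g) <= 1 by rewrite -expR0 ler_expR oppr_le0.
have h3 := expR_gt0 (- m `^ g).
have : expR (- m `^ g) * (1 - e) <= expR (- m `^ g) * expR (- e).
  by rewrite ler_pM2l.
have : 0 <= (1 - expR (- m `^ g)) * e by rewrite mulr_ge0 ?subr_ge0// ltW.
lra.
Qed.

Lemma weibull_ge (X : {RV P >-> R}) (v : R) : 0 < g -> weibull_distributed g X ->
  prob P (X @^-1` `[v, +oo[) = weibull_tail g v.
Proof.
move=> g0 wX; rewrite (_ : _ @^-1` _ = ~` (X @^-1` `]-oo, v[)); last first.
  by apply/seteqP; split => w /=; rewrite !in_itv/= andbT leNgt => /negP.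
rewrite prob_setC; last exact: rv_level_measurable.
by rewrite weibull_lt// opprB addrC subrK.
Qed.

Lemma weibull_itv (X : {RV P >-> R}) (v v' : R) : 0 < g -> weibull_distributed g X ->
  v <= v' ->
  prob P (X @^-1` `[v, v'[) = weibull_tail g v - weibull_tail g v'.
Proof.
move=> g0 wX vv'.
rewrite (_ : _ @^-1` _ = (X @^-1` `[v, +oo[) `\` (X @^-1` `[v', +oo[)); last first.
  apply/seteqP; split => w /=; rewrite !in_itv/= !andbT.
    by move=> /andP[-> h]; split => //; apply/negP; rewrite -ltNge.
  by move=> [-> /negP]; rewrite -ltNge.
rewrite prob_setD ?weibull_ge//; [exact: rv_level_measurable|exact: rv_level_measurable|].
by move=> w /=; rewrite !in_itv/= !andbT; exact: le_trans.
Qed.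

End weibull_law.

Lemma prod_1B_le (R : realType) (I : Type) (s : seq I) (Q : pred I) (q : I -> R) :
  (forall i, 0 <= q i <= 1) ->
  \prod_(i <- s | Q i) (1 - q i) <= expR (- \sum_(i <- s | Q i) q i).
Proof.
move=> q01; elim: s => [|i s IH]; first by rewrite !big_nil oppr0 expR0.
rewrite !big_cons; case: (Q i) => //; rewrite opprD expRD.
have /andP[h0 h1] := q01 i.
apply: ler_pM => //; first by rewrite subr_ge0.
  apply: prodr_ge0 => j _; rewrite subr_ge0; by have /andP[] := q01 j.
exact: expR_ge1Dx.
Qed.

(** From [1 - q >= exp (- q / (1 - q))]. When [eta] tends to 0 this meets the bound above: the
    Poisson approximation of a product over many rare events. *)
Lemma prod_1B_ge (R : realType) (I : Type) (s : seq I) (Q : pred I) (q : I -> R)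
    (eta : R) :
  eta < 1 -> (forall i, 0 <= q i <= eta) ->
  expR (- (\sum_(i <- s | Q i) q i / (1 - eta))) <= \prod_(i <- s | Q i) (1 - q i).
Proof.
move=> eta1 q01; elim: s => [|i s IH]; first by rewrite !big_nil oppr0 expR0.
rewrite !big_cons; case: (Q i) => //; rewrite opprD expRD.
have /andP[h0 h1] := q01 i.
apply: ler_pM; rewrite ?expR_ge0//.
have e1 : 0 < 1 - eta by rewrite subr_gt0.
have q1 : 0 < 1 - q i by lra.
rewrite expRN -[leRHS]invrK lef_pV2 ?posrE ?invr_gt0 ?expR_gt0//.
apply: le_trans (expR_ge1Dx _).
rewrite -lerBlDl -[X in _ - X](mulfV (lt0r_neq0 q1)).
rewrite -[X in X - _]mul1r -mulrBl opprB addrC subrK.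
by rewrite ler_wpM2l// lef_pV2 ?posrE// lerB.
Qed.

(** * Maximisers for one or two slopes *)

Section winner.
Context (disp : measure_display) (Omega : measurableType disp) (R : realType)
  (P : probability Omega R) (d : nat) (g : R) (xi : 'rV[int]_d -> {RV P >-> R}).

Lemma prob_bigcap_seq (A : 'rV[int]_d -> set R) (s : seq 'rV[int]_d) :
  uniq s -> mutually_independent xi -> (forall z, measurable (A z)) ->
  prob P (\bigcap_(z in [set` s]) xi z @^-1` A z) =
  \prod_(z <- s) prob P (xi z @^-1` A z).
Proof.
move=> us ind mA; pose J := seq_fset tt s.
have pJ : perm_eq J s by rewrite (perm_trans (seq_fset_perm _ _))// undup_id.
have := ind J A mA; rewrite (perm_big _ pJ)/= => E.
rewrite /prob (_ : \bigcap_(z in _) _ = \bigcap_(z in [set` J]) xi z @^-1` A z); last first.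
  by apply/seteqP; split => w Aw z /= zJ; apply: Aw; move: zJ; rewrite /= seq_fsetE.
rewrite E (eq_bigr (fun z => (fine (P (xi z @^-1` A z)))%:E)); last first.
  by move=> z _; rewrite -probE//; exact: rv_level_measurable.
by rewrite prodEFin.
Qed.

Lemma cvg_prob_bigcap (A : 'rV[int]_d -> set R) :
  (forall z, measurable (A z)) ->
  (fun m => prob P (\bigcap_(z in [set` lattice_ball d m]) xi z @^-1` A z)) @ \oo -->
    prob P (\bigcap_z xi z @^-1` A z).
Proof.
move=> mA; pose F m := \bigcap_(z in [set` lattice_ball d m]) xi z @^-1` A z.
have mF m : measurable (F m).
  apply: fin_bigcap_measurable; first exact: finite_seq.
  by move=> z _; exact: rv_level_measurable.
have capF : \bigcap_z xi z @^-1` A z = \bigcap_m F m.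
  apply/seteqP; split => [w Aw m _ z _|w Fw z _]; first exact: Aw.
  by apply: (Fw (l1norm z)) => //=; rewrite mem_lattice_ball.
rewrite capF; apply: fine_cvg; rewrite -probE; last exact: bigcapT_measurable.
apply: (@nonincreasing_cvg_mu _ _ _ P F) => //.
  by rewrite ltey_eq fin_num_measure.
  exact: bigcapT_measurable.
move=> i j ij; apply/subsetPset => w Fw z /= zi; apply: Fw => /=.
by move: zi; rewrite !mem_lattice_ball => /leq_trans; exact.
Qed.

(** The thresholds are deterministic, unlike those in [joint_maximiser], so independence turns the
    probability into a product. [B] is the cell of heights allowed to [z0]. *)
Definition winner_event (z0 : 'rV[int]_d) (B : set R) (t : nat -> R) : set Omega :=
  \bigcap_z xi z @^-1` (if z == z0 then B else `]-oo, t (l1norm z)]%classic).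

Lemma measurable_winner_event z0 (B : set R) (t : nat -> R) : measurable B ->
  measurable (winner_event z0 B t).
Proof.
move=> mB; apply: bigcap_countable_measurable; first exact: countable_rV.
by move=> z; apply: rv_level_measurable; case: ifP.
Qed.

Lemma prob_winner_ball z0 (B : set R) (t : nat -> R) m : 0 < g -> mutually_independent xi ->
  (forall z, weibull_distributed g (xi z)) -> measurable B ->
  (l1norm z0 <= m)%N ->
  prob P (\bigcap_(z in [set` lattice_ball d m])
    xi z @^-1` (if z == z0 then B else `]-oo, t (l1norm z)]%classic)) =
  prob P (xi z0 @^-1` B) *
  \prod_(z <- lattice_ball d m | z != z0) (1 - weibull_tail g (t (l1norm z))).
Proof.
move=> g0 ind wei mB z0m; rewrite prob_bigcap_seq ?lattice_ball_uniq//; last by move=> z; case: ifP.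
rewrite (bigD1_seq z0) ?mem_lattice_ball ?lattice_ball_uniq//= eqxx.
by congr (_ * _); apply: eq_bigr => z /negbTE ->; exact: weibull_le.
Qed.

Lemma sum_tail_ball z0 (t : nat -> R) m : (l1norm z0 <= m)%N ->
  \sum_(z <- lattice_ball d m | z != z0) weibull_tail g (t (l1norm z)) =
  \sum_(j < m.+1) (size (lattice_shell d j))%:R * weibull_tail g (t j) -
  weibull_tail g (t (l1norm z0)).
Proof.
move=> z0m; have E : \sum_(z <- lattice_ball d m) weibull_tail g (t (l1norm z)) =
    \sum_(j < m.+1) (size (lattice_shell d j))%:R * weibull_tail g (t j).
  rewrite big_lattice_ball; apply: eq_bigr => j _.
  rewrite (eq_big_seq (fun=> weibull_tail g (t j))); last first.
    by move=> z; rewrite mem_lattice_shell => /eqP ->.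
  by rewrite big_const_seq count_predT iter_addr addr0 mulr_natl.
rewrite -E [X in _ = X - _](bigD1_seq z0) ?mem_lattice_ball ?lattice_ball_uniq//=.
by rewrite addrAC subrr add0r.
Qed.

(** [Q] counts the site [z0] too, whereas the product omits it; the tail in the exponent makes up
    for this. The lower bound below simply drops the term. *)
Lemma prob_winner_le z0 (B : set R) (t : nat -> R) (Q : R) : 0 < g -> mutually_independent xi ->
  (forall z, weibull_distributed g (xi z)) -> measurable B ->
  (fun m => \sum_(j < m) (size (lattice_shell d j))%:R * weibull_tail g (t j))
    @ \oo --> Q ->
  prob P (winner_event z0 B t) <=
  prob P (xi z0 @^-1` B) * expR (weibull_tail g (t (l1norm z0)) - Q).
Proof.
move=> g0 ind wei mB SQ.
have SQ1 : (fun m => \sum_(j < m.+1) (size (lattice_shell d j))%:R *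
    weibull_tail g (t j)) @ \oo --> Q by rewrite -(cvg_shiftn 1) in SQ; move: SQ;
  under [X in X @ _ --> _ -> _]eq_fun do rewrite addn1.
have L : (fun m => prob P (xi z0 @^-1` B) * expR (weibull_tail g (t (l1norm z0)) -
    \sum_(j < m.+1) (size (lattice_shell d j))%:R * weibull_tail g (t j))) @ \oo -->
    prob P (xi z0 @^-1` B) * expR (weibull_tail g (t (l1norm z0)) - Q).
  apply: cvgM; first exact: cvg_cst.
  apply: continuous_cvg; first exact: continuous_expR.
  by apply: cvgB => //; exact: cvg_cst.
apply: (@ler_cvg_to _ _ _ _ _ _ _ _ (cvg_prob_bigcap _) L).
  by move=> z; case: ifP.
near=> m; have z0m : (l1norm z0 <= m)%N by near: m; exact: nbhs_infty_ge.
rewrite prob_winner_ball// ler_wpM2l ?prob_ge0//.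
rewrite -opprB -(sum_tail_ball _ z0m); apply: prod_1B_le => z.
by rewrite weibull_tail_le1 ltW// weibull_tail_gt0.
Unshelve. all: by end_near. Qed.

Lemma prob_winner_ge z0 (B : set R) (t : nat -> R) (Q eta : R) : 0 < g -> mutually_independent xi ->
  (forall z, weibull_distributed g (xi z)) -> measurable B -> eta < 1 ->
  (forall j, weibull_tail g (t j) <= eta) ->
  (fun m => \sum_(j < m) (size (lattice_shell d j))%:R * weibull_tail g (t j))
    @ \oo --> Q ->
  prob P (xi z0 @^-1` B) * expR (- (Q / (1 - eta))) <= prob P (winner_event z0 B t).
Proof.
move=> g0 ind wei mB eta1 teta SQ.
have S0 j : 0 <= (size (lattice_shell d j))%:R * weibull_tail g (t j).
  by rewrite mulr_ge0// ltW// weibull_tail_gt0.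
have SleQ m : \sum_(j < m) (size (lattice_shell d j))%:R * weibull_tail g (t j) <= Q.
  apply: (cvgr_to_ge SQ); near=> n.
  have mn : (m <= n)%N by near: n; exact: nbhs_infty_ge.
  rewrite -!(big_mkord xpredT (fun j => (size (lattice_shell d j))%:R * weibull_tail g (t j))).
  by rewrite [leRHS](big_cat_nat _ mn)//= lerDl sumr_ge0.
apply: (cvgr_to_ge (cvg_prob_bigcap _)); first by move=> z; case: ifP.
near=> m; have z0m : (l1norm z0 <= m)%N by near: m; exact: nbhs_infty_ge.
rewrite prob_winner_ball// ler_wpM2l ?prob_ge0//.
apply: le_trans (prod_1B_ge _ _ eta1 _); last first.
  by move=> z; rewrite teta ltW// weibull_tail_gt0.
rewrite ler_expR lerN2 -mulr_suml ler_wpM2r ?invr_ge0 ?subr_ge0 ?(ltW eta1)//.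
rewrite (sum_tail_ball _ z0m); apply: le_trans (SleQ m.+1).
by rewrite gerBl ltW// weibull_tail_gt0.
Unshelve. all: by end_near. Qed.

(** [z] maximises both [xi - c |.|] and [xi - c' |.|]. *)
Definition joint_maximiser (c c' : R) (z : 'rV[int]_d) : set Omega :=
  [set w | forall y, xi y w <= xi z w + penalty c c' (l1norm z) (l1norm y)].

Lemma penaltyxx (c c' : R) k : penalty c c' k k = 0.
Proof. by rewrite /penalty subrr !mul0r minxx. Qed.

Lemma measurable_joint_maximiser c c' z : measurable (joint_maximiser c c' z).
Proof.
rewrite (_ : joint_maximiser c c' z = \bigcap_y
    [set w | xi y w <= xi z w + penalty c c' (l1norm z) (l1norm y)]); last first.
  by apply/seteqP; split => w h y; [move=> _|]; exact: h.
apply: bigcap_countable_measurable; first exact: countable_rV.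
move=> y; rewrite -[X in measurable X]setTI.
apply: measurable_fun_le => //.
by apply: measurable_funD.
Qed.

(** If the rivals stay below the thresholds of the lower end [u] of the cell, they stay below those
    of the actual height. The next lemma uses the upper end in the same way for the opposite
    inclusion. *)
Lemma joint_maximiser_cell_ge c c' z (v v' : itv_bound R) (u : R) :
  (BLeft u <= v)%O ->
  winner_event z [set` Interval v v']
    (fun j => u + penalty c c' (l1norm z) j) `<=`
  joint_maximiser c c' z `&` xi z @^-1` [set` Interval v v'].
Proof.
move=> uv w Vw; have := Vw z I; rewrite /= eqxx => zB; split => // y.
have [->|yz] := eqVneq y z; first by rewrite penaltyxx addr0.
have := Vw y I; rewrite /= (negbTE yz) /= in_itv/= => /le_trans; apply.
rewrite lerD2r; move: zB; rewrite /= itv_boundlr => /andP[+ _].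
by move=> /(le_trans uv).
Qed.

Lemma joint_maximiser_cell_le c c' z (v : itv_bound R) (u : R) :
  joint_maximiser c c' z `&` xi z @^-1` [set` Interval v (BLeft u)] `<=`
  winner_event z [set` Interval v (BLeft u)]
    (fun j => u + penalty c c' (l1norm z) j).
Proof.
move=> w [Ew zB] y _ /=; have [->//|yz] := eqVneq y z.
rewrite /= in_itv/=; apply: le_trans (Ew y) _; rewrite lerD2r.
by move: zB; rewrite /= itv_boundlr => /andP[_ /ltW].
Qed.

End winner.

(** * Riemann sums over the height of the winner *)

Lemma level_homo (R : realType) (d : nat) (g r x x' : R) : 0 < g -> 0 < r ->
  0 < x -> x <= x' -> x' <= r ^+ d -> level d g r x' <= level d g r x.
Proof.
move=> g0 r0 x0 xx' x'r; have x'0 := lt_le_trans x0 xx'.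
have lx : 0 <= d%:R * ln r - ln x'.
  by rewrite subr_ge0 mulr_natl -lnXn// ler_ln ?posrE// exprn_gt0.
have ll : ln x <= ln x' by rewrite ler_ln ?posrE.
apply: ge0_ler_powR; rewrite ?nnegrE ?invr_ge0 ?(ltW g0)//; lra.
Qed.

Lemma scaling_rX (R : realType) (d : nat) (g theta : R) (c c' r : nat -> R) :
  (0 < d)%N -> scaling d g theta c c' r -> (fun n => r n ^+ d) @ \oo --> +oo.
Proof.
move=> d0 S; apply/cvgryPge => A; near=> n.
have r1 : Num.max 1 A <= r n.
  by near: n; move/cvgryPge : (scaling_ry S); exact.
move: r1; rewrite ge_max => /andP[r1 Ar]; apply: le_trans Ar _.
by rewrite -(prednK d0) exprS ler_peMr ?exprn_ege1// (le_trans ler01).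
Unshelve. all: by end_near. Qed.

(** The integral of [exp (- u * D)] over [0 < u < x]: with [D = rival_mass], the limiting weight of
    the event that a given site wins at a height above [level x]. *)
Definition escape (R : realType) (D x : R) : R := (1 - expR (- (x * D))) / D.

Lemma escape_bounds (R : realType) (D x x' : R) : 0 < D -> x <= x' ->
  (x' - x) * expR (- (x' * D)) <= escape D x' - escape D x
    <= (x' - x) * expR (- (x * D)).
Proof.
move=> D0 xx'.
have -> : escape D x' - escape D x = (expR (- (x * D)) - expR (- (x' * D))) / D.
  by rewrite /escape -mulrBl; congr (_ / _); ring.
have E1 : expR (- (x * D)) = expR (- (x' * D)) * expR ((x' - x) * D).
  by rewrite -expRD; congr expR; ring.
have E2 : expR (- (x' * D)) = expR (- (x * D)) * expR (- ((x' - x) * D)).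
  by rewrite -expRD; congr expR; ring.
apply/andP; split.
  rewrite ler_pdivlMr// E1.
  have := expR_ge1Dx ((x' - x) * D); rewrite -(ler_pM2l (expR_gt0 (- (x' * D)))).
  by rewrite mulrDr mulr1 mulrC mulrA => ?; lra.
rewrite ler_pdivrMr// E2.
have := expR_ge1Dx (- ((x' - x) * D)); rewrite -(ler_pM2l (expR_gt0 (- (x * D)))).
rewrite mulrDr mulr1 mulrN => ?; have -> : (x' - x) * expR (- (x * D)) * D =
  expR (- (x * D)) * ((x' - x) * D) by ring.
lra.
Qed.

Section local_limit.
Context (disp : measure_display) (Omega : measurableType disp) (R : realType)
  (P : probability Omega R) (d : nat) (g : R) (xi : 'rV[int]_d -> {RV P >-> R}).

Lemma rival_sum_limit (theta x p : R) (c c' r : nat -> R) (k : nat -> nat) :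
  (0 < d)%N -> scaling d g theta c c' r -> 0 < x -> 0 <= p ->
  (fun n => (k n)%:R / r n) @ \oo --> p ->
  exists2 Q : nat -> R, Q @ \oo --> x * rival_mass d theta p &
    \forall n \near \oo,
      (fun m => \sum_(j < m) (size (lattice_shell d j))%:R *
         weibull_tail g (level d g (r n) x + penalty (c n) (c' n) (k n) j))
      @ \oo --> Q n.
Proof.
move=> d0 S x0 p0 kp; have [iS SQ] := rival_sum_cvg d0 S x0 p0 kp.
eexists; first exact: SQ.
apply: filterS iS => n iSn; apply: (cvg_sum_step (scaling_pos S n)) => // j.
exact: rival_sum_term_ge0.
Qed.

Lemma site_tail_small (theta x p : R) (c c' r : nat -> R) (k : nat -> nat) :
  (0 < d)%N -> scaling d g theta c c' r -> 0 < x -> 0 <= p ->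
  (fun n => (k n)%:R / r n) @ \oo --> p ->
  exists2 eta : nat -> R, eta @ \oo --> (0 : R) & \forall n \near \oo, forall j,
    weibull_tail g (level d g (r n) x + penalty (c n) (c' n) (k n) j) <= eta n.
Proof.
move=> d0 S x0 p0 kp.
have [C C0 domC] := site_tail_domination d0 S x0 p0 (ltn0Sn 0) kp.
exists (fun n => C * (r n ^+ d)^-1).
  rewrite -(mulr0 C); apply: cvgM; first exact: cvg_cst.
  by apply: cvgryV; exact: scaling_rX d0 S.
apply: filterS domC => n H j; have rn := scaling_pos S n.
rewrite ler_pdivlMr ?exprn_gt0// mulrC; apply: le_trans (H j) _.
rewrite expr1 ler_pdivrMr ?ltr_wpDr// ?divr_ge0 ?(ltW rn)//.
by rewrite ler_peMr ?(ltW C0)// lerDl divr_ge0 ?(ltW rn).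
Qed.

(** [level] decreases, so the cell has mass [(x' - x) / r ^+ d]. Its upper end, [level x], has the
    fewest rivals and gives the upper bound. The thresholds depend on distances only, hence the
    uniformity in [z]. *)
Lemma cell_upper (theta x x' p e : R) (c c' r : nat -> R) (k : nat -> nat) :
  (0 < d)%N -> mutually_independent xi -> (forall z, weibull_distributed g (xi z)) ->
  scaling d g theta c c' r -> 0 < x -> x < x' -> 0 <= p -> 0 < e ->
  (fun n => (k n)%:R / r n) @ \oo --> p ->
  \forall n \near \oo, forall z : 'rV[int]_d, l1norm z = k n ->
    r n ^+ d * prob P (joint_maximiser xi (c n) (c' n) z `&`
      xi z @^-1` `[level d g (r n) x', level d g (r n) x[)
    <= (x' - x) * expR (- (x * rival_mass d theta p)) + e.
Proof.
move=> d0 ind wei S x0 xx' p0 e0 kp; have g0 := scaling_gamma S.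
have [Q QD SQ] := rival_sum_limit d0 S x0 p0 kp.
have [eta eta0 tS] := site_tail_small d0 S x0 p0 kp.
have U : (fun n => (x' - x) * expR (eta n - Q n)) @ \oo -->
    (x' - x) * expR (- (x * rival_mass d theta p)).
  rewrite -(sub0r (x * _)); apply: cvgM; first exact: cvg_cst.
  by apply: continuous_cvg; [exact: continuous_expR|exact: cvgB].
have rX : \forall n \near \oo, x' <= r n ^+ d.
  by move/cvgryPge : (scaling_rX d0 S); exact.
near=> n => z zk; have rn := scaling_pos S n.
have rx' : x' <= r n ^+ d by near: n.
have mc : measurable (`[level d g (r n) x', level d g (r n) x[%classic : set R) by [].
apply: (@le_trans _ _ ((x' - x) * expR (eta n - Q n))); last first.
  near: n; apply: (cvgr_le _ U).
  by rewrite ltrDl.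
apply: (@le_trans _ _ (r n ^+ d * prob P (winner_event xi z
    `[level d g (r n) x', level d g (r n) x[
    (fun j => level d g (r n) x + penalty (c n) (c' n) (l1norm z) j)))).
  rewrite ler_pM2l ?exprn_gt0//; apply: prob_le.
  - apply: measurableI; [exact: measurable_joint_maximiser|exact: rv_level_measurable].
  - exact: measurable_winner_event.
  - exact: joint_maximiser_cell_le.
have SQn : (fun m => \sum_(j < m) (size (lattice_shell d j))%:R *
    weibull_tail g (level d g (r n) x + penalty (c n) (c' n) (l1norm z) j)) @ \oo --> Q n.
  by rewrite zk; near: n.
apply: (@le_trans _ _ (r n ^+ d * (prob P (xi z @^-1` `[level d g (r n) x', level d g (r n) x[)
   * expR (weibull_tail g (level d g (r n) x +
        penalty (c n) (c' n) (l1norm z) (l1norm z)) - Q n)))).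
  rewrite ler_pM2l ?exprn_gt0//.
  apply: (@prob_winner_le _ _ _ _ _ g _ _ _
    (fun j => level d g (r n) x + penalty (c n) (c' n) (l1norm z) j)) => //.
rewrite (weibull_itv g0 (wei z)); last exact: level_homo (ltW xx') rx'.
have x'0 : 0 < x' := lt_trans x0 xx'.
have rx : x <= r n ^+ d := le_trans (ltW xx') rx'.
rewrite !weibull_tail_level//.
rewrite -mulrBl mulrA (mulrC (r n ^+ d)) divfK ?expf_neq0 ?gt_eqF//.
rewrite ler_pM2l ?subr_gt0// ler_expR lerD2r zk.
by near: n; apply: filterS tS => n; exact.
Unshelve. all: by end_near. Qed.

(** The upper end [b] and the mass [q] of the cell are kept abstract in order to cover the unbounded
    top cell, where [q = x']. *)
Lemma cell_lower (theta x' q p e : R) (c c' r : nat -> R) (k : nat -> nat)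
    (b : nat -> itv_bound R) :
  (0 < d)%N -> mutually_independent xi -> (forall z, weibull_distributed g (xi z)) ->
  scaling d g theta c c' r -> 0 < x' -> 0 <= p -> 0 < e -> 0 <= q ->
  (\forall n \near \oo, forall z, r n ^+ d *
     prob P (xi z @^-1` [set` Interval (BLeft (level d g (r n) x')) (b n)]) = q) ->
  (fun n => (k n)%:R / r n) @ \oo --> p ->
  \forall n \near \oo, forall z : 'rV[int]_d, l1norm z = k n ->
    q * expR (- (x' * rival_mass d theta p)) - e <=
    r n ^+ d * prob P (joint_maximiser xi (c n) (c' n) z `&`
      xi z @^-1` [set` Interval (BLeft (level d g (r n) x')) (b n)]).
Proof.
move=> d0 ind wei S x'0 p0 e0 q0 cellE kp; have g0 := scaling_gamma S.
have [Q QD SQ] := rival_sum_limit d0 S x'0 p0 kp.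
have [eta eta0 tS] := site_tail_small d0 S x'0 p0 kp.
have U : (fun n => q * expR (- (Q n / (1 - eta n)))) @ \oo -->
    q * expR (- (x' * rival_mass d theta p)).
  apply: cvgM; first exact: cvg_cst.
  apply: continuous_cvg; first exact: continuous_expR.
  apply: cvgN; rewrite -[X in _ --> X]divr1 -[in X in _ --> X](subr0 1).
  apply: cvgM => //; apply: cvgV; first by rewrite subr0 oner_neq0.
  by apply: cvgB => //; exact: cvg_cst.
near=> n => z zk; have rn := scaling_pos S n.
set B := [set` Interval _ _].
have mB : measurable B by exact: measurable_itv.
have eta1 : eta n < 1.
  by near: n; apply: (cvgr_lt _ eta0); exact: ltr01.
apply: (@le_trans _ _ (q * expR (- (Q n / (1 - eta n))))).
  near: n; apply: (cvgr_ge _ U); by rewrite gtrBl.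
have cE : r n ^+ d * prob P (xi z @^-1` B) = q.
  rewrite /B; move: z {zk B mB}; near: n; exact: cellE.
rewrite -[in leLHS]cE -mulrA ler_pM2l ?exprn_gt0//.
apply: (@le_trans _ _ (prob P (winner_event xi z B
    (fun j => level d g (r n) x' + penalty (c n) (c' n) (l1norm z) j)))).
  apply: (@prob_winner_ge _ _ _ _ _ g _ _ _
    (fun j => level d g (r n) x' + penalty (c n) (c' n) (l1norm z) j)) => //.
    by rewrite zk; near: n.
  by rewrite zk; near: n.
apply: prob_le.
- exact: measurable_winner_event.
- apply: measurableI; [exact: measurable_joint_maximiser|exact: rv_level_measurable].
- exact: joint_maximiser_cell_ge.
Unshelve. all: by end_near. Qed.

Lemma prob_joint_cell (c c' v v' : R) z : v' <= v ->
  prob P (joint_maximiser xi c c' z `&` xi z @^-1` `[v', +oo[) =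
  prob P (joint_maximiser xi c c' z `&` xi z @^-1` `[v, +oo[) +
  prob P (joint_maximiser xi c c' z `&` xi z @^-1` `[v', v[).
Proof.
move=> vv'.
have mE a b : measurable (joint_maximiser xi c c' z `&` xi z @^-1` [set` Interval a b]).
  apply: measurableI; [exact: measurable_joint_maximiser|exact: rv_level_measurable].
have -> : joint_maximiser xi c c' z `&` xi z @^-1` `[v', v[ =
    (joint_maximiser xi c c' z `&` xi z @^-1` `[v', +oo[) `\`
    (joint_maximiser xi c c' z `&` xi z @^-1` `[v, +oo[).
  apply/seteqP; split => w /=; rewrite !in_itv/= !andbT.
    by move=> [Ew /andP[-> wv]]; split => // -[_]; rewrite leNgt wv.
  move=> [[Ew -> /= H]]; split => //; rewrite ltNge; apply/negP => vw.
  exact: H.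
rewrite prob_setD//; first by rewrite addrC subrK.
by move=> w /=; rewrite !in_itv/= !andbT => -[? ?]; split => //; exact: le_trans vv' _.
Qed.

(** Induction from the top cell downwards. On each cell the two bounds differ by [h * (exp (- x * D)
    - exp (- (x + h) * D))], up to the limits; these gaps telescope to the stated error. Half of [e]
    goes to the new cell. *)
Lemma top_limit_grid (theta p h : R) (c c' r : nat -> R) (k : nat -> nat) :
  (0 < d)%N -> mutually_independent xi -> (forall z, weibull_distributed g (xi z)) ->
  scaling d g theta c c' r -> 0 <= p -> 0 < h ->
  (fun n => (k n)%:R / r n) @ \oo --> p ->
  forall (i : nat) (e : R), 0 < e ->
  \forall n \near \oo, forall z : 'rV[int]_d, l1norm z = k n ->
    `|r n ^+ d * prob P (joint_maximiser xi (c n) (c' n) z `&`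
        xi z @^-1` `[level d g (r n) (i.+1%:R * h), +oo[)
      - escape (rival_mass d theta p) (i.+1%:R * h)|
    <= h * (1 - expR (- (i.+1%:R * h * rival_mass d theta p))) + e.
Proof.
move=> d0 ind wei S p0 h0 kp; have g0 := scaling_gamma S.
set D := rival_mass d theta p.
have D0 : 0 < D by rewrite rival_mass_gt0// (scaling_theta S).
have rX x : \forall n \near \oo, x <= r n ^+ d.
  by move/cvgryPge : (scaling_rX d0 S); exact.
have geE x : 0 < x -> \forall n \near \oo, forall z : 'rV[int]_d,
    r n ^+ d * prob P (xi z @^-1` `[level d g (r n) x, +oo[) = x.
  move=> x0; near=> n => z; have rn := scaling_pos S n.
  rewrite (weibull_ge _ g0 (wei z)) weibull_tail_level//; last by near: n.
  by rewrite mulrC divfK// expf_neq0// gt_eqF.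
elim=> [|i IH] e e0.
  rewrite mul1r.
  have L := cell_lower d0 ind wei S h0 p0 e0 (ltW h0) (geE h h0) kp.
  have G := geE h h0.
  near=> n => z zk; have rn := scaling_pos S n.
  have Ln : h * expR (- (h * D)) - e <= r n ^+ d *
      prob P (joint_maximiser xi (c n) (c' n) z `&` xi z @^-1` `[level d g (r n) h, +oo[).
    by move: z zk; near: n; exact: L.
  (* The top cell has no upper end; its whole mass [h] serves as upper bound. *)
  have Un : r n ^+ d *
      prob P (joint_maximiser xi (c n) (c' n) z `&` xi z @^-1` `[level d g (r n) h, +oo[) <= h.
    apply: (@le_trans _ _ (r n ^+ d * prob P (xi z @^-1` `[level d g (r n) h, +oo[))); last first.
      rewrite le_eqVlt; apply/orP; left; apply/eqP.
      by move: z {zk Ln}; near: n; exact: G.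
    rewrite ler_pM2l ?exprn_gt0//; apply: prob_le.
    - apply: measurableI; [exact: measurable_joint_maximiser|exact: rv_level_measurable].
    - exact: rv_level_measurable.
    - exact: subIsetr.
  have := escape_bounds D0 (ltW h0).
  rewrite /escape mul0r oppr0 expR0 subrr mul0r !subr0 mulr1 => /andP[h1 h2].
  by rewrite ler_norml; apply/andP; split; lra.
have e20 : 0 < e / 2 by rewrite divr_gt0.
set x := i.+1%:R * h in IH *.
have x'E : i.+2%:R * h = x + h by rewrite /x -natr1 mulrDl mul1r.
rewrite x'E.
have x0 : 0 < x by rewrite mulr_gt0.
have xx' : x < x + h by rewrite ltrDl.
have x'0 : 0 < x + h := lt_trans x0 xx'.
have IHe := IH _ e20.
have cE : \forall n \near \oo, forall z : 'rV[int]_d, r n ^+ d *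
    prob P (xi z @^-1` `[level d g (r n) (x + h), level d g (r n) x[) = h.
  near=> n => z; have rn := scaling_pos S n.
  have rx' : x + h <= r n ^+ d by near: n.
  rewrite (weibull_itv g0 (wei z)); last exact: level_homo (ltW xx') rx'.
  rewrite !weibull_tail_level//; last exact: le_trans (ltW xx') rx'.
  rewrite -mulrBl mulrC divfK ?expf_neq0 ?gt_eqF//; ring.
have L := cell_lower d0 ind wei S x'0 p0 e20 (ltW h0) cE kp.
have U := cell_upper d0 ind wei S x0 xx' p0 e20 kp.
near=> n => z zk; have rn := scaling_pos S n.
have rx' : x + h <= r n ^+ d by near: n.
rewrite (@prob_joint_cell _ _ (level d g (r n) x)); last exact: level_homo (ltW xx') rx'.
rewrite mulrDr.
have Ln : h * expR (- ((x + h) * D)) - e / 2 <= r n ^+ d *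
    prob P (joint_maximiser xi (c n) (c' n) z `&`
      xi z @^-1` `[level d g (r n) (x + h), level d g (r n) x[).
  by move: z zk; near: n; exact: L.
have Un : r n ^+ d * prob P (joint_maximiser xi (c n) (c' n) z `&`
      xi z @^-1` `[level d g (r n) (x + h), level d g (r n) x[) <=
    (x + h - x) * expR (- (x * D)) + e / 2.
  by move: z zk {Ln}; near: n; exact: U.
have := escape_bounds D0 (ltW xx').
have -> : x + h - x = h by ring.
rewrite (_ : x + h - x = h) in Un; last by ring.
have : `|r n ^+ d * prob P (joint_maximiser xi (c n) (c' n) z `&`
        xi z @^-1` `[level d g (r n) x, +oo[) - escape D x|
    <= h * (1 - expR (- (x * D))) + e / 2.
  by move: z zk {Ln Un}; near: n; exact: IHe.
move: Ln Un; move: (prob P _) (prob P _) => A B; move: (r n ^+ d * A) (r n ^+ d * B).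
move=> a b Ln Un; rewrite !ler_norml => /andP[h1 h2] /andP[h3 h4].
by apply/andP; split; lra.
Unshelve. all: by end_near. Qed.

Lemma top_limit (theta p M e : R) (c c' r : nat -> R) (k : nat -> nat) :
  (0 < d)%N -> mutually_independent xi -> (forall z, weibull_distributed g (xi z)) ->
  scaling d g theta c c' r -> 0 <= p -> 0 < M -> 0 < e ->
  (fun n => (k n)%:R / r n) @ \oo --> p ->
  \forall n \near \oo, forall z : 'rV[int]_d, l1norm z = k n ->
    `|r n ^+ d * prob P (joint_maximiser xi (c n) (c' n) z `&`
        xi z @^-1` `[level d g (r n) M, +oo[)
      - escape (rival_mass d theta p) M| <= e.
Proof.
move=> d0 ind wei S p0 M0 e0 kp.
(* The mesh [h] divides [M] and is at most [e / 2], which bounds the telescoped error. *)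
pose i := Num.truncn (M / (e / 2)); pose h := M / i.+1%:R.
have h0 : 0 < h by rewrite divr_gt0.
have ME : i.+1%:R * h = M by rewrite /h mulrC divfK.
have he : h <= e / 2.
  rewrite /h ler_pdivrMr// mulrC -ler_pdivrMr ?divr_gt0//.
  by have /andP[_ /ltW] := truncn_itv (ltW (divr_gt0 M0 (divr_gt0 e0 (ltr0n R 2)))).
have e20 : 0 < e / 2 by rewrite divr_gt0.
have := top_limit_grid d0 ind wei S p0 h0 kp i e20; rewrite ME.
apply: filterS => n H z zk; apply: (le_trans (H z zk)).
have : 0 < h * expR (- (M * rival_mass d theta p)) by rewrite mulr_gt0// expR_gt0.
lra.
Qed.

End local_limit.

(** * Ties between two sites have probability zero *)

Section tie.
Context (disp : measure_display) (Omega : measurableType disp) (R : realType)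
  (P : probability Omega R) (d : nat) (g : R) (xi : 'rV[int]_d -> {RV P >-> R}).

Lemma prob_indep2 (z z' : 'rV[int]_d) (A B : set R) :
  mutually_independent xi -> z != z' -> measurable A -> measurable B ->
  prob P (xi z @^-1` A `&` xi z' @^-1` B) =
  prob P (xi z @^-1` A) * prob P (xi z' @^-1` B).
Proof.
move=> ind zz' mA mB.
have := @prob_bigcap_seq _ _ _ _ _ xi (fun y => if y == z then A else B) [:: z; z'].
rewrite /= inE zz' => /(_ isT ind) E.
rewrite (_ : _ `&` _ = \bigcap_(y in [set` [:: z; z']])
    xi y @^-1` (if y == z then A else B)); last first.
  apply/seteqP; split => [w [Aw Bw] y /=|w H].
    rewrite !inE => /orP[/eqP ->|/eqP ->]; first by rewrite eqxx.
    by rewrite eq_sym (negbTE zz').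
  split.
    by have := H z; rewrite /= !inE !eqxx => /(_ isT).
  by have := H z'; rewrite /= !inE eqxx orbT [z' == z]eq_sym (negbTE zz') => /(_ isT).
rewrite E; last by move=> y; case: ifP.
by rewrite !big_cons big_nil mulr1 eqxx [z' == z]eq_sym (negbTE zz').
Qed.

Definition tie (z z' : 'rV[int]_d) (a : R) : set Omega :=
  [set w | xi z' w = xi z w + a].

Lemma measurable_tie z z' a : measurable (tie z z' a).
Proof.
rewrite -[X in measurable X]setTI.
have -> : tie z z' a = (fun w => xi z' w - (xi z w + a)) @^-1` [set 0].
  apply/seteqP; split => w /=; rewrite /tie /=; first by move=> ->; rewrite subrr.
  by move/eqP; rewrite subr_eq0 => /eqP.
suff : measurable_fun setT (fun w => xi z' w - (xi z w + a)) by apply.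
by apply: measurable_funB => //; exact: measurable_funD.
Qed.

(** With [d = 1] and [r = 1], [level] is the quantile function, so every cell has mass [h] for
    [xi z]. A tie forces [xi z'] into the shifted cell, an independent event; the shifted cells are
    disjoint, so their masses add up to a probability. This replaces the joint law of the two
    heights. *)
Lemma prob_tie_le (z z' : 'rV[int]_d) (a h : R) (i : nat) :
  0 < g -> mutually_independent xi -> (forall z, weibull_distributed g (xi z)) ->
  z != z' -> 0 < h -> i.+1%:R * h <= 1 ->
  prob P (tie z z' a `&` xi z @^-1` `[level 1 g 1 (i.+1%:R * h), +oo[) <=
  h * prob P (xi z' @^-1` `[level 1 g 1 (i.+1%:R * h) + a, +oo[).
Proof.
move=> g0 ind wei zz' h0.
have mX y (u v : itv_bound R) : measurable (xi y @^-1` [set` Interval u v]).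
  exact: rv_level_measurable.
have mT := measurable_tie z z' a.
have tieS (u v : R) : tie z z' a `&` xi z @^-1` `[u, v[ `<=`
    xi z @^-1` `[u, v[ `&` xi z' @^-1` `[u + a, v + a[.
  move=> w [/= Tw]; rewrite !in_itv/= => uv; split => //.
  by rewrite Tw lerD2r ltrD2r.
elim: i => [|i IH] ih.
  rewrite mul1r in ih *; set v := level _ _ _ _.
  have <- : prob P (xi z @^-1` `[v, +oo[) = h.
    rewrite (weibull_ge _ g0 (wei z)) weibull_tail_level ?expr1//.
    by rewrite divr1.
  rewrite -prob_indep2//; apply: prob_le.
  - exact: measurableI.
  - exact: measurableI.
  move=> w [/= Tw]; rewrite !in_itv/= !andbT => uv; split => //.
  by rewrite Tw lerD2r.
set x := i.+1%:R * h in IH *; set x' := i.+2%:R * h in ih *.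
have xx' : x < x' by rewrite ltr_pM2r// ltr_nat.
have x0 : 0 < x by rewrite mulr_gt0.
have x'0 := lt_trans x0 xx'.
have vv' : level 1 g 1 x' <= level 1 g 1 x by rewrite level_homo ?ltr01 ?expr1// ltW.
have IH' := IH (le_trans (ltW xx') ih).
set v := level 1 g 1 x in IH' vv' *; set v' := level 1 g 1 x' in vv' *.
have cE : prob P (xi z @^-1` `[v', v[) = h.
  rewrite (weibull_itv g0 (wei z))// !weibull_tail_level ?expr1//; last exact: le_trans (ltW xx') ih.
  by rewrite !divr1 /x /x' -natr1 mulrDl mul1r addrC addKr.
have cl : prob P (tie z z' a `&` xi z @^-1` `[v', v[) <=
    h * prob P (xi z' @^-1` `[v' + a, v + a[).
  rewrite -cE -prob_indep2//; apply: prob_le; [exact: measurableI|exact: measurableI|].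
  exact: tieS.
have E1 : tie z z' a `&` xi z @^-1` `[v', +oo[ `<=`
   (tie z z' a `&` xi z @^-1` `[v, +oo[) `|` (tie z z' a `&` xi z @^-1` `[v', v[).
  move=> w [Tw]; rewrite /= !in_itv/= !andbT => vw.
  have [h1|h1] := leP v (xi z w); first by left.
  by right; rewrite vw.
have E2 : prob P (xi z' @^-1` `[v' + a, +oo[) =
    prob P (xi z' @^-1` `[v + a, +oo[) + prob P (xi z' @^-1` `[v' + a, v + a[).
  rewrite (weibull_itv g0 (wei z')) ?lerD2r// !(weibull_ge _ g0 (wei z')).
  by rewrite [RHS]addrC subrK.
rewrite E2 mulrDr; apply: (le_trans (prob_le P _ _ E1)).
- exact: measurableI.
- by apply: measurableU; exact: measurableI.
apply: (le_trans (prob_setU_le P _ _)); [exact: measurableI|exact: measurableI|].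
exact: lerD.
Qed.

Lemma prob_tie (z z' : 'rV[int]_d) (a : R) :
  0 < g -> mutually_independent xi -> (forall z, weibull_distributed g (xi z)) ->
  z != z' -> prob P (tie z z' a) = 0.
Proof.
move=> g0 ind wei zz'; apply/eqP; rewrite eq_le prob_ge0 andbT.
apply/ler_addgt0Pr => e e0; rewrite add0r.
pose i := Num.truncn e^-1; pose h : R := i.+1%:R^-1.
have h0 : 0 < h by rewrite invr_gt0.
have he : h <= e.
  rewrite invf_ple ?posrE//.
  by have /andP[_ /ltW] := truncn_itv (ltW (divr_gt0 ltr01 e0)); rewrite mul1r.
have hi : i.+1%:R * h = 1 by rewrite mulfV.
have := @prob_tie_le z z' a h i g0 ind wei zz' h0; rewrite hi lexx => /(_ isT) H.
(* The cells reach down to height 0, below which [xi z] has no mass. *)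
have l0 : level 1 g 1 1 = 0.
  by rewrite /level !ln1 mulr0 subr0 powR0// gt_eqF// invr_gt0.
rewrite l0 in H.
have mT := measurable_tie z z' a.
have m0 (A : set R) : measurable A -> measurable (xi z @^-1` A).
  exact: rv_level_measurable.
have S : tie z z' a `<=` (tie z z' a `&` xi z @^-1` `[0, +oo[) `|` xi z @^-1` `]-oo, 0[.
  move=> w Tw; have [h1|h1] := leP 0 (xi z w); [left|right] => /=; rewrite in_itv/= ?andbT//.
apply: (le_trans (prob_le P mT _ S)).
  by apply: measurableU; [apply: measurableI => //; exact: m0|exact: m0].
apply: (le_trans (prob_setU_le P _ _)); [by apply: measurableI => //; exact: m0|exact: m0|].
rewrite (weibull_lt _ g0 (wei z)) /weibull_tail maxxx powR0 ?gt_eqF// oppr0 expR0 subrr addr0.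
apply: (le_trans H); apply: le_trans he; rewrite ler_piMr ?(ltW h0)//.
by apply: prob_le1; exact: rv_level_measurable.
Qed.

(** Both sites maximise for the common slope [c], so their penalised heights agree there. *)
Lemma joint_maximiser_tie (c c' c'' : R) z y :
  joint_maximiser xi c c' z `&` joint_maximiser xi c c'' y `<=`
  tie z y (c * (l1norm y)%:R - c * (l1norm z)%:R).
Proof.
move=> w [/(_ y) h1 /(_ z) h2].
have p1 : penalty c c' (l1norm z) (l1norm y) <= ((l1norm y)%:R - (l1norm z)%:R) * c.
  by rewrite ge_min lexx.
have p2 : penalty c c'' (l1norm y) (l1norm z) <= ((l1norm z)%:R - (l1norm y)%:R) * c.
  by rewrite ge_min lexx.
by rewrite /tie/=; apply/eqP; rewrite eq_le; apply/andP; split; lra.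
Qed.

End tie.

(** * Summation over the sites *)

Lemma bigcup_seq_cons (T : Type) (I : eqType) (i : I) (s : seq I) (F : I -> set T) :
  \bigcup_(j in [set` i :: s]) F j = F i `|` \bigcup_(j in [set` s]) F j.
Proof.
apply/seteqP; split => [w [j /=]|w [Fw|[j /= js Fw]]].
- by rewrite inE => /predU1P[->|js] Fw; [left|right; exists j].
- by exists i => //=; rewrite inE eqxx.
- by exists j => //=; rewrite inE js orbT.
Qed.

Lemma prob_bigcup_seq (disp : measure_display) (Omega : measurableType disp)
    (R : realType) (P : probability Omega R) (I : eqType) (s : seq I)
    (F : I -> set Omega) : uniq s -> (forall i, measurable (F i)) ->
  (forall i j, i != j -> prob P (F i `&` F j) = 0) ->
  measurable (\bigcup_(i in [set` s]) F i) /\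
  prob P (\bigcup_(i in [set` s]) F i) = \sum_(i <- s) prob P (F i).
Proof.
move=> + mF F0; elim: s => [|i s IH]; first by rewrite /= set_nil bigcup_set0 big_nil /prob measure0.
rewrite cons_uniq => /andP[iNs us]; have [mU IHE] := IH us.
rewrite bigcup_seq_cons; split; first exact: measurableU.
rewrite big_cons -IHE; apply/eqP; rewrite eq_le; apply/andP; split.
  exact: prob_setU_le.
have int0 : prob P (F i `&` \bigcup_(j in [set` s]) F j) = 0.
  apply/eqP; rewrite eq_le prob_ge0 andbT setI_bigcupr.
  have : forall t : seq I, {subset t <= s} ->
      measurable (\bigcup_(j in [set` t]) (F i `&` F j)) /\
      prob P (\bigcup_(j in [set` t]) (F i `&` F j)) <= 0.
    elim=> [_|j t IHt js]; first by rewrite set_nil bigcup_set0 /prob measure0.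
    have [mt t0] : measurable (\bigcup_(j in [set` t]) (F i `&` F j)) /\
      prob P (\bigcup_(j in [set` t]) (F i `&` F j)) <= 0.
      by apply: IHt => k kt; apply: js; rewrite inE kt orbT.
    rewrite bigcup_seq_cons; split.
      by apply: measurableU => //; exact: measurableI.
    apply: (le_trans (prob_setU_le P _ mt)); first exact: measurableI.
    rewrite F0 ?add0r//; apply: contraNneq iNs => ->.
    by apply: js; rewrite inE eqxx.
  by move=> /(_ s) [].
rewrite -lerBrDr -prob_setD ; [|exact: measurableU|by []|by move=> w; right].
have D : F i `<=` ((F i `|` \bigcup_(j in [set` s]) F j) `\` \bigcup_(j in [set` s]) F j)
    `|` (F i `&` \bigcup_(j in [set` s]) F j).
  move=> w Fw; have [Uw|Uw] := pselect ((\bigcup_(j in [set` s]) F j) w); first by right.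
  by left; split => //; left.
apply: (le_trans (prob_le P (mF i) _ D)).
  apply: measurableU; last exact: measurableI.
  by apply: measurableD => //; exact: measurableU.
apply: (le_trans (prob_setU_le P _ _)).
- by apply: measurableD => //; exact: measurableU.
- exact: measurableI.
by rewrite int0 addr0.
Qed.

Lemma dist_sum_le (R : realType) (I : eqType) (s : seq I) (a : I -> R) (phi e : R) :
  (forall i, i \in s -> `|a i - phi| <= e) ->
  `|\sum_(i <- s) a i - (size s)%:R * phi| <= (size s)%:R * e.
Proof.
elim: s => [_|i s IH H]; first by rewrite big_nil !mul0r subrr normr0.
rewrite big_cons /= -natr1 !mulrDl !mul1r.
have -> : a i + \sum_(j <- s) a j - ((size s)%:R * phi + phi) =
  (\sum_(j <- s) a j - (size s)%:R * phi) + (a i - phi) by ring.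
apply: le_trans (ler_normD _ _) _; apply: lerD; last by apply: H; rewrite inE eqxx.
by apply: IH => j js; apply: H; rewrite inE js orbT.
Qed.

Lemma negligible_bigcup_count (disp : measure_display) (T : measurableType disp)
    (R : realType) (mu : {measure set T -> \bar R}) (U : countType) (F : U -> set T) :
  (forall i, mu.-negligible (F i)) -> mu.-negligible (\bigcup_i F i).
Proof.
move=> F0.
have : mu.-negligible (\bigcup_n (if @choice.unpickle U n is Some i then F i else set0)).
  by apply: negligible_bigcup => n; case: choice.unpickle => // ; exact: negligible_set0.
apply: negligibleS => w [i _ Fw]; exists (choice.pickle i) => //.
by rewrite choice.pickleK.
Qed.

(** The error budget of [cvg_same_maximiser]. [S] and [S1] are the truncated sums for the ratios
    [theta] and 1, the [I] are integrals of step functions, the [t] are truncated persistences. The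
    upper bound spends [e / 4] on [S] and [e / 2] on [1 - S1]. *)
Lemma sandwich_dist (R : realType) (e pr G tG t1 tG' S S1 I I1 I' : R) :
  S <= pr -> pr <= S + (1 - S1) -> I <= S -> I1 <= S1 -> S <= I' ->
  tG - e / 4 <= I -> t1 - e / 4 <= I1 -> I' <= tG' + e / 4 ->
  G - e / 4 <= tG -> 1 - e / 4 <= t1 -> tG' <= G -> `|pr - G| <= e.
Proof. by move=> *; rewrite ler_norml; apply/andP; split; lra. Qed.

Section outer.
Context (disp : measure_display) (Omega : measurableType disp) (R : realType)
  (P : probability Omega R) (d : nat) (g : R) (xi : 'rV[int]_d -> {RV P >-> R}).

Definition top_event (c c' v : R) (z : 'rV[int]_d) : set Omega :=
  joint_maximiser xi c c' z `&` xi z @^-1` `[v, +oo[.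

Definition shell_mass (c c' v : R) (k : nat) : R :=
  \sum_(z <- lattice_shell d k) prob P (top_event c c' v z).

Lemma measurable_top_event c c' v z : measurable (top_event c c' v z).
Proof.
apply: measurableI; [exact: measurable_joint_maximiser|exact: rv_level_measurable].
Qed.

Lemma shell_mass_ge0 c c' v k : 0 <= shell_mass c c' v k.
Proof. by apply: sumr_ge0 => z _; exact: prob_ge0. Qed.

Lemma shell_mass_scaled (c c' v r : R) k : (0 < d)%N -> 0 < r ->
  r * shell_mass c c' v k =
  (\sum_(z <- lattice_shell d k) (r ^+ d * prob P (top_event c c' v z))) / r ^+ d.-1.
Proof.
move=> d0 r0; have -> : r ^+ d = r * r ^+ d.-1 by rewrite -exprS prednK.
by rewrite -mulr_sumr -/(shell_mass c c' v k); field; rewrite expf_neq0// gt_eqF.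
Qed.

Lemma shell_mass_limit (theta p M : R) (c c' r : nat -> R) (k : nat -> nat) :
  (0 < d)%N -> mutually_independent xi -> (forall z, weibull_distributed g (xi z)) ->
  scaling d g theta c c' r -> 0 < p -> 0 < M ->
  (fun n => (k n)%:R / r n) @ \oo --> p ->
  (fun n => r n * shell_mass (c n) (c' n) (level d g (r n) M) (k n)) @ \oo -->
    truncated_density d theta M p.
Proof.
move=> d0 ind wei S p0 M0 kp.
pose N n := (size (lattice_shell d (k n)))%:R / r n ^+ d.-1.
pose L := shell_density R d * p ^+ d.-1.
have NL : N @ \oo --> L.
  exact: cvg_size_shell d0 (scaling_pos S) (scaling_ry S) p0 kp.
set phi := escape (rival_mass d theta p) M.
have L0 : 0 < L by rewrite mulr_gt0 ?exprn_gt0// shell_density_gt0.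
have -> : truncated_density d theta M p = L * phi.
  by rewrite truncated_densityE persistence_densityE /phi /escape /L; ring.
have NLphi : (fun n => N n * phi) @ \oo --> L * phi.
  by apply: cvgM => //; exact: cvg_cst.
apply/cvgrPdist_le => /= e e0.
(* Eventually the shell has at most [(L + 1) * r ^+ d.-1] sites, so errors [e'] per site add up to
   [e / 2]. *)
pose e' := e / (2 * (L + 1)).
have e'0 : 0 < e' by rewrite divr_gt0// mulr_gt0//; lra.
have T := top_limit d0 ind wei S (ltW p0) M0 e'0 kp.
near=> n; have rn := scaling_pos S n.
have h1 : `|L * phi - N n * phi| <= e / 2.
  by near: n; move/cvgrPdist_le : NLphi; apply; rewrite divr_gt0.
have N1 : N n <= L + 1 by near: n; apply: (cvgr_le _ NL); lra.
have rd0 : 0 < r n ^+ d.-1 by rewrite exprn_gt0.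
have h2 : `|r n * shell_mass (c n) (c' n) (level d g (r n) M) (k n) - N n * phi| <= e / 2.
  rewrite shell_mass_scaled// /N mulrAC -mulrBl normrM.
  rewrite (gtr0_norm (_ : 0 < (r n ^+ d.-1)^-1)) ?invr_gt0//.
  have D : `|\sum_(z <- lattice_shell d (k n))
       (r n ^+ d * prob P (top_event (c n) (c' n) (level d g (r n) M) z)) -
       (size (lattice_shell d (k n)))%:R * phi| <=
      (size (lattice_shell d (k n)))%:R * e'.
    apply: dist_sum_le => z; rewrite mem_lattice_shell => /eqP.
    by move: z; near: n; exact: T.
  apply: (@le_trans _ _ (N n * e')).
    by rewrite /N mulrAC ler_pM2r ?invr_gt0.
  apply: (@le_trans _ _ ((L + 1) * e')); first by rewrite ler_pM2r.
  rewrite le_eqVlt; apply/orP; left; apply/eqP; rewrite /e'.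
  by field; rewrite gt_eqF//; lra.
rewrite distrC in h2.
have -> : L * phi - r n * shell_mass (c n) (c' n) (level d g (r n) M) (k n) =
  (L * phi - N n * phi) +
  (N n * phi - r n * shell_mass (c n) (c' n) (level d g (r n) M) (k n)) by ring.
apply: le_trans (ler_normD _ _) _.
by apply: (le_trans (lerD h1 h2)); rewrite -splitr.
Unshelve. all: by end_near. Qed.

(** Forgetting maximality leaves mass [M / r ^+ d] per site. On a bounded interval this gives a
    constant dominating function. *)
Lemma shell_mass_bound (theta M b : R) (c c' r : nat -> R) :
  (0 < d)%N -> (forall z, weibull_distributed g (xi z)) ->
  scaling d g theta c c' r -> 0 < M -> 0 <= b ->
  exists B, \forall n \near \oo, forall k, k%:R / r n <= b ->
    r n * shell_mass (c n) (c' n) (level d g (r n) M) k <= B.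
Proof.
move=> d0 wei S M0 b0; have g0 := scaling_gamma S.
have [C C0 shC] := size_shell_scaled_le R d0.
exists (C * (b + 1) ^+ d.-1 * M).
have rX : \forall n \near \oo, M <= r n ^+ d.
  by move/cvgryPge : (scaling_rX d0 S); exact.
have r1 : \forall n \near \oo, 1 <= r n by move/cvgryPge : (scaling_ry S); exact.
near=> n => k kb; have rn := scaling_pos S n.
have Mr : M <= r n ^+ d by near: n.
have rn1 : 1 <= r n by near: n.
rewrite shell_mass_scaled//.
apply: (@le_trans _ _ ((size (lattice_shell d k))%:R / r n ^+ d.-1 * M)).
  rewrite mulrAC ler_pM2r ?invr_gt0 ?exprn_gt0//.
  apply: (@le_trans _ _ (\sum_(z <- lattice_shell d k) M)); last first.
    by rewrite big_const_seq count_predT iter_addr addr0 mulr_natl.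
  apply: ler_sum => z _.
  apply: (@le_trans _ _ (r n ^+ d * prob P (xi z @^-1` `[level d g (r n) M, +oo[))).
    rewrite ler_pM2l ?exprn_gt0//; apply: prob_le.
    - exact: measurable_top_event.
    - exact: rv_level_measurable.
    - exact: subIsetr.
  rewrite (weibull_ge _ g0 (wei z)) weibull_tail_level//.
  by rewrite mulrC divfK// expf_neq0// gt_eqF.
rewrite ler_pM2r//; apply: (le_trans (shC _ _ rn)); rewrite ler_pM2l//.
apply: lerXn2r; rewrite ?nnegrE ?divr_ge0 ?addr_ge0 ?(ltW rn)//.
by rewrite -natr1 mulrDl lerD// mul1r invf_le1.
Unshelve. all: by end_near. Qed.

Lemma shell_mass_integral (theta M b : R) (c c' r : nat -> R) :
  (0 < d)%N -> mutually_independent xi -> (forall z, weibull_distributed g (xi z)) ->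
  scaling d g theta c c' r -> 0 < M -> 0 <= b ->
  let S n := shell_mass (c n) (c' n) (level d g (r n) M) in
  (\forall n \near \oo,
     (@lebesgue_measure R).-integrable `]0, b] (EFin \o step (r n) (S n))) /\
  (fun n => (\int[lebesgue_measure]_(p in `]0, b]) step (r n) (S n) p)%R) @ \oo -->
    truncated_persistence d theta b M.
Proof.
move=> d0 ind wei S M0 b0 Sh.
have [B HB] := shell_mass_bound d0 wei S M0 b0.
split.
  apply: filterS HB => n Hn.
  apply: integrable_step_bounded Hn; first exact: scaling_pos S n.
  exact: shell_mass_ge0.
rewrite truncated_persistenceE.
apply: (@dominated_convergence_ge0 _ _ _ lebesgue_measure _ _ _ (cst B)).
- exact: measurable_itv.
- move=> n; apply: measurable_step => //; first exact: scaling_pos S n.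
  exact: itv_oc_sub_cy.
- move=> p pb; have p0 := itv_oc_ge0 pb.
  have pp : 0 < p by move: pb; rewrite /= in_itv/= => /andP[].
  apply: (shell_mass_limit d0 ind wei S pp M0).
  exact: cvg_truncn_scaled p0 (scaling_pos S) (scaling_ry S).
- exact: integrable_cst_itv.
- by move=> n p _; rewrite mulr_ge0 ?shell_mass_ge0// ltW// (scaling_pos S).
- apply: filterS HB => n Hn p pb; have p0 := itv_oc_ge0 pb.
  apply: Hn; have := mem_step_cell (scaling_pos S n) p0.
  rewrite in_itv/= => /andP[/le_trans + _]; apply.
  by move: pb; rewrite /= in_itv/= => /andP[].
Qed.

Definition same_maximiser (c c' : R) : set Omega :=
  \bigcup_z joint_maximiser xi c c' z.

Lemma measurable_same_maximiser c c' : measurable (same_maximiser c c').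
Proof.
apply: countable_bigcupT_measurable; first exact: countable_rV.
by move=> z; exact: measurable_joint_maximiser.
Qed.

Lemma prob_joint_maximiser2 (c c' : R) z y : 0 < g ->
  mutually_independent xi -> (forall z, weibull_distributed g (xi z)) -> z != y ->
  prob P (joint_maximiser xi c c' z `&` joint_maximiser xi c c' y) = 0.
Proof.
move=> g0 ind wei zy; apply/eqP; rewrite eq_le prob_ge0 andbT.
have mJ := measurable_joint_maximiser xi c c'.
apply: (@le_trans _ _ (prob P (tie xi z y (c * (l1norm y)%:R - c * (l1norm z)%:R)))).
  apply: prob_le; [exact: measurableI|exact: measurable_tie|].
  exact: joint_maximiser_tie.
by rewrite (prob_tie _ g0 ind wei zy).
Qed.

Lemma top_event_ball (c c' v : R) m : 0 < g ->
  mutually_independent xi -> (forall z, weibull_distributed g (xi z)) ->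
  measurable (\bigcup_(z in [set` lattice_ball d m]) top_event c c' v z) /\
  prob P (\bigcup_(z in [set` lattice_ball d m]) top_event c c' v z) =
  \sum_(k < m.+1) shell_mass c c' v k.
Proof.
move=> g0 ind wei; rewrite -big_lattice_ball.
apply: prob_bigcup_seq; first exact: lattice_ball_uniq.
  exact: measurable_top_event.
move=> z y zy; apply/eqP; rewrite eq_le prob_ge0 andbT.
rewrite -(prob_joint_maximiser2 c c' g0 ind wei zy); apply: prob_le.
- by apply: measurableI; exact: measurable_top_event.
- by apply: measurableI; exact: measurable_joint_maximiser.
- by move=> w [[? _] [? _]].
Qed.

(** The diagonal contributes [set0], so that the union runs over a whole countable type. *)
Definition double_maximiser (c : R) : set Omega :=
  \bigcup_(zy : 'rV[int]_d * 'rV[int]_d)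
    (if zy.1 == zy.2 then set0
     else joint_maximiser xi c c zy.1 `&` joint_maximiser xi c c zy.2).

Lemma measurable_double_maximiser c : measurable (double_maximiser c).
Proof.
apply: countable_bigcupT_measurable; first exact: countableP.
move=> [z y] /=; case: ifP => _; first exact: measurable0.
by apply: measurableI; exact: measurable_joint_maximiser.
Qed.

Lemma negligible_double_maximiser c : 0 < g ->
  mutually_independent xi -> (forall z, weibull_distributed g (xi z)) ->
  P.-negligible (double_maximiser c).
Proof.
move=> g0 ind wei; apply: negligible_bigcup_count => -[z y] /=.
case: eqVneq => [_|zy]; first exact: negligible_set0.
have mJ := measurable_joint_maximiser xi c c.
exists (joint_maximiser xi c c z `&` joint_maximiser xi c c y).
split => //; first exact: measurableI.
rewrite probE; last exact: measurableI.
by rewrite (prob_joint_maximiser2 _ _ g0 ind wei zy).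
Qed.

Lemma joint_maximiser_left (c c' : R) z :
  joint_maximiser xi c c' z `<=` joint_maximiser xi c c z.
Proof.
move=> w H y; apply: le_trans (H y) _; rewrite lerD2l /penalty minxx.
by rewrite ge_min lexx.
Qed.

Lemma same_maximiser_ge (c c' v : R) m : 0 < g ->
  mutually_independent xi -> (forall z, weibull_distributed g (xi z)) ->
  \sum_(k < m.+1) shell_mass c c' v k <= prob P (same_maximiser c c').
Proof.
move=> g0 ind wei; have [mU <-] := top_event_ball c c' v m g0 ind wei.
apply: prob_le => //; first exact: measurable_same_maximiser.
by move=> w [z _ [Jz _]]; exists z.
Qed.

(** If some site of the ball of height at least [v] maximises for [c], it is the joint maximiser,
    unless [c] has two maximisers. Otherwise the complement of the truncated event for [(c, c)]
    occurs. *)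
Lemma same_maximiser_le (c c' v : R) m : 0 < g ->
  mutually_independent xi -> (forall z, weibull_distributed g (xi z)) ->
  prob P (same_maximiser c c') <=
  \sum_(k < m.+1) shell_mass c c' v k + (1 - \sum_(k < m.+1) shell_mass c c v k).
Proof.
move=> g0 ind wei.
have [mU UE] := top_event_ball c c' v m g0 ind wei.
have [mV VE] := top_event_ball c c v m g0 ind wei.
rewrite -UE -VE -prob_setC//.
have mA := measurable_same_maximiser c c'.
have mD := measurable_double_maximiser c.
have mVC := measurableC mV.
have D0 := prob_negligible mD (negligible_double_maximiser c g0 ind wei).
set U := \bigcup_(z in _) top_event c c' v z in mU *.
set V := \bigcup_(z in _) top_event c c v z in mV mVC *.
have S : same_maximiser c c' `<=` (U `|` ~` V) `|` double_maximiser c.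
  move=> w [z _ Jz]; have [[y /= ym [Jy yv]]|nV] := pselect (V w); last by left; right.
  have [zy|zy] := eqVneq z y.
    by left; left; exists y => //; split => //; rewrite -zy.
  right; exists (z, y) => //=; rewrite (negbTE zy); split => //.
  exact: joint_maximiser_left Jz.
have mUV := measurableU _ _ mU mVC.
apply: (le_trans (prob_le P mA (measurableU _ _ mUV mD) S)).
apply: (le_trans (prob_setU_le P mUV mD)).
by rewrite D0 addr0; exact: prob_setU_le.
Qed.

Theorem cvg_same_maximiser (theta : R) (c c' r : nat -> R) :
  (0 < d)%N -> mutually_independent xi -> (forall z, weibull_distributed g (xi z)) ->
  scaling d g theta c c' r ->
  (fun n => prob P (same_maximiser (c n) (c' n))) @ \oo --> persistence d theta.
Proof.
move=> d0 ind wei S; have g0 := scaling_gamma S.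
(* The pair [(c, c)] has the same scale with ratio 1; it measures the mass lost to the cut-offs. *)
have S1 : scaling d g 1 c c r.
  case: S => _ _ cc' r0 ry _ rc; split => //; first by rewrite ltr01 lexx.
    by move=> n; have /andP[h1 h2] := cc' n; rewrite lexx andbT (lt_le_trans h1).
  under eq_fun => n.
    rewrite divff; last by have /andP[h1 h2] := cc' n; rewrite gt_eqF// (lt_le_trans h1).
    over.
  exact: cvg_cst.
have t01 := scaling_theta S.
have o01 : 0 < (1 : R) <= 1 by rewrite ltr01 lexx.
apply/cvgrPdist_le => /= e e0; have e40 : 0 < e / 4 by rewrite divr_gt0.
have tp1 := @cvg_truncated_persistence R d 1 d0 o01.
rewrite persistence1// in tp1.
have lt1 : 1 - e / 4 < 1 by rewrite gtrBl.
have ltp : persistence d theta - e / 4 < persistence d theta by rewrite gtrBl.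
(* One [b] will serve as cut-off in space and in height, for both ratios. *)
have [N0 _ HN0] := filterI (cvgr_ge _ (cvg_truncated_persistence d0 t01) _ ltp)
  (filterI (cvgr_ge _ tp1 _ lt1) (nbhs_infty_gt 0)).
have [HN1 [HN2 Np]] := HN0 N0 (leqnn _).
have {HN0 HN1 HN2 N0 Np} [b [b0 HN1 HN2]] : exists b : R, [/\ 0 < b,
    persistence d theta - e / 4 <= truncated_persistence d theta b b &
    1 - e / 4 <= truncated_persistence d 1 b b].
  by exists N0%:R; split; [rewrite ltr0n|exact: HN1|exact: HN2].
have b1 : 0 <= b + 1 by rewrite addr_ge0 ?ler01 ?ltW.
have [iA cA] := shell_mass_integral d0 ind wei S b0 (ltW b0).
have [iB cB] := shell_mass_integral d0 ind wei S1 b0 (ltW b0).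
(* The last of the [m.+1] cells passes [b] but not [b + 1], as the mesh is at most 1; the upper
   bound therefore integrates up to [b + 1]. *)
have [iC cC] := shell_mass_integral d0 ind wei S b0 b1.
have TC := truncated_persistence_le (b + 1) d0 t01 (ltW b0).
have r1 : \forall n \near \oo, 1 <= r n by move/cvgryPge : (scaling_ry S); exact.
have lt2 x : x - e / 4 < x by rewrite gtrBl.
have lt3 x : x < x + e / 4 by rewrite ltrDl.
have cA2 := cvgr_ge _ cA _ (lt2 _).
have cB2 := cvgr_ge _ cB _ (lt2 _).
have cC2 := cvgr_le _ cC _ (lt3 _).
near=> n; have rn := scaling_pos S n.
have rn1 : 1 <= r n by near: n.
pose m := Num.truncn (b * r n); pose v := level d g (r n) b.
have /andP[m1 m2] : m%:R <= b * r n < m.+1%:R.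
  by apply: truncn_itv; rewrite mulr_ge0// ltW.
have mb : b < m.+1%:R / r n by rewrite ltr_pdivlMr.
have mb1 : m.+1%:R / r n <= b + 1.
  by rewrite ler_pdivrMr// mulrDl mul1r -natr1 lerD.
have iAn : (@lebesgue_measure R).-integrable `]0, b]
    (EFin \o step (r n) (shell_mass (c n) (c' n) v)) by rewrite /v; near: n.
have iBn : (@lebesgue_measure R).-integrable `]0, b]
    (EFin \o step (r n) (shell_mass (c n) (c n) v)) by rewrite /v; near: n.
have iCn : (@lebesgue_measure R).-integrable `]0, (b + 1)]
    (EFin \o step (r n) (shell_mass (c n) (c' n) v)) by rewrite /v; near: n.
have A1 := ge_sum_step rn (shell_mass_ge0 (c n) (c' n) v) iAn mb.
have B1 := ge_sum_step rn (shell_mass_ge0 (c n) (c n) v) iBn mb.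
have C1 := le_sum_step rn (shell_mass_ge0 (c n) (c' n) v) iCn mb1.
have A2 : truncated_persistence d theta b b - e / 4 <=
    (\int[lebesgue_measure]_(p in `]0, b]) step (r n) (shell_mass (c n) (c' n) v) p)%R.
  by rewrite /v; near: n; exact: cA2.
have B2 : truncated_persistence d (1 : R) b b - e / 4 <=
    (\int[lebesgue_measure]_(p in `]0, b]) step (r n) (shell_mass (c n) (c n) v) p)%R.
  by rewrite /v; near: n; exact: cB2.
have C2 : (\int[lebesgue_measure]_(p in `]0, (b + 1)%R]) step (r n) (shell_mass (c n) (c' n) v) p)%R
    <= truncated_persistence d theta (b + 1) b + e / 4.
  by rewrite /v; near: n; exact: cC2.
have L1 := same_maximiser_ge (c n) (c' n) v m g0 ind wei.
have L2 := same_maximiser_le (c n) (c' n) v m g0 ind wei.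
rewrite distrC; exact: sandwich_dist L1 L2 A1 B1 C1 A2 B2 C2 HN1 HN2 TC.
Unshelve. all: by end_near. Qed.

End outer.

(** * The slope as a function of time *)

Lemma cvg_ln_div (R : realType) (y : nat -> R) : y @ \oo --> +oo ->
  (fun n => ln (y n) / y n) @ \oo --> (0 : R).
Proof.
move=> yy; have ly := cvgry_ln yy.
have l0 : \forall n \near \oo, 0 < ln (y n) by move/cvgryPgt : ly; exact.
have y0 : \forall n \near \oo, 0 < y n by move/cvgryPgt : yy; exact.
apply: (@squeeze_cvgr _ _ _ _ (cst 0) (fun n => 2 * (ln (y n))^-1)).
- near=> n; have ln0 : 0 < ln (y n) by near: n.
  have yn0 : 0 < y n by near: n.
  rewrite divr_ge0 ?(ltW ln0) ?(ltW yn0)//= ler_pdivrMr// mulrAC ler_pdivlMr//.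
  by have := exprn_le_expR 2 (ltW ln0); rewrite lnK ?posrE// expr2.
- exact: cvg_cst.
- by rewrite -(mulr0 2); apply: cvgM; [exact: cvg_cst|exact: cvgryV].
Unshelve. all: by end_near. Qed.

(** [scaling_norm] defines [r] implicitly, through [ln r]. Replacing [d * ln r] by [l = - d * ln c]
    makes [r] explicit, and the quotient [q] of the two tends to 1, so the normalisation survives in
    the limit. *)
Lemma exists_scaling (R : realType) (d : nat) (g theta : R) (c c' : nat -> R) :
  (0 < d)%N -> 0 < g -> 0 < theta <= 1 -> (forall n, 0 < c' n <= c n) ->
  (forall n, c n < 1) -> c @ \oo --> (0 : R) ->
  (fun n => c' n / c n) @ \oo --> theta ->
  exists r, scaling d g theta c c' r.
Proof.
move=> d0 g0 t01 cc' c1 cc ct.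
have c0 n : 0 < c n by have /andP[/lt_le_trans h1 h2] := cc' n; exact: h1.
pose l n := d%:R * - ln (c n).
have d0' : 0 < d%:R :> R by rewrite ltr0n.
have l0 n : 0 < l n by rewrite mulr_gt0// oppr_gt0 ln_lt0// c0 c1.
have ly : l @ \oo --> +oo.
  apply: cvgryMl => //; apply/cvgryPge => A; near=> n.
  rewrite -lnV ?posrE// -[A]expRK ler_ln ?posrE ?invr_gt0 ?expR_gt0//.
  rewrite -[expR A]invrK lef_pV2 ?posrE ?invr_gt0 ?expR_gt0// ltW//.
  by near: n; apply: (cvgr_lt _ cc); rewrite invr_gt0 expR_gt0.
pose k := 1 - g^-1.
pose r n := (g * c n * l n `^ k)^-1.
have r0 n : 0 < r n by rewrite invr_gt0 !mulr_gt0// powR_gt0.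
have lr n : ln (r n) = - ln (c n) - ln g - k * ln (l n).
  rewrite /r; move: (l n) (l0 n) (c n) (c0 n) => L L0 C C0.
  rewrite lnV ?posrE ?mulr_gt0 ?powR_gt0// lnM ?posrE ?mulr_gt0 ?powR_gt0//.
  by rewrite lnM ?posrE// ln_powR; ring.
pose q n := d%:R * ln (r n) / l n.
have qE n : q n = 1 - d%:R * ln g * (l n)^-1 - d%:R * k * (ln (l n) / l n).
  have : l n != 0 by rewrite gt_eqF.
  rewrite /q lr => ln0.
  have -> : d%:R * (- ln (c n) - ln g - k * ln (l n)) =
    l n - d%:R * ln g - d%:R * k * ln (l n) by rewrite /l; ring.
  by field.
have q1 : q @ \oo --> (1 : R).
  have -> : q = (fun n => 1 - d%:R * ln g * (l n)^-1 - d%:R * k * (ln (l n) / l n)).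
    by apply/funext.
  rewrite -[X in _ --> X](_ : 1 - d%:R * ln g * 0 - d%:R * k * 0 = 1); last first.
    by rewrite !mulr0 !subr0.
  apply: cvgB; last by apply: cvgM; [exact: cvg_cst|exact: cvg_ln_div].
  apply: cvgB; first exact: cvg_cst.
  by apply: cvgM; [exact: cvg_cst|exact: cvgryV].
have q12 : \forall n \near \oo, 2^-1 <= q n.
  by apply: (cvgr_ge _ q1); rewrite invf_lt1// ltr1n.
have ry : r @ \oo --> +oo.
  apply/cvgryPge => A; near=> n.
  apply: (@le_trans _ _ (ln (r n))); last exact/ltW/ln_sublinear.
  have h1 : 2^-1 <= q n by near: n.
  have h2 : 2 * d%:R * Num.max A 0 <= l n by near: n; move/cvgryPge : ly; exact.
  have h3 : 2^-1 * l n <= d%:R * ln (r n) by rewrite -ler_pdivlMr.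
  rewrite -(ler_pM2l d0'); apply: le_trans h3.
  apply: (@le_trans _ _ (d%:R * Num.max A 0)).
    by rewrite ler_pM2l// le_max lexx.
  by rewrite [leRHS]mulrC ler_pdivlMr// mulrC mulrA.
exists r; split => //.
have P1 : (fun n => expR (k * ln (q n))) @ \oo --> (1 : R).
  rewrite -[X in _ --> X]expR0 -(mulr0 k) -ln1.
  apply: continuous_cvg; first exact: continuous_expR.
  apply: cvgM; first exact: cvg_cst.
  by apply: continuous_cvg q1; exact: continuous_ln.
apply: cvg_trans P1; apply: near_eq_cvg; near=> n.
have q0 : 0 < q n.
  have : 2^-1 <= q n by near: n.
  by apply: lt_le_trans; rewrite invr_gt0.
have -> : d%:R * ln (r n) = l n * q n by rewrite /q [RHS]mulrC divfK// gt_eqF.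
rewrite powRM ?(ltW q0) ?(ltW (l0 n))// [q n `^ _]/powR gt_eqF// -/k /r.
by field; rewrite !gt_eqF// powR_gt0.
Unshelve. all: by end_near. Qed.

Definition slope (R : realType) (g t : R) : R := ln (ln t) / (g * t).

(** From this time on [ln (ln t) >= 1], which makes the slope positive and strictly decreasing. *)
Definition slope_start (R : realType) : R := expR (expR 1).

Lemma ln_slope_start (R : realType) (t : R) : slope_start R <= t ->
  [/\ 1 <= t, expR 1 <= ln t & 1 <= ln (ln t)].
Proof.
move=> t0; have tp : 0 < t := lt_le_trans (expR_gt0 _) t0.
have lt : expR 1 <= ln t by rewrite -[expR 1]expRK ler_ln ?posrE ?expR_gt0.
have ltp : 0 < ln t := lt_le_trans (expR_gt0 _) lt.
split => //; last by rewrite -[1]expRK ler_ln ?posrE ?expR_gt0.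
apply: le_trans t0; apply: le_trans (expR_ge1Dx _).
by rewrite lerDl expR_ge0.
Qed.

Lemma slope_gt0 (R : realType) (g t : R) : 0 < g -> slope_start R <= t ->
  0 < slope g t.
Proof.
move=> g0 /ln_slope_start[t1 _ ll].
by rewrite divr_gt0 ?mulr_gt0// (lt_le_trans ltr01).
Qed.

(** Multiplying [t] by [m > 1] adds to [ln (ln t)] at most [ln m / ln t < ln m <= m - 1 <= (m - 1) *
    ln (ln t)], less than the denominator gains. *)
Lemma slope_decr (R : realType) (g t t' : R) : 0 < g -> slope_start R <= t ->
  t < t' -> slope g t' < slope g t.
Proof.
move=> g0 t0 tt'; have [t1 l1 l2] := ln_slope_start t0.
have tp : 0 < t by rewrite (lt_le_trans ltr01).
have t'p : 0 < t' := lt_trans tp tt'.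
have lp : 0 < ln t by rewrite (lt_le_trans (expR_gt0 1)).
pose m := t' / t.
have m1 : 1 < m by rewrite ltr_pdivlMr// mul1r.
have m0 : 0 < m by rewrite (lt_trans ltr01).
have t'E : t' = m * t by rewrite /m divfK// gt_eqF.
have lm : 0 < ln m by rewrite ln_gt0.
have lt' : ln t' = ln t * (1 + ln m / ln t).
  rewrite t'E lnM ?posrE// mulrDr mulr1 [ln t * (_ / _)]mulrC divfK ?gt_eqF//.
  exact: addrC.
have up : ln (ln t') < m * ln (ln t).
  have h0 : 0 < 1 + ln m / ln t by rewrite ltr_wpDr// divr_ge0 ?ltW.
  rewrite lt' lnM ?posrE//.
  have h1 : ln (1 + ln m / ln t) <= ln m / ln t by apply: le_trans (lnB1_le h0) _; lra.
  have e1 : 1 < expR 1 :> R by rewrite expR_gt1.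
  have h2 : ln m / ln t < ln m.
    by rewrite ltr_pdivrMr// ltr_pMr// (lt_le_trans e1).
  have h3 := lnB1_le m0.
  have h4 : m - 1 <= (m - 1) * ln (ln t) by rewrite ler_peMr// subr_ge0 ltW.
  lra.
rewrite /slope t'E; have -> : ln (ln t) / (g * t) = m * ln (ln t) / (g * (m * t)).
  by field; rewrite !gt_eqF.
by rewrite -t'E ltr_pM2r// invr_gt0 mulr_gt0.
Qed.

Lemma cvg_slope (R : realType) (g : R) (t : nat -> R) : 0 < g ->
  t @ \oo --> +oo -> (fun n => slope g (t n)) @ \oo --> (0 : R).
Proof.
move=> g0 ty.
have t0 : \forall n \near \oo, slope_start R <= t n by move/cvgryPge : ty; exact.
apply: (@squeeze_cvgr _ _ _ _ (cst 0) (fun n => g^-1 * (ln (t n) / t n))).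
- near=> n; have tn : slope_start R <= t n by near: n.
  have [t1 l1 l2] := ln_slope_start tn.
  have tp : 0 < t n by rewrite (lt_le_trans ltr01).
  have lp : 0 < ln (t n) by rewrite (lt_le_trans (expR_gt0 1)).
  rewrite (ltW (slope_gt0 g0 tn))/= /slope.
  have -> : g^-1 * (ln (t n) / t n) = ln (t n) / (g * t n) by field; rewrite !gt_eqF.
  by rewrite ler_pM2r ?invr_gt0 ?mulr_gt0// ltW// ln_sublinear.
- exact: cvg_cst.
- by rewrite -(mulr0 g^-1); apply: cvgM; [exact: cvg_cst|exact: cvg_ln_div].
Unshelve. all: by end_near. Qed.

(** [ln (ln t)] varies slowly: a factor [m] in [t] adds only [ln (1 + ln m / ln t)] to it. *)
Lemma cvg_slope_ratio (R : realType) (g m : R) (t : nat -> R) : 0 < g -> 0 < m ->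
  t @ \oo --> +oo ->
  (fun n => slope g (t n * m) / slope g (t n)) @ \oo --> m^-1.
Proof.
move=> g0 m0 ty.
have t0 : \forall n \near \oo, slope_start R <= t n by move/cvgryPge : ty; exact.
have ly := cvgry_ln ty; have lly := cvgry_ln ly.
have a1 : (fun n => 1 + ln m * (ln (t n))^-1) @ \oo --> (1 : R).
  rewrite -[X in _ --> X]addr0 -(mulr0 (ln m)).
  apply: cvgD; first exact: cvg_cst.
  by apply: cvgM; [exact: cvg_cst|exact: cvgryV].
have L : (fun n => m^-1 * (1 + ln (1 + ln m * (ln (t n))^-1) * (ln (ln (t n)))^-1))
    @ \oo --> m^-1.
  rewrite -[X in _ --> X]mulr1; apply: cvgM; first exact: cvg_cst.
  rewrite -[X in _ --> X]addr0 -(mulr0 0); apply: cvgD; first exact: cvg_cst.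
  apply: cvgM; last exact: cvgryV.
  by rewrite -ln1; apply: continuous_cvg a1; exact: continuous_ln.
apply: cvg_trans L; apply: near_eq_cvg; near=> n.
have tn : slope_start R <= t n by near: n.
have [t1 l1 l2] := ln_slope_start tn.
have tp : 0 < t n by rewrite (lt_le_trans ltr01).
have lp : 0 < ln (t n) by rewrite (lt_le_trans (expR_gt0 1)).
have llp : 0 < ln (ln (t n)) by rewrite (lt_le_trans ltr01).
have a0 : 0 < 1 + ln m * (ln (t n))^-1.
  by near: n; apply: (cvgr_gt _ a1).
rewrite /slope lnM ?posrE//.
have -> : ln (t n) + ln m = ln (t n) * (1 + ln m * (ln (t n))^-1).
  by rewrite mulrDr mulr1 mulrCA mulfV ?gt_eqF// mulr1.
rewrite [in RHS]lnM ?posrE//.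
by field; rewrite !gt_eqF.
Unshelve. all: by end_near. Qed.

(** * Maximisers as the slope varies *)

Lemma argmax_seq (R : realType) (T : eqType) (f : T -> R) (s : seq T) (z : T) :
  z \in s -> exists2 x, x \in s & forall y, y \in s -> f y <= f x.
Proof.
elim: s z => // a s IH z _; case: s IH => [_|b s IH].
  by exists a; [rewrite inE|move=> y; rewrite inE => /eqP ->].
have [x xs H] := IH b (mem_head _ _).
have [ax|xa] := leP (f a) (f x).
  by exists x; [rewrite inE xs orbT|move=> y; rewrite inE => /orP[/eqP ->|/H]].
exists a; first exact: mem_head.
by move=> y; rewrite inE => /orP[/eqP ->|/H/le_trans]//; apply; exact: ltW.
Qed.

Section maximisers.
Context (disp : measure_display) (Omega : measurableType disp) (R : realType)
  (P : probability Omega R) (d : nat) (g : R) (xi : 'rV[int]_d -> {RV P >-> R}).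

Lemma is_maximiserE (t : R) (z : 'rV[int]_d) (w : Omega) :
  is_maximiser (Psi g (fun y => xi y w) t) z <->
  joint_maximiser xi (slope g t) (slope g t) z w.
Proof.
have E y : (Psi g (fun y => xi y w) t y <= Psi g (fun y => xi y w) t z) =
    (xi y w <= xi z w + penalty (slope g t) (slope g t) (l1norm z) (l1norm y)).
  have h k : k / (g * t) * ln (ln t) = k * slope g t by rewrite mulrAC mulrA.
  rewrite /Psi /penalty minxx !h mulrBl.
  by rewrite lerBlDr -addrA [- _ + _]addrC.
by split => H y; [rewrite -E|rewrite E]; exact: H.
Qed.

Lemma joint_maximiserE (c c' : R) (z : 'rV[int]_d) (w : Omega) :
  joint_maximiser xi c c' z w <->
  joint_maximiser xi c c z w /\ joint_maximiser xi c' c' z w.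
Proof.
split=> [H|[H1 H2] y].
  split=> y; apply: le_trans (H y) _; rewrite lerD2l /penalty minxx.
    by rewrite ge_min lexx.
  by rewrite ge_min lexx orbT.
have := H1 y; have := H2 y; rewrite /penalty !minxx -!lerBlDl => h1 h2.
by rewrite le_min h1 h2.
Qed.

Lemma joint_maximiser_between (c c' c'' : R) (z : 'rV[int]_d) (w : Omega) :
  c' <= c'' <= c -> joint_maximiser xi c c' z w -> joint_maximiser xi c'' c'' z w.
Proof.
move=> /andP[h1 h2] H y; apply: le_trans (H y) _; rewrite lerD2l /penalty minxx ge_min.
have [k0|k0] := leP 0 ((l1norm y)%:R - (l1norm z)%:R : R).
  by rewrite [X in _ || X]ler_wpM2l// orbT.
by rewrite ler_wnM2l// ltW.
Qed.

(** When the slope grows, the sites farther out than [z] lose further ground to [z], and the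
    remaining sites form a finite ball. Existence at arbitrarily small slopes thus gives existence
    at all slopes. *)
Lemma joint_maximiser_mono (c c' : R) (z : 'rV[int]_d) (w : Omega) : c <= c' ->
  joint_maximiser xi c c z w -> exists y, joint_maximiser xi c' c' y w.
Proof.
move=> cc' H; pose f y : R := xi y w - c' * (l1norm y)%:R.
have [|x xs Hx] := @argmax_seq _ _ f (lattice_ball d (l1norm z)) z.
  by rewrite mem_lattice_ball.
exists x => y; rewrite /penalty minxx.
suff : f y <= f x by rewrite /f; lra.
have [yz|zy] := leqP (l1norm y) (l1norm z); first by apply: Hx; rewrite mem_lattice_ball.
have zs : f z <= f x by apply: Hx; rewrite mem_lattice_ball.
apply: le_trans zs; have := H y; rewrite /penalty minxx /f => Hy.
have : 0 <= (c' - c) * ((l1norm y)%:R - (l1norm z)%:R).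
  by rewrite mulr_ge0// subr_ge0// ler_nat ltnW.
move: Hy; clear; lra.
Qed.

Lemma double_maximiser_eq (c : R) (z y : 'rV[int]_d) (w : Omega) :
  ~ double_maximiser xi c w ->
  joint_maximiser xi c c z w -> joint_maximiser xi c c y w -> z = y.
Proof.
move=> D Jz Jy; apply: contrapT => /eqP zy; apply: D.
by exists (z, y) => //=; rewrite (negbTE zy).
Qed.

Lemma same_maximiser_sub (a c c' c'' : R) : c'' <= c' -> c' <= c -> c <= a ->
  same_maximiser xi a c'' `<=` same_maximiser xi c c'.
Proof.
move=> h1 h2 h3 w [z _ J]; exists z => //; apply/joint_maximiserE; split.
  by apply: joint_maximiser_between J; rewrite (le_trans h1).
by apply: joint_maximiser_between J; rewrite h1 (le_trans h2).
Qed.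

(** A joint maximiser must be [z], by uniqueness at [c]. But [y] is strictly worse than [z] at [c]
    and no worse at [c'], so it lies farther out and is strictly better at [c'']. At [c'] itself the
    two may tie, hence the third slope. *)
Lemma overtaken (c c' c'' : R) (z y x : 'rV[int]_d) (w : Omega) :
  c'' < c' -> c' < c -> ~ double_maximiser xi c w ->
  joint_maximiser xi c c z w -> joint_maximiser xi c' c' y w -> y <> z ->
  ~ joint_maximiser xi c c'' x w.
Proof.
move=> c2 c1 D Jz Jy yz /joint_maximiserE[Jx1 Jx2].
have zx := double_maximiser_eq D Jz Jx1; subst x.
have : xi y w - c * (l1norm y)%:R <= xi z w - c * (l1norm z)%:R.
  by have := Jz y; rewrite /penalty minxx; lra.
(* Equality would make [y] a second maximiser for [c]. *)
rewrite le_eqVlt => /orP[/eqP xy|yx].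
  apply: yz; apply: esym; apply: (double_maximiser_eq D Jz) => v.
  by have := Jz v; rewrite /penalty !minxx; lra.
have h1 := Jy z; have h2 := Jx2 y; move: h1 h2; rewrite /penalty !minxx => h1 h2.
have h3 : 0 < (c - c') * ((l1norm y)%:R - (l1norm z)%:R) by lra.
have h4 : 0 < (l1norm y)%:R - (l1norm z)%:R :> R.
  by move: h3; rewrite pmulr_rgt0// subr_gt0.
have : 0 < (c' - c'') * ((l1norm y)%:R - (l1norm z)%:R).
  by rewrite mulr_gt0// subr_gt0.
lra.
Qed.

End maximisers.

(** * Persistence of the maximiser in time *)

Lemma ge_cvg_lim (R : realType) (u : nat -> R) (l a : R) : u @ \oo --> l ->
  (\forall n \near \oo, a <= u n) -> a <= l.
Proof.
move=> ul H; rewrite -(cvg_lim (@norm_hausdorff _ _) ul).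
by apply: limr_ge => //; apply/cvg_ex; exists l.
Qed.

Lemma le_cvg_lim (R : realType) (u : nat -> R) (l a : R) : u @ \oo --> l ->
  (\forall n \near \oo, u n <= a) -> l <= a.
Proof.
move=> ul H; rewrite -(cvg_lim (@norm_hausdorff _ _) ul).
by apply: limr_le => //; apply/cvg_ex; exists l.
Qed.

Section persistence_limit.
Context (disp : measure_display) (Omega : measurableType disp) (R : realType)
  (P : probability Omega R) (d : nat) (g : R) (xi : 'rV[int]_d -> {RV P >-> R})
  (d0 : (0 < d)%N) (g0 : 0 < g) (ind : mutually_independent xi)
  (wei : forall z, weibull_distributed g (xi z)).

Lemma cvg_prob_same_maximiser (theta : R) (c c' : nat -> R) : 0 < theta <= 1 ->
  (\forall n \near \oo, 0 < c' n <= c n) -> c @ \oo --> (0 : R) ->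
  (fun n => c' n / c n) @ \oo --> theta ->
  (fun n => prob P (same_maximiser xi (c n) (c' n))) @ \oo --> persistence d theta.
Proof.
move=> t01 cc' cc ct.
have c1 : \forall n \near \oo, c n < 1 by exact: (cvgr_lt _ cc _ ltr01).
have [N _ HN] : \forall n \near \oo, 0 < c' n <= c n /\ c n < 1.
  by near=> n; split; near: n.
have [||||r S] := @exists_scaling R d g theta (fun n => c (n + N)%N)
  (fun n => c' (n + N)%N) d0 g0 t01.
- by move=> n; have [] := HN (n + N)%N (leq_addl _ _).
- by move=> n; have [] := HN (n + N)%N (leq_addl _ _).
- by have := cc; rewrite -(cvg_shiftn N).
- by have := ct; rewrite -(cvg_shiftn N).
rewrite -(cvg_shiftn N).
exact: cvg_same_maximiser d0 ind wei S.
Unshelve. all: by end_near. Qed.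

Lemma cvg_prob_same_slope (m : R) (t : nat -> R) : 1 <= m -> t @ \oo --> +oo ->
  (fun n => prob P (same_maximiser xi (slope g (t n)) (slope g (t n * m)))) @ \oo
    --> persistence d m^-1.
Proof.
move=> m1 ty; have m0 : 0 < m by rewrite (lt_le_trans ltr01).
apply: cvg_prob_same_maximiser; first by rewrite invr_gt0 m0 invf_le1.
- have t0 : \forall n \near \oo, slope_start R <= t n by move/cvgryPge : ty; exact.
  near=> n; have tn : slope_start R <= t n by near: n.
  have tm : t n <= t n * m by rewrite ler_peMr// ltW// (lt_le_trans (expR_gt0 _) tn).
  rewrite slope_gt0//=; last exact: le_trans tm.
  move: tm; rewrite le_eqVlt => /orP[/eqP <-//|tm].
  exact/ltW/slope_decr.
- exact: cvg_slope.
- exact: cvg_slope_ratio.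
Unshelve. all: by end_near. Qed.

(** Along slopes tending to 0 the probability tends to [persistence d 1 = 1], and by
    [joint_maximiser_mono] it does not decrease as the slope grows. *)
Lemma prob_exists_maximiser (c : R) : 0 < c -> prob P (same_maximiser xi c c) = 1.
Proof.
move=> c0; apply/eqP; rewrite eq_le prob_le1/=; last exact: measurable_same_maximiser.
have hc := @cvg_harmonic R.
have h0 n : 0 < @harmonic R n by rewrite /harmonic /= invr_gt0.
have h1 : (fun n => prob P (same_maximiser xi (harmonic n) (harmonic n))) @ \oo --> (1 : R).
  rewrite -(persistence1 R d0); apply: cvg_prob_same_maximiser => //.
  - by rewrite ltr01 lexx.
  - by apply: nearW => n; rewrite h0 lexx.
  - by under eq_fun do rewrite divff ?gt_eqF//; exact: cvg_cst.
have h2 : \forall n \near \oo, harmonic n < c by exact: (cvgr_lt _ hc _ c0).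
apply: (le_cvg_lim h1).
near=> n; apply: prob_le; [exact: measurable_same_maximiser..|].
move=> w [z _ Jz]; have hn : harmonic n < c by near: n.
by have [y Jy] := joint_maximiser_mono (ltW hn) Jz; exists y.
Unshelve. all: by end_near. Qed.

(** A single null set for all slopes: by monotonicity, a sequence of slopes tending to 0 decides. *)
Lemma negligible_no_maximiser :
  P.-negligible [set w | exists2 c, 0 < c & ~ same_maximiser xi c c w].
Proof.
have : P.-negligible (\bigcup_n ~` same_maximiser xi (harmonic n) (harmonic n)).
  apply: negligible_bigcup => n.
  have mS := measurable_same_maximiser xi (harmonic n) (harmonic n).
  exists (~` same_maximiser xi (harmonic n) (harmonic n)).
  split => //; first exact: measurableC.
  apply: (etrans (probE P (measurableC mS))).
  by rewrite prob_setC// prob_exists_maximiser ?subrr// invr_gt0.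
apply: negligibleS => w [c c0 Sc].
have [n _ /(_ n (leqnn _)) hn] := cvgr_lt _ (@cvg_harmonic R) _ c0.
exists n => // -[z _ Jz]; apply: Sc.
by have [y Jy] := joint_maximiser_mono (ltW hn) Jz; exists y.
Qed.

(** Integer delays suffice: a site maximising at two slopes also maximises at the
slopes in between. *)
Definition frozen (t : R) : set Omega :=
  \bigcap_n same_maximiser xi (slope g t) (slope g (t + n.+1%:R)).

Lemma slope_homo (t t' : R) : slope_start R <= t -> t <= t' -> slope g t' <= slope g t.
Proof. by move=> ts; rewrite le_eqVlt => /orP[/eqP ->//|/(slope_decr g0 ts)/ltW]. Qed.

Lemma measurable_frozen t : measurable (frozen t).
Proof. by apply: bigcapT_measurable => n; exact: measurable_same_maximiser. Qed.

Lemma frozen_sub (t t' m : R) : slope_start R <= t -> t <= t' -> 1 <= m ->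
  frozen t `<=` same_maximiser xi (slope g t') (slope g (t' * m)).
Proof.
move=> ts tt' m1 w F; have [n] : exists n : nat, t' * m <= t + n.+1%:R.
  exists (Num.truncn (t' * m)); rewrite ltW// (lt_le_trans (truncnS_gt _))//.
  by rewrite lerDr (le_trans _ ts)// expR_ge0.
move=> h; have := F n I; apply: same_maximiser_sub.
- apply: slope_homo h; rewrite (le_trans (le_trans ts tt'))// ler_peMr//.
  by rewrite (le_trans _ (le_trans ts tt'))// expR_ge0.
- apply: slope_homo; first exact: le_trans tt'.
  by rewrite ler_peMr// (le_trans _ (le_trans ts tt'))// expR_ge0.
- exact: slope_homo.
Qed.

(** A maximiser frozen from [t] on survives every later window from [t'] to [t' * m], an event of
    limiting probability [persistence d m^-1]; then [m] tends to infinity. *)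
Lemma negligible_frozen (t : R) : slope_start R <= t -> P.-negligible (frozen t).
Proof.
move=> ts; have mF := measurable_frozen t.
exists (frozen t); split => //.
rewrite probE//; congr (_%:E); apply/eqP; rewrite eq_le prob_ge0 andbT.
have H n : prob P (frozen t) <= persistence d (harmonic n : R).
  have ty : (fun k => t + k%:R) @ \oo --> +oo.
    apply/cvgryPge => A; near=> k; have : A - t <= k%:R by near: k; exact: nbhs_infty_ger.
    lra.
  have n1 : 1 <= n.+1%:R :> R by rewrite ler1n.
  apply: (ge_cvg_lim (cvg_prob_same_slope n1 ty)).
  near=> k; apply: prob_le => //; first exact: measurable_same_maximiser.
  by apply: frozen_sub => //; rewrite lerDl.
have L : (fun n => persistence d (harmonic n : R)) @ \oo --> (0 : R).
  apply: cvg_persistence0 => //; last exact: cvg_harmonic.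
  by move=> n; rewrite /harmonic /= invr_gt0 ltr0n/= invf_le1 ?ltr0n// ler1n.
by apply: (ge_cvg_lim L); near=> n; exact: H.
Unshelve. all: by end_near. Qed.

End persistence_limit.

(** * The time of the first change *)

Lemma measurable_fun_ereal_inf_countable (disp : measure_display)
    (T : measurableType disp) (R : realType) (U : Type) (F : U -> T -> \bar R) :
  countable [set: U] -> (forall i, measurable_fun setT (F i)) ->
  measurable_fun setT (fun w => ereal_inf (range (F ^~ w))).
Proof.
move=> cU mF mT; apply: (measurability _ (ErealGenCInfty.measurableE R)) => //.
move=> _ [_ [x ->] <-]; rewrite setTI.
rewrite (_ : _ @^-1` _ = \bigcap_i (F i @^-1` `[x%:E, +oo[)).
  apply: bigcap_countable_measurable => // i; rewrite -[X in measurable X]setTI.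
  exact: (mF i measurableT _ (emeasurable_itv _)).
apply/seteqP; split => w /=; rewrite in_itv/= andbT.
  by move=> /ereal_infP H i _ /=; rewrite in_itv/= andbT; apply: H; exists i.
move=> H; apply/ereal_infP => _ [i _ <-].
by have /= := H i I; rewrite in_itv/= andbT.
Qed.

Section change_law.
Context (disp : measure_display) (Omega : measurableType disp) (R : realType)
  (P : probability Omega R) (d : nat) (g : R) (xi : 'rV[int]_d -> {RV P >-> R}).

Definition persists (t s : R) : set Omega :=
  same_maximiser xi (slope g t) (slope g (t + s)).

(** A measurable version of the first change after time [t]: the infimum over
the positive rational delays, [+oo] marking the delays before the change. *)
Definition rational_change (t : R) (w : Omega) : \bar R :=
  ereal_inf (range (fun q : rat =>
    if (0 < q) && (w \notin persists t (ratr q)) then (ratr q)%:E else +oo%E)).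

(** [fine] sends [+oo] to 0; for large [t] this can only happen on the null event [frozen]. *)
Definition scaled_change (t : R) (w : Omega) : R := fine (rational_change t w) * t^-1.

Lemma measurable_scaled_change t : measurable_fun setT (scaled_change t).
Proof.
apply: measurable_funM => //; apply: measurableT_comp => //.
apply: measurable_fun_ereal_inf_countable; first exact: countableP.
move=> q; apply: measurable_fun_ifT => //.
apply: (measurable_fun_bool true); rewrite setTI.
have mS : measurable (persists t (ratr q)) by exact: measurable_same_maximiser.
case: (0 < q); last first.
  by rewrite (_ : _ @^-1` _ = set0)//; apply/seteqP; split.
rewrite (_ : _ @^-1` _ = ~` persists t (ratr q)); first exact: measurableC.
by apply/seteqP; split => w /=; [move/negP => h /mem_set|move=> h; apply/negP => /set_mem].
Qed.

HB.instance Definition _ t := @isMeasurableFun.Build _ _ _ _ (scaled_change t)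
  (@measurable_scaled_change t).

Lemma rational_change_ge0 t w : (0 <= rational_change t w)%E.
Proof.
apply/ereal_infP => _ [q _ <-]; case: ifP => [/andP[q0 _]|_]; last exact: leey.
by rewrite lee_fin ler0q ltW.
Qed.

Lemma persists_sub (t s s' : R) : 0 < g -> slope_start R <= t -> 0 <= s <= s' ->
  persists t s' `<=` persists t s.
Proof.
move=> g0 ts /andP[s0 ss']; apply: same_maximiser_sub => //.
  by apply: slope_homo => //; [rewrite (le_trans ts)// lerDl|rewrite lerD2l].
by apply: slope_homo => //; rewrite lerDl.
Qed.

(** Persistence then fails at every delay beyond [x] as well, in particular at rationals arbitrarily
    close to [x]. *)
Lemma rational_change_le (t x : R) w : 0 < g -> slope_start R <= t -> 0 <= x ->
  ~ persists t x w -> (rational_change t w <= x%:E)%E.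
Proof.
move=> g0 ts x0 nx; apply/lee_addgt0Pr => e e0.
have : x < x + e by rewrite ltrDl.
move=> /rat_in_itvoo[q]; rewrite in_itv/= => /andP[xq qe].
apply: ge_ereal_inf; exists (ratr q)%:E; last by rewrite -EFinD lee_fin ltW.
exists q => //; rewrite ifT// -(ltr0q R) (le_lt_trans x0)//=.
apply/negP => /set_mem h; apply: nx; apply: persists_sub h => //.
by rewrite x0 ltW.
Qed.

Lemma rational_change_lt (t x : R) w : 0 < g -> slope_start R <= t ->
  (rational_change t w < x%:E)%E -> ~ persists t x w.
Proof.
move=> g0 ts /ereal_inf_lt[_ [q _ <-]]; case: ifP => [/andP[q0 nq]|_]; last by [].
rewrite lte_fin => qx px; move/negP : nq; apply; apply/mem_set.
by apply: persists_sub px => //; rewrite ler0q !ltW.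
Qed.

Lemma rational_change_fin_num t w : 0 < g -> slope_start R <= t ->
  ~ frozen g xi t w -> rational_change t w \is a fin_num.
Proof.
move=> g0 ts nF; rewrite ge0_fin_numE ?rational_change_ge0//.
have [n nn] : exists n, ~ persists t n.+1%:R w.
  by apply/existsNP => H; apply: nF => n _; exact: H.
exact: le_lt_trans (rational_change_le g0 ts _ nn) (ltry _).
Qed.

(** At a rational delay where no site maximises for both slopes, [Z] has changed. Conversely, once
    [Z] has moved away, [overtaken] excludes persistence at every later delay. Uniqueness is assumed
    at time [t] only, because it cannot be had at all later times simultaneously. *)
Lemma change_timeE (Z : R -> Omega -> 'rV[int]_d) (t : R) (w : Omega) :
  0 < g -> slope_start R <= t -> ~ double_maximiser xi (slope g t) w ->
  (forall s, 0 <= s ->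
     joint_maximiser xi (slope g (t + s)) (slope g (t + s)) (Z (t + s) w) w) ->
  change_time Z t w = rational_change t w.
Proof.
move=> g0 ts nD HZ.
have HZt : joint_maximiser xi (slope g t) (slope g t) (Z t w) w.
  by have := HZ 0; rewrite addr0; apply.
have later s s' : 0 <= s -> s < s' -> slope g (t + s') < slope g (t + s).
  by move=> s0 ss'; apply: slope_decr; rewrite ?ltrD2l// (le_trans ts)// lerDl.
apply/eqP; rewrite eq_le; apply/andP; split.
  apply/ereal_infP => _ [q _ <-]; case: ifP => [/andP[q0 nq]|_]; last exact: leey.
  apply: ereal_inf_lbound; exists (ratr q) => //=; split; first by rewrite ltr0q.
  move=> Zq; move/negP : nq; apply; apply/mem_set; exists (Z t w) => //.
  apply/joint_maximiserE; split => //; rewrite -Zq.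
  by apply: HZ; rewrite ler0q ltW.
(* At the delay [s] itself the old maximiser may still tie with the new one, so persistence is
   refuted at [s + e]. *)
apply/ereal_infP => _ [s [s0 Zs] <-]; apply/lee_addgt0Pr => e e0.
have : s < s + e by rewrite ltrDl.
move=> se; rewrite -EFinD; apply: rational_change_le => //.
  by rewrite addr_ge0 ?ltW.
move=> [x _]; apply: (overtaken _ _ nD HZt (HZ s (ltW s0)) Zs); last first.
  by have := later 0 s; rewrite addr0; exact.
by apply: later => //; exact: ltW.
Qed.

End change_law.

(** * The limit law *)

(** The dimension is [d.+1] because the structure instances below leave no room for the hypothesis
    [0 < d]. At negative [x] the maximum gives [1 - persistence d.+1 1 = 0]. *)
Definition limit_cdf (R : realType) (d : nat) (x : R) : R :=
  1 - persistence d.+1 (1 + Num.max x 0)^-1.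

Lemma cvg_limit_cdf (R : realType) (d : nat) (x : R) (u : nat -> R) :
  u @ \oo --> x -> (fun n => limit_cdf d (u n)) @ \oo --> limit_cdf d x.
Proof.
move=> ux; apply: cvgB; first exact: cvg_cst.
(* Capping the sequence keeps the ratios away from 0, as [cvg_persistence] requires; eventually the
   cap is inactive. *)
pose v n : R := Num.min (Num.max (u n) 0) (Num.max x 0 + 1).
have mx : 0 <= Num.max x 0 by rewrite le_max lexx orbT.
have mu : (fun n => Num.max (u n) 0) @ \oo --> Num.max x 0.
  have E y : Num.max y 0 = - Num.min (- y) 0 :> R by rewrite oppr_min opprK oppr0.
  by rewrite E; under eq_fun do rewrite E; apply: cvgN; apply: cvg_minr; [exact: cvgN|exact: cvg_cst].
have vx : v @ \oo --> Num.max x 0.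
  rewrite -[X in _ --> X](_ : Num.min (Num.max x 0) (Num.max x 0 + 1) = _); last first.
    by rewrite min_l// lerDl.
  by apply: cvg_minr; [exact: mu|exact: cvg_cst].
have v0 n : 0 <= v n by rewrite le_min addr_ge0// le_max lexx orbT.
have x0 : 0 < 1 + Num.max x 0 by rewrite ltr_wpDr.
have L : (fun n => persistence d.+1 (1 + v n)^-1) @ \oo -->
    persistence d.+1 (1 + Num.max x 0)^-1.
  apply: (@cvg_persistence R d.+1 (1 + (Num.max x 0 + 1))^-1).
  - by [].
  - by rewrite invr_gt0 ltr_wpDr// addr_ge0.
  - by rewrite invr_gt0 x0 invf_le1// lerDl.
  - move=> n; have vp : 0 < 1 + v n by rewrite ltr_wpDr.
    rewrite lef_pV2 ?posrE//; last by rewrite ltr_wpDr// addr_ge0.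
    by rewrite lerD2l ge_min lexx orbT/= invf_le1// lerDl.
  - apply: cvgV; first by rewrite gt_eqF.
    by apply: cvgD; [exact: cvg_cst|exact: vx].
apply: cvg_trans L; apply: near_eq_cvg.
have H : \forall n \near \oo, Num.max (u n) 0 <= Num.max x 0 + 1.
  by apply: (cvgr_le _ mu); rewrite ltrDl.
near=> n; rewrite /v min_l//; near: n; exact: H.
Unshelve. all: by end_near. Qed.

Lemma limit_cdf_homo (R : realType) (d : nat) : nondecreasing (@limit_cdf R d).
Proof.
move=> x y xy; have m0 z : 0 < 1 + Num.max z 0 :> R.
  by rewrite ltr_wpDr// le_max lexx orbT.
rewrite lerD2l lerN2; apply: persistence_homo => //.
- by rewrite invr_gt0 m0.
- rewrite lef_pV2 ?posrE// lerD2l ge_max !le_max xy/=.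
  by rewrite lexx orbT.
- by rewrite invf_le1// lerDl le_max lexx orbT.
Qed.

Lemma limit_cdf_right_continuous (R : realType) (d : nat) :
  right_continuous (@limit_cdf R d).
Proof. by move=> x; apply/cvg_at_rightP => u [_ /cvg_limit_cdf]; exact. Qed.

Lemma limit_cdf0 (R : realType) (d : nat) (x : R) : x <= 0 -> limit_cdf d x = 0.
Proof. by move=> x0; rewrite /limit_cdf max_r// addr0 invr1 persistence1// subrr. Qed.

Lemma limit_cdf_lt1 (R : realType) (d : nat) (x : R) : limit_cdf d x < 1.
Proof.
rewrite gtrBl persistence_gt0//.
have m0 : 0 <= Num.max x 0 by rewrite le_max lexx orbT.
by rewrite invr_gt0 ltr_wpDr//= invf_le1 ?lerDl// ltr_wpDr.
Qed.

Lemma limit_cdfNy (R : realType) (d : nat) : @limit_cdf R d @ -oo --> (0 : R).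
Proof.
apply/cvg_ninftyP => u uy; apply: cvg_near_cst.
have : \forall n \near \oo, u n <= 0 by move/cvgrNyPle : uy; exact.
by apply: filterS => n u0; exact: limit_cdf0.
Qed.

Lemma limit_cdfy (R : realType) (d : nat) : @limit_cdf R d @ +oo --> (1 : R).
Proof.
apply/cvg_pinftyP => u uy.
have m0 n : 0 <= Num.max (u n) 0 by rewrite le_max lexx orbT.
have m1 n : 0 < 1 + Num.max (u n) 0 by rewrite ltr_wpDr.
rewrite -[X in _ --> X]subr0; apply: cvgB; first exact: cvg_cst.
apply: cvg_persistence0 => //.
  by move=> n; rewrite invr_gt0 m1 invf_le1// lerDl m0.
apply: cvgryV; apply/cvgryPge => A; near=> n.
have : A <= u n by near: n; move/cvgryPge : uy; exact.
move=> h; rewrite (le_trans h)// (@le_trans _ _ (Num.max (u n) 0))//.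
  by rewrite le_max lexx.
by rewrite lerDr.
Unshelve. all: by end_near. Qed.

HB.instance Definition _ (R : realType) (d : nat) := isCumulative.Build R _ R
  (@limit_cdf R d) (@limit_cdf_homo R d) (@limit_cdf_right_continuous R d).

HB.instance Definition _ (R : realType) (d : nat) := isCumulativeBounded.Build R 0 1
  (@limit_cdf R d) (@limit_cdfNy R d) (@limit_cdfy R d).

Section change_limit.
Context (disp : measure_display) (Omega : measurableType disp) (R : realType)
  (P : probability Omega R) (d : nat) (g : R) (xi : 'rV[int]_d.+1 -> {RV P >-> R})
  (g0 : 0 < g) (ind : mutually_independent xi)
  (wei : forall z, weibull_distributed g (xi z)).

Let Y t : {RV P >-> R} := scaled_change g xi t.

Lemma scaled_changeE (t : R) w : slope_start R <= t -> ~ frozen g xi t w ->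
  (scaled_change g xi t w * t)%:E = rational_change g xi t w.
Proof.
move=> ts nF; rewrite /scaled_change divfK; last first.
  by rewrite gt_eqF// (lt_le_trans _ ts)// expR_gt0.
by rewrite fineK// rational_change_fin_num.
Qed.

Lemma prob_scaled_change_ge (t x : R) : slope_start R <= t -> 0 <= x ->
  1 - prob P (persists g xi t (t * x)) <= prob P (Y t @^-1` `]-oo, x]).
Proof.
move=> ts x0; have t0 : 0 < t by rewrite (lt_le_trans _ ts)// expR_gt0.
have mS : measurable (persists g xi t (t * x)) by exact: measurable_same_maximiser.
have mY : measurable (Y t @^-1` `]-oo, x]) by exact: rv_level_measurable.
have mF := measurable_frozen g xi t.
rewrite -prob_setC//.
have /(prob_negligible mF) F0 := negligible_frozen (ltn0Sn d) g0 ind wei ts.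
rewrite -[leRHS]addr0 -F0.
apply: le_trans (prob_setU_le P mY mF); apply: prob_le => //.
- exact: measurableC.
- exact: measurableU.
move=> w nS; have [F|nF] := pselect (frozen g xi t w); [by right|left].
rewrite /= in_itv/= -(ler_pM2r t0) -lee_fin scaled_changeE// [x * t]mulrC.
by apply: rational_change_le => //; rewrite mulr_ge0// ltW.
Qed.

(** At a delay equal to the change time a tie may still count as persistence, hence the larger [x'];
    continuity of [limit_cdf] closes the gap. *)
Lemma prob_scaled_change_le (t x x' : R) : slope_start R <= t -> x < x' ->
  prob P (Y t @^-1` `]-oo, x]) <= 1 - prob P (persists g xi t (t * x')).
Proof.
move=> ts xx'; have t0 : 0 < t by rewrite (lt_le_trans _ ts)// expR_gt0.
have mS : measurable (persists g xi t (t * x')) by exact: measurable_same_maximiser.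
have mY : measurable (Y t @^-1` `]-oo, x]) by exact: rv_level_measurable.
have mF := measurable_frozen g xi t.
have mSC := measurableC mS.
rewrite -prob_setC//.
have /(prob_negligible mF) F0 := negligible_frozen (ltn0Sn d) g0 ind wei ts.
rewrite -[leRHS]addr0 -F0.
apply: le_trans (prob_setU_le P mSC mF); apply: prob_le => //.
- exact: measurableU.
move=> w /= Yx; have [F|nF] := pselect (frozen g xi t w); [by right|left].
apply: rational_change_lt => //; rewrite -scaled_changeE// lte_fin.
by move: Yx; rewrite in_itv/= => /le_lt_trans/(_ xx'); rewrite mulrC ltr_pM2l.
Qed.

Lemma cvg_cdf_scaled_change (x : R) :
  cdf (Y t) x @[t --> +oo] --> (limit_cdf d x)%:E.
Proof.
apply/cvge_pinftyP => t ty.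
have cdfE n : cdf (Y (t n)) x = (prob P (Y (t n) @^-1` `]-oo, x]))%:E.
  by rewrite -probE//; exact: rv_level_measurable.
under eq_fun do rewrite cdfE.
suff H : (fun n => prob P (Y (t n) @^-1` `]-oo, x])) @ \oo --> limit_cdf d x.
  by apply: cvg_EFin; [exact: nearW|exact: H].
have [x0|x0] := ltP x 0.
  rewrite limit_cdf0; last exact: ltW.
  apply: cvg_near_cst; near=> n.
  have tn : slope_start R <= t n by near: n; move/cvgryPge : ty; exact.
  rewrite /prob (_ : _ @^-1` _ = set0) ?measure0//; apply/seteqP; split => // w.
  rewrite /= in_itv/= leNgt (lt_le_trans x0)// mulr_ge0//.
    by apply: fine_ge0; exact: rational_change_ge0.
  by rewrite invr_ge0 (le_trans _ tn)// expR_ge0.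
have lim y : 0 <= y -> (fun n => 1 - prob P (persists g xi (t n) (t n * y))) @ \oo -->
    limit_cdf d y.
  move=> y0; rewrite /limit_cdf max_l//; apply: cvgB; first exact: cvg_cst.
  have y1 : 1 <= 1 + y by rewrite lerDl.
  have := cvg_prob_same_slope (ltn0Sn d) g0 ind wei y1 ty.
  by under eq_fun do rewrite mulrDr mulr1.
apply/cvgrPdist_le => e e0.
have e2 : 0 < e / 2 by rewrite divr_gt0.
(* Some [harmonic k] provides the point just above [x] that the upper bound calls for. *)
have hc : (fun k => x + harmonic k) @ \oo --> x.
  rewrite -[X in _ --> X]addr0; apply: cvgD; [exact: cvg_cst|exact: cvg_harmonic].
have [k _ /(_ k (leqnn _)) /= hk] : \forall k \near \oo,
    limit_cdf d (x + harmonic k) <= limit_cdf d x + e / 2.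
  by apply: (cvgr_le _ (cvg_limit_cdf hc)); rewrite ltrDl.
have xk : x < x + harmonic k by rewrite ltrDl invr_gt0.
have H1 : \forall n \near \oo, limit_cdf d x - e <=
    1 - prob P (persists g xi (t n) (t n * x)).
  by apply: (cvgr_ge _ (lim x x0)); rewrite gtrBl.
have H2 : \forall n \near \oo, 1 - prob P (persists g xi (t n) (t n * (x + harmonic k)))
    <= limit_cdf d (x + harmonic k) + e / 2.
  by apply: (cvgr_le _ (lim _ (le_trans x0 (ltW xk)))); rewrite ltrDl.
near=> n.
have tn : slope_start R <= t n by near: n; move/cvgryPge : ty; exact.
have h1 : limit_cdf d x - e <= 1 - prob P (persists g xi (t n) (t n * x)) by near: n.
have h2 : 1 - prob P (persists g xi (t n) (t n * (x + harmonic k)))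
    <= limit_cdf d (x + harmonic k) + e / 2 by near: n.
have h3 := prob_scaled_change_ge tn x0; have h4 := prob_scaled_change_le tn xk.
move: h1 h2 h3 h4 hk.
move: (prob _ _) (prob _ _) (prob _ _) (limit_cdf d (x + _)) (limit_cdf d x) => p1 p2 p3 l1 l2.
by clear; rewrite ler_norml => *; apply/andP; split; lra.
Unshelve. all: by end_near. Qed.

End change_limit.

Definition limit_law (R : realType) (d : nat) : probability (measurableTypeR R) R :=
  lebesgue_stieltjes_measure (@limit_cdf R d).

Definition limit_time (R : realType) : measurableTypeR R -> R := idfun.

HB.instance Definition _ (R : realType) := @isMeasurableFun.Build _ _ _ _
  (@limit_time R) (@measurable_id _ _ setT).

Lemma cdf_limit_time (R : realType) (d : nat) (x : R) :
  cdf (@limit_time R : {RV limit_law R d >-> R}) x = (limit_cdf d x)%:E.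
Proof. exact: cdf_lebesgue_stieltjes_id. Qed.

Lemma limit_time_gt0 (R : realType) (d : nat) :
  {ae limit_law R d, forall w, 0 < limit_time w}.
Proof.
exists (@limit_time R @^-1` `]-oo, 0]); split.
- exact: (@measurable_funPTI _ _ _ _ (@limit_time R)).
- by have := cdf_limit_time d (0 : R); rewrite limit_cdf0.
- by move=> w /= /negP; rewrite -leNgt in_itv.
Qed.

(** A constant [c] would force the distribution function to equal 1 at [c], which [limit_cdf_lt1]
    excludes. *)
Lemma limit_time_nondegenerate (R : realType) (d : nat) :
  nondegenerate_rv (@limit_time R : {RV limit_law R d >-> R}).
Proof.
move=> c [N [mN N0 H]].
have mA : measurable (@limit_time R @^-1` `]-oo, c]).
  exact: (@measurable_funPTI _ _ _ _ (@limit_time R)).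
have : (limit_law R d setT <= limit_law R d (@limit_time R @^-1` `]-oo, c] `|` N))%E.
  apply: le_measure; rewrite ?inE//; first exact: measurableU.
  move=> w _; have [wc|wc] := pselect (limit_time w = c); last by right; exact: H.
  by left; rewrite /= in_itv/= wc.
rewrite probability_setT; apply/negP; rewrite -ltNge.
apply: (@le_lt_trans _ _ (limit_cdf d c)%:E); last by rewrite lte_fin limit_cdf_lt1.
rewrite -cdf_limit_time -[leRHS]adde0 -N0.
exact: measureU2.
Qed.

Theorem theorem1p3 (R : realType) (d : nat) (hd : (1 <= d)%N)
    (gamma : R) (hgamma : 0 < gamma)
    (disp : measure_display) (Omega : measurableType disp)
    (P : probability Omega R)
    (xi : 'rV[int]_d -> {RV P >-> R})
    (xi_indep : mutually_independent xi)
    (xi_weibull : forall z, weibull_distributed gamma (xi z))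
    (Z : R -> Omega -> 'rV[int]_d)
    (Z_max : maximiser_choice gamma (fun w z => xi z w) Z) :
  exists (disp' : measure_display) (Omega' : measurableType disp')
         (P' : probability Omega' R) (Theta : {RV P' >-> R}),
    [/\ {ae P', forall w, 0 < Theta w},
        nondegenerate_rv Theta &
        ae_cvg_in_distribution P
          (fun t w => (change_time Z t w * (t^-1)%:E)%E) Theta].
Proof.
case: d hd xi xi_indep xi_weibull Z Z_max => // d _ xi ind wei Z [T [Treal HT]].
exists _, (measurableTypeR R), (limit_law R d), (@limit_time R).
split; [exact: limit_time_gt0|exact: limit_time_nondegenerate|].
exists (fun t => scaled_change gamma xi t : {RV P >-> R}); last first.
  by move=> x _; rewrite cdf_limit_time; exact: cvg_cdf_scaled_change.
have Tt : \forall t \near +oo, T < t by exact: nbhs_pinfty_gt.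
have st : \forall t \near +oo, slope_start R <= t.
  exact: nbhs_pinfty_ge (num_real _).
near=> t.
have tT : T < t by near: t.
have ts : slope_start R <= t by near: t.
have t0 : 0 < t by rewrite (lt_le_trans _ ts)// expR_gt0.
(* Off these three null sets, maximisers exist at [t] and at all later times, the one at [t] is
   unique, and it is eventually replaced. *)
have N1 := negligible_no_maximiser (ltn0Sn d) hgamma ind wei.
have N2 := negligible_double_maximiser (slope gamma t) hgamma ind wei.
have N3 := negligible_frozen (ltn0Sn d) hgamma ind wei ts.
apply: negligibleS (negligibleU (negligibleU N1 N2) N3) => w /= E.
apply: contrapT => /not_orP[/not_orP[nN1 nD] nF]; apply: E.
rewrite (change_timeE hgamma ts nD).
  by rewrite -(scaled_changeE hgamma ts nF) -EFinM mulfK// gt_eqF.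
move=> s s0; apply/is_maximiserE; apply: HT; first by rewrite (lt_le_trans tT)// lerDl.
have : same_maximiser xi (slope gamma (t + s)) (slope gamma (t + s)) w.
  apply: contrapT => nS; apply: nN1; exists (slope gamma (t + s)) => //.
  by rewrite slope_gt0// (le_trans ts)// lerDl.
by move=> [z _ Jz]; exists z; apply/is_maximiserE.
Unshelve. all: by end_near. Qed.
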